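(* Let $p$ be a prime, $m\geq 3$ an odd integer, $q=p^m$, and let $a\in\mathbf{F}_q^*$ be an element that is not a $(p^{(m-1)/2}-1)$-th power in $\mathbf{F}_q^*$. Then the curve $C_m$ over $\mathbf{F}_q$ defined by $$y^{q-1}=-\frac{\big(x^{p^{(m+1)/2}}-a^{p^{(m+1)/2}}x\big)^{p^{(m-1)/2}}}{a x^{p^{(m-1)/2}}-x}$$ has genus $$g(C_m)=\frac{1}{2}\Big\{\big(p^{(m+1)/2}+p^{(m-1)/2}-2\big)(q-2)-2p+4\Big\}$$ and has the following number of $\mathbf{F}_q$-rational points: $$\#C_m(\mathbf{F}_q)=\begin{cases}(q-1)^2 & \text{if } -a\notin(\mathbf{F}_q^* )^{p-1},\\ (q-1)^2+2(p-1) & \text{if } -a\in(\mathbf{F}_q^* )^{p-1}.\end{cases}$$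
   Context: $\mathbf{F}_q$ is the finite field with $q=p^m$ elements, and $(\mathbf{F}_q^* )^d$ denotes the set of $d$-th powers in $\mathbf{F}_q^*$. The curve ''defined by'' an affine equation $y^{q-1}=f(x)$ with $f\in\mathbf{F}_q(x)$ means the non-singular complete irreducible curve over $\mathbf{F}_q$ with function field $\mathbf{F}_q(x,y)$, $y^{q-1}=f(x)$. *)

(* Defs.v *)
From HB Require Import structures.
From mathcomp Require Import all_boot all_order all_algebra all_field.
From mathcomp Require Import all_classical.

Set Implicit Arguments.
Unset Strict Implicit.
Unset Printing Implicit Defensive.

Import Order.TTheory GRing.Theory Num.Theory.

Local Open Scope classical_set_scope.
Local Open Scope ring_scope.

(* A function field of one variable over [K] is a finite extension [L] of the
   rational function field K(x) = {fraction {poly K}}.  The non-singular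
   complete curve with function field [L] is described through the places of
   [L / K], as in Stichtenoth, "Algebraic Function Fields and Codes", Ch. 1:
   its closed points are the places, and its K-rational points are the places
   of degree one. *)

Definition is_power_unit (F : fieldType) (d : nat) (u : F) : Prop :=
  exists2 b : F, b != 0 & u = b ^+ d.

Section FunctionField.

Variables (K : fieldType) (L : fieldExtType {fraction {poly K}}).

Definition const_in (c : K) : L := (tofrac c%:P)%:A.

Definition xvar : L := (tofrac 'X)%:A.

Definition full_constant_field : Prop :=
  forall (z : L) (f : {poly K}),
    f != 0 -> (map_poly const_in f).[z] = 0 -> exists c : K, z = const_in c.

(* The proper inclusion of K in the ring is automatic: a ring equal to K would
   force L = K by the third condition. *)
Definition is_valuation_ring (O : set L) : Prop :=
  [/\ forall c : K, O (const_in c),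
      forall u v : L, O u -> O v -> O (u - v) /\ O (u * v),
      forall z : L, O z \/ O z^-1
    & exists z : L, ~ O z].

(* A place is the maximal ideal of a valuation ring; either determines the
   other, and places are represented here by their valuation rings. *)
Record place := Place {
  val_ring : set L;
  val_ringP : is_valuation_ring val_ring
}.

HB.instance Definition _ := gen_eqMixin place.
HB.instance Definition _ := gen_choiceMixin place.

Definition is_unit_at (P : place) (z : L) : Prop :=
  val_ring P z /\ exists2 w, val_ring P w & z * w = 1.

Definition max_ideal (P : place) : set L :=
  [set z | val_ring P z /\ ~ is_unit_at P z].

Definition local_parameter (P : place) (t : L) : Prop :=
  max_ideal P = [set t * z | z in val_ring P].

(* The discrete valuation v_P(z), for nonzero z; local parameters exist at
   every place of a function field, so the default value 0 is not used. *)
Definition order_at (P : place) (z : L) : int :=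
  xget 0 [set n : int | exists t u : L,
    [/\ local_parameter P t, is_unit_at P u & z = t ^ n * u]].

(* For K-subspaces W of V of L: the quotient V / W has dimension n over K,
   i.e. some b_1, ..., b_n in V represent a basis of V / W. *)
Definition has_quotient_dim (V W : set L) (n : nat) : Prop :=
  exists b : 'I_n -> L, (forall i, V (b i)) /\
    (forall z, V z ->
       exists! c : 'rV[K]_n, W (z - \sum_(i < n) const_in (c 0 i) * b i)).

(* The dimensions below are finite, so that the default value 0 of [xget] is
   never reached for lack of a dimension. *)
Definition place_degree (P : place) : nat :=
  xget 0%N [set n | has_quotient_dim (val_ring P) (max_ideal P) n].

Record divisor := Divisor {
  coef_at :> place -> int;
  finite_support : finite_set [set P | coef_at P != 0]
}.

Definition divisor_degree (D : divisor) : int :=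
  \sum_(P \in [set: place]) D P * (place_degree P)%:Z.

Definition riemann_roch_space (D : divisor) : set L :=
  [set z | z != 0 -> forall P : place, - D P <= order_at P z].

Definition ell (D : divisor) : nat :=
  xget 0%N [set n | has_quotient_dim (riemann_roch_space D) [set 0] n].

(* g = max_D (deg D - l(D) + 1).  Dimensions being taken over K, this is the
   genus only when K is the full constant field of L, hence the first clause. *)
Definition has_genus (g : int) : Prop :=
  [/\ full_constant_field,
      exists D : divisor, divisor_degree D - (ell D)%:Z + 1 = g
    & forall D : divisor, divisor_degree D - (ell D)%:Z + 1 <= g].

Definition rational_points : set place :=
  [set P | place_degree P = 1%N].

End FunctionField.

Arguments const_in {K} L c.
Arguments xvar {K} L.
Arguments has_genus {K} L g.
Arguments rational_points {K} L.

(* Main.v *)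
Require Import Defs.
From HB Require Import structures.
From mathcomp Require Import all_boot all_order all_algebra all_field.
From mathcomp Require Import all_classical.
From mathcomp Require Import cyclic zify ring.

(* Genus.  Write q = #|F|, N = q - 1, r = p^((m+1)/2), s = p^((m-1)/2), so that
   rs = q.  The right-hand side of the equation is -x^(s-1) A^s / B, where
   A = x^(r-1) - a^r and B = a x^(s-1) - 1; as a is not an (s-1)-th power, x A B
   is squarefree.  B has simple zeros, which makes 1, y, ..., y^(N-1) a basis of
   L over F(x).  Since F contains the N-th roots of unity, averaging over the
   automorphisms y -> zeta y splits L(n (x)_oo) along this basis, and each
   component is a space of polynomials of bounded degree in x.  Hence
   l(n (x)_oo) = nN + 1 - g for all large n, with an explicit g.  Every divisor
   is dominated by one of the form (zeros of a polynomial h away from infinity) +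
   n (x)_oo, whose Riemann-Roch space is h^-1 L((n + deg h) (x)_oo); as deg D - l(D)
   increases with D, the fundamental inequality sum e f <= N shows that g is the
   maximum of deg D - l(D) + 1.

   Rational points.  The radicand takes the value 1 at each nonzero c in F, so
   there are N places over x = c, one for each N-th root of unity.  Over x = 0
   and x = oo the function y^N is, up to a d-th power with d = p - 1, a unit of
   residue -a and -1/a; the places there have degree one exactly when this residue
   is a d-th power, and then there are d of them. *)

Set Implicit Arguments.
Unset Strict Implicit.
Unset Printing Implicit Defensive.

Import Order.TTheory GRing.Theory Num.Theory.

Local Open Scope classical_set_scope.
Local Open Scope card_scope.
Local Open Scope ring_scope.

(** A [place] is a bare valuation ring, and [order_at], [place_degree] and [ell] carry no
    information until local parameters, finite residue fields and finite-dimensional Riemann-Roch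
    spaces are known to exist. These facts are derived from the definitions: discreteness by
    comparison with the rational function field, places above a given base place by Zorn's lemma,
    finiteness of dimensions by a growth argument in powers of one element. Since F is finite,
    dimensions are compared by counting coordinate vectors. The degree of (x)_oo is not computed
    place by place: it is at most N by the fundamental inequality, and at least N because l(n
    (x)_oo) grows like n N. The constants of the genus are a sum of ceilings: the component of y^i
    takes up ceil(deg(residual i) / N) of the n poles allowed at infinity. As r s = N + 1, these
    ceilings are linear in the residues modulo N of i (s - 1), i s and -i, and the sum of the first
    kind of residues brings in gcd(s - 1, N) = p - 1, the origin of the term - 2 p. *)

Section Embedding.

Variables (K : fieldType) (L : fieldExtType {fraction {poly K}}).

Definition poly_in (g : {poly K}) : L := in_alg L (tofrac g).

HB.instance Definition _ :=
  GRing.RMorphism.copy poly_in (in_alg L \o @tofrac {poly K}).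

Lemma const_inE c : const_in L c = poly_in c%:P. Proof. by []. Qed.
Lemma xvarE : xvar L = poly_in 'X. Proof. by []. Qed.

Lemma const_in_is_zmod_morphism : zmod_morphism (@const_in K L).
Proof. by move=> c d; rewrite !const_inE polyCB rmorphB. Qed.
Lemma const_in_is_monoid_morphism : monoid_morphism (@const_in K L).
Proof. by split=> [|c d]; rewrite !const_inE ?polyC1 ?rmorph1 // polyCM rmorphM. Qed.
HB.instance Definition _ := GRing.isZmodMorphism.Build K L (@const_in K L)
  const_in_is_zmod_morphism.
HB.instance Definition _ := GRing.isMonoidMorphism.Build K L (@const_in K L)
  const_in_is_monoid_morphism.

Lemma poly_in_eq0 g : (poly_in g == 0) = (g == 0).
Proof. by rewrite /poly_in fmorph_eq0 tofrac_eq0. Qed.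

Lemma poly_in_inj : injective poly_in.
Proof.
by move=> g h /eqP; rewrite -subr_eq0 -rmorphB poly_in_eq0 subr_eq0 => /eqP.
Qed.

Lemma tofrac_ratio (k : {fraction {poly K}}) :
  exists g h : {poly K}, h != 0 /\ k = tofrac g / tofrac h.
Proof.
move: k; apply: quotP => r _.
exists (\n_r), (\d_r); split; first exact: denom_ratioP.
have dn0 := denom_ratioP r.
have -> : tofrac \n_r = \pi_{fraction {poly K}}%qT r * tofrac \d_r.
  unlock FracField.tofrac; rewrite -[RHS]FracField.pi_mul; apply/eqP.
  rewrite FracField.equivf_def /FracField.mulf !numden_Ratio ?mulr1 ?oner_neq0 //.
  by rewrite mul1r.
by rewrite mulfK // tofrac_eq0.
Qed.

End Embedding.

(** * Quotient dimensions over a finite field *)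

Section QuotientDimension.

Variables (F : finFieldType) (L : fieldExtType {fraction {poly F}}).
Implicit Types (V U W : set L) (c : F) (I J : finType).
Local Notation const_in := (const_in L).

Definition subspace W :=
  W 0 /\ forall c u v, W u -> W v -> W (const_in c * u + v).

(** Families are indexed by arbitrary finite types, so that they can be juxtaposed over [I + J] or
    indexed by pairs; [qdim_fintype] returns to ordinals. *)
Definition lcomb I (b : I -> L) (c : I -> F) : L := \sum_i const_in (c i) * b i.

Definition free_mod W I (b : I -> L) :=
  forall c : I -> F, W (lcomb b c) -> forall i, c i = 0.

Definition gen_mod V W I (b : I -> L) :=
  forall z, V z -> exists c : I -> F, W (z - lcomb b c).

Lemma subspaceD W u v : subspace W -> W u -> W v -> W (u + v).
Proof. by case=> _ sW uW vW; rewrite -[u]mul1r -(rmorph1 const_in); apply: sW. Qed.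

Lemma subspaceZ W c u : subspace W -> W u -> W (const_in c * u).
Proof. by case=> W0 sW uW; rewrite -[_ * _]addr0; apply: sW. Qed.

Lemma subspaceN W u : subspace W -> W u -> W (- u).
Proof. by move=> sW uW; rewrite -mulN1r -(rmorph1 const_in) -rmorphN; apply: subspaceZ. Qed.

Lemma subspaceB W u v : subspace W -> W u -> W v -> W (u - v).
Proof. by move=> sW uW vW; apply: subspaceD => //; apply: subspaceN. Qed.

Lemma subspace_sum W I (P : pred I) (b : I -> L) : subspace W ->
  (forall i, P i -> W (b i)) -> W (\sum_(i | P i) b i).
Proof.
move=> sW bW; elim/big_ind: _ => //; first by case: sW.
by move=> u v; apply: subspaceD.
Qed.

Lemma subspace_lcomb W I (b : I -> L) (c : I -> F) : subspace W ->
  (forall i, W (b i)) -> W (lcomb b c).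
Proof. by move=> sW bW; apply: subspace_sum => // i _; apply: subspaceZ. Qed.

Lemma lcombB I (b : I -> L) (c d : I -> F) :
  lcomb b (fun i => c i - d i) = lcomb b c - lcomb b d.
Proof. by rewrite /lcomb -sumrB; apply: eq_bigr => i _; rewrite rmorphB mulrBl. Qed.

Lemma lcombD I (b : I -> L) (c d : I -> F) :
  lcomb b (fun i => c i + d i) = lcomb b c + lcomb b d.
Proof. by rewrite /lcomb -big_split; apply: eq_bigr => i _; rewrite /= rmorphD mulrDl. Qed.

Lemma lcombZ I (b : I -> L) (a : F) (c : I -> F) :
  lcomb b (fun i => a * c i) = const_in a * lcomb b c.
Proof. by rewrite /lcomb mulr_sumr; apply: eq_bigr => i _; rewrite rmorphM mulrA. Qed.

Lemma lcomb_mull I (b : I -> L) (c : I -> F) z :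
  lcomb (fun i => z * b i) c = z * lcomb b c.
Proof. by rewrite /lcomb mulr_sumr; apply: eq_bigr => i _; rewrite mulrCA. Qed.

Lemma lcomb_sum I J (b : I -> L) (b' : J -> L) (c : I + J -> F) :
  lcomb (fun k => match k with inl i => b i | inr j => b' j end) c =
  lcomb b (c \o inl) + lcomb b' (c \o inr).
Proof. by rewrite /lcomb big_sumType. Qed.

Lemma lcomb_reindex I J (h : J -> I) (b : I -> L) (c : I -> F) : bijective h ->
  lcomb (b \o h) (c \o h) = lcomb b c.
Proof. by move=> hb; rewrite /lcomb [RHS](reindex h) //; apply: onW_bij. Qed.

Lemma free_mod_sub V W I (b : I -> L) : W `<=` V -> free_mod V b -> free_mod W b.
Proof. by move=> WV Vb c /WV /Vb. Qed.

(* Coordinates embed F^I into F^J, and F is finite. *)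
Lemma free_le_gen V W I J (b : I -> L) (b' : J -> L) : subspace V -> subspace W ->
  (forall i, V (b i)) -> free_mod W b -> gen_mod V W b' -> (#|I| <= #|J|)%N.
Proof.
move=> sV sW bV bfree b'gen.
have /choice[h hP] : forall c : {ffun I -> F}, exists d : {ffun J -> F},
    W (lcomb b c - lcomb b' d).
  move=> c; have [d dP] := b'gen (lcomb b c) (subspace_lcomb c sV bV).
  exists (finfun d); suff -> : lcomb b' (finfun d) = lcomb b' d by [].
  by apply: eq_bigr => j _; rewrite ffunE.
have hinj : injective h.
  move=> c d eq_cd; apply/ffunP => i; apply/eqP; rewrite -subr_eq0; apply/eqP.
  apply: (bfree (fun i => c i - d i)); rewrite lcombB.
  have := subspaceB sW (hP c) (hP d); rewrite eq_cd.
  by rewrite opprB addrA subrK.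
have := leq_card h hinj; rewrite !card_ffun leq_exp2l //.
exact: finRing_gt1.
Qed.

(** The unique coordinates of [has_quotient_dim] are split into generation and independence, which
    are proved separately. *)
Definition qdim V W n :=
  exists b : 'I_n -> L, [/\ forall i, V (b i), gen_mod V W b & free_mod W b].

Lemma qdimP V W n : subspace V -> subspace W ->
  has_quotient_dim V W n <-> qdim V W n.
Proof.
move=> sV sW; have lcE (b : 'I_n -> L) (c : 'rV[F]_n) :
    \sum_(i < n) const_in (c 0 i) * b i = lcomb b (c 0) by [].
have lcF (b : 'I_n -> L) (c : 'I_n -> F) : lcomb b ((\row_i c i) 0) = lcomb b c.
  by apply: eq_bigr => i _; rewrite mxE.
split=> -[b].
  case=> bV bP; exists b; split=> //.
    by move=> z /bP[c [cW _]]; exists (c 0).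
  move=> c cW i; have [d [_ dU]] := bP _ (subspace_lcomb c sV bV).
  have d0 : d = 0.
    apply: dU; rewrite lcE [X in _ - X](_ : _ = 0) ?subr0 //.
    by apply: big1 => j _; rewrite mxE rmorph0 mul0r.
  have dc : d = \row_i c i.
    by apply: dU; rewrite lcE lcF subrr; case: sW.
  by move/rowP/(_ i): d0; rewrite dc !mxE.
case=> bV bgen bfree; exists b; split=> // z /bgen[c cW].
exists (\row_i c i); split; first by rewrite lcE lcF.
move=> d; rewrite lcE => dW; apply/rowP => i; rewrite mxE; apply/eqP.
rewrite -subr_eq0; apply/eqP; apply: (bfree (fun i => c i - d 0 i)).
rewrite lcombB; have := subspaceB sW dW cW.
by rewrite opprB addrC addrA subrK.
Qed.

Lemma qdim_inj V W n n' : subspace V -> subspace W ->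
  qdim V W n -> qdim V W n' -> n = n'.
Proof.
move=> sV sW [b [bV bgen bfree]] [b' [bV' bgen' bfree']].
have := free_le_gen sV sW bV bfree bgen'; have := free_le_gen sV sW bV' bfree' bgen.
by rewrite !card_ord => h h'; apply/eqP; rewrite eqn_leq h h'.
Qed.

Lemma xget_qdim V W n : subspace V -> subspace W -> qdim V W n ->
  xget 0%N [set n | has_quotient_dim V W n] = n.
Proof.
move=> sV sW nP; apply: xget_unique; first by apply/qdimP.
by move=> n' /qdimP-/(_ sV sW) /(qdim_inj sV sW nP).
Qed.

Lemma qdim_fintype V W I (b : I -> L) : (forall i, V (b i)) ->
  gen_mod V W b -> free_mod W b -> qdim V W #|I|.
Proof.
move=> bV bgen bfree; exists (b \o enum_val); split=> [i|z /bgen[c cW]|c cW i] /=.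
- exact: bV.
- by exists (c \o enum_val); rewrite lcomb_reindex //; apply: enum_val_bij.
have : W (lcomb b (c \o enum_rank)).
  rewrite -(lcomb_reindex b _ (enum_val_bij I)) [X in lcomb _ X](_ : _ = c) //.
  by apply/funext => j /=; rewrite enum_valK.
by move=> /bfree/(_ (enum_val i)) /=; rewrite enum_valK.
Qed.

(* Extending a free family of maximal size by an element outside its span would
   keep it free. *)
Lemma qdim_of_bound V W M : subspace V -> subspace W ->
  (forall n (b : 'I_n -> L), (forall i, V (b i)) -> free_mod W b -> (n <= M)%N) ->
  exists2 n, (n <= M)%N & qdim V W n.
Proof.
move=> sV sW bound.
pose Q n := `[< exists b : 'I_n -> L, (forall i, V (b i)) /\ free_mod W b >].
have Q0 : exists n, Q n.
  by exists 0%N; apply/asboolP; exists (fun=> 0); split=> [[]|c _ []].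
have QM n : Q n -> (n <= M)%N by move=> /asboolP[b [bV /bound]]; apply.
case: (ex_maxnP Q0 QM) => n Qn nmax.
exists n; first exact: QM.
case/asboolP: Qn => b [bV bfree]; exists b; split=> // z Vz.
apply: contrapT => nz.
suff : Q n.+1 by move/nmax; rewrite ltnn.
apply/asboolP.
pose b' (k : 'I_n.+1) := if unlift ord0 k is Some j then b j else z.
have lc (c : 'I_n.+1 -> F) :
    lcomb b' c = const_in (c ord0) * z + lcomb b (c \o lift ord0).
  rewrite /lcomb big_ord_recl /b' unlift_none; congr (_ + _).
  by apply: eq_bigr => i _; rewrite liftK.
exists b'; split=> [k|c].
  by rewrite /b'; case: unliftP.
rewrite lc => cW; have c0 : c ord0 = 0.
  apply: contrapT => /eqP c0; apply: nz.
  exists (fun i => - (c ord0)^-1 * c (lift ord0 i)).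
  rewrite (lcombZ _ _ (c \o lift ord0)) rmorphN mulNr opprK.
  have := subspaceZ (c ord0)^-1 sW cW.
  by rewrite mulrDr mulrA -rmorphM mulVf // rmorph1 mul1r.
move: cW; rewrite c0 rmorph0 mul0r add0r => /bfree cl k.
by case: (unliftP ord0 k) => [j ->|->] //; apply: cl.
Qed.

(** A relation modulo W is first read modulo U, where the second family vanishes and the first is
    independent; what remains involves the second family only. *)
Lemma free_mod_cat U W I J (b : I -> L) (b' : J -> L) :
  subspace U -> W `<=` U -> (forall j, U (b' j)) -> free_mod U b -> free_mod W b' ->
  free_mod W (fun k : I + J => match k with inl i => b i | inr j => b' j end).
Proof.
move=> sU WU bU' bfree bfree' c; rewrite lcomb_sum => cW.
have cl : forall i, (c \o inl) i = 0.
  apply: bfree; rewrite -[lcomb _ _](addrK (lcomb b' (c \o inr))).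
  by apply: subspaceB; [|apply: WU|apply: subspace_lcomb].
have cr : forall j, (c \o inr) j = 0.
  apply: bfree'; move: cW; rewrite [lcomb b _]big1 ?add0r // => i _.
  by rewrite cl rmorph0 mul0r.
by case=> k; [apply: cl|apply: cr].
Qed.

Lemma qdim_add V U W n m : subspace U -> W `<=` U -> U `<=` V ->
  qdim V U n -> qdim U W m -> qdim V W (n + m).
Proof.
move=> sU WU UV [b [bV bgen bfree]] [b' [bV' bgen' bfree']].
pose bb (k : 'I_n + 'I_m) := match k with inl i => b i | inr j => b' j end.
have -> : (n + m)%N = #|{: 'I_n + 'I_m}| by rewrite card_sum !card_ord.
apply: (@qdim_fintype V W _ bb).
- by case=> k /=; [apply: bV|apply: UV].
- move=> z /bgen[c /bgen'[d dW]].
  exists (fun k => match k with inl i => c i | inr j => d j end).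
  by rewrite /bb lcomb_sum opprD addrA.
- exact: (free_mod_cat sU WU bV' bfree bfree').
Qed.

Definition qdim_le V W n := exists2 k, (k <= n)%N & qdim V W k.

Lemma qdim_le_add V U W n m : subspace U -> W `<=` U -> U `<=` V ->
  qdim_le V U n -> qdim_le U W m -> qdim_le V W (n + m).
Proof.
move=> sU WU UV [n' len dn] [m' lem dm].
by exists (n' + m')%N; [apply: leq_add|apply: qdim_add dn dm].
Qed.

Lemma qdim_sub V U W n : subspace V -> subspace U -> subspace W -> U `<=` V ->
  qdim V W n -> qdim_le U W n.
Proof.
move=> sV sU sW UV [b [bV bgen bfree]]; apply: qdim_of_bound => // k b' bU' bfree'.
have := free_le_gen sV sW (fun i => UV _ (bU' i)) bfree' bgen.
by rewrite !card_ord.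
Qed.

End QuotientDimension.

(** * Valuation rings and orders *)

Section Places.

Variables (K : fieldType) (L : fieldExtType {fraction {poly K}}).
Local Notation KX := {fraction {poly K}}.
Local Notation ι := (@poly_in K L).

Section OnePlace.

Variable P : place L.
Local Notation O := (val_ring P).
Local Notation m := (max_ideal P).
Local Notation unit := (is_unit_at P).

Lemma val_ring_const c : O (const_in L c).
Proof. by case: (val_ringP P). Qed.

Lemma val_ring0 : O 0.
Proof. by rewrite -(rmorph0 (const_in L)); apply: val_ring_const. Qed.

Lemma val_ring1 : O 1.
Proof. by rewrite -(rmorph1 (const_in L)); apply: val_ring_const. Qed.

Lemma val_ringB u v : O u -> O v -> O (u - v).
Proof. by case: (val_ringP P) => _ /(_ u v) h _ _ uO vO; case: (h uO vO). Qed.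

Lemma val_ringM u v : O u -> O v -> O (u * v).
Proof. by case: (val_ringP P) => _ /(_ u v) h _ _ uO vO; case: (h uO vO). Qed.

Lemma val_ringN u : O u -> O (- u).
Proof. by rewrite -sub0r; apply: val_ringB; apply: val_ring0. Qed.

Lemma val_ringD u v : O u -> O v -> O (u + v).
Proof. by move=> uO vO; rewrite -[v]opprK; apply: val_ringB => //; apply: val_ringN. Qed.

Lemma val_ringX u n : O u -> O (u ^+ n).
Proof.
by move=> uO; elim: n => [|n IH]; rewrite ?expr0 ?exprS; [apply: val_ring1|apply: val_ringM].
Qed.

Lemma val_ring_sum I (r : seq I) (Q : pred I) (f : I -> L) :
  (forall i, Q i -> O (f i)) -> O (\sum_(i <- r | Q i) f i).
Proof. by move=> h; elim/big_ind: _ => //; [apply: val_ring0|apply: val_ringD]. Qed.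

Lemma val_ringVN z : ~ O z -> O z^-1.
Proof. by case: (val_ringP P) => _ _ /(_ z)[]. Qed.

Lemma unit_atP z : unit z <-> [/\ z != 0, O z & O z^-1].
Proof.
split=> [[zO [w wO zw]]|[z0 zO zVO]].
  have z0 : z != 0 by apply/eqP=> z0; move: zw; rewrite z0 mul0r => /esym/eqP/negP; rewrite oner_eq0.
  split=> //; suff -> : z^-1 = w by [].
  by apply: (mulfI z0); rewrite zw mulfV.
by split=> //; exists z^-1 => //; rewrite mulfV.
Qed.

Lemma max_idealP z : m z <-> z = 0 \/ ~ O z^-1.
Proof.
split=> [[zO zu]|[->|zVO]].
- case: (eqVneq z 0) => [->|z0]; first by left.
  by right=> zVO; apply: zu; apply/unit_atP.
- by split; [apply: val_ring0|rewrite unit_atP; case; rewrite eqxx].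
split; last by case/unit_atP.
by rewrite -[z]invrK; apply: val_ringVN.
Qed.

Lemma max_ideal_sub z : m z -> O z. Proof. by case. Qed.

Lemma val_ring_cases z : O z -> m z \/ unit z.
Proof.
by move=> zO; case: (pselect (unit z)) => [|nu]; [right|left; split].
Qed.

Lemma max_ideal0 : m 0. Proof. by apply/max_idealP; left. Qed.

Lemma max_ideal_unit z : m z -> unit z -> False. Proof. by case. Qed.

Lemma unit_at_neq0 z : unit z -> z != 0. Proof. by case/unit_atP. Qed.

Lemma unit_at_val z : unit z -> O z. Proof. by case. Qed.

Lemma unit_at1 : unit 1.
Proof. by apply/unit_atP; rewrite invr1 oner_neq0; split=> //; apply: val_ring1. Qed.

Lemma unit_atV z : unit z -> unit z^-1.
Proof. by move/unit_atP=> [z0 zO zVO]; apply/unit_atP; rewrite invr_neq0 // invrK. Qed.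

Lemma unit_atM z w : unit z -> unit w -> unit (z * w).
Proof.
move=> /unit_atP[z0 zO zVO] /unit_atP[w0 wO wVO]; apply/unit_atP.
by rewrite mulf_neq0 // invfM; split=> //; apply: val_ringM.
Qed.

Lemma unit_atX z n : unit z -> unit (z ^+ n).
Proof.
by move=> zu; elim: n => [|n IH]; rewrite ?expr0 ?exprS; [apply: unit_at1|apply: unit_atM].
Qed.

Lemma unit_atXz z (n : int) : unit z -> unit (z ^ n).
Proof.
by case: n => n zu; [apply: unit_atX|rewrite NegzE -exprnN; apply/unit_atV/unit_atX].
Qed.

Lemma unit_at_const c : c != 0 -> unit (const_in L c).
Proof.
move=> c0; apply/unit_atP; rewrite fmorph_eq0 -fmorphV; split=> //; exact: val_ring_const.
Qed.

Lemma not_max_ideal1 : ~ m 1.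
Proof. by move/max_ideal_unit; apply; apply: unit_at1. Qed.

Lemma max_idealM z w : O z -> m w -> m (z * w).
Proof.
move=> zO /max_idealP wm; apply/max_idealP.
case: (eqVneq z 0) => [->|z0]; first by left; rewrite mul0r.
case: wm => [->|wm]; first by left; rewrite mulr0.
right; rewrite invfM => h; apply: wm.
by rewrite -[w^-1](mulVKf z0); apply: val_ringM.
Qed.

Lemma max_idealMr z w : m z -> O w -> m (z * w).
Proof. by move=> zm wO; rewrite mulrC; apply: max_idealM. Qed.

Lemma max_idealD z w : m z -> m w -> m (z + w).
Proof.
move=> zm wm; case: (eqVneq z 0) => [->|z0]; first by rewrite add0r.
case: (eqVneq w 0) => [->|w0]; first by rewrite addr0.
have [h|h] : O (w / z) \/ O (z / w).
- case: (pselect (O (w / z))); first by left.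
  by move/val_ringVN; rewrite invfM invrK mulrC; right.
- have -> : z + w = z * (1 + w / z) by rewrite mulrDr mulr1 mulrC divfK.
  by apply: max_idealMr => //; apply: val_ringD => //; apply: val_ring1.
have -> : z + w = w * (1 + z / w) by rewrite mulrDr mulr1 [w * _]mulrC divfK // addrC.
by apply: max_idealMr => //; apply: val_ringD => //; apply: val_ring1.
Qed.

Lemma max_idealN z : m z -> m (- z).
Proof. by move=> zm; rewrite -mulN1r; apply: max_idealM => //; apply/val_ringN/val_ring1. Qed.

Lemma max_idealB z w : m z -> m w -> m (z - w).
Proof. by move=> zm wm; apply: max_idealD => //; apply: max_idealN. Qed.

Lemma max_ideal_sum I (r : seq I) (Q : pred I) (f : I -> L) :
  (forall i, Q i -> m (f i)) -> m (\sum_(i <- r | Q i) f i).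
Proof. by move=> h; elim/big_ind: _ => //; [apply: max_ideal0|apply: max_idealD]. Qed.

Lemma max_ideal_exp z n : m z -> (0 < n)%N -> m (z ^+ n).
Proof.
case: n => // n zm _; rewrite exprS; apply: max_idealMr => //.
by apply: val_ringX; apply: max_ideal_sub.
Qed.

Lemma max_ideal_prime z w : O z -> O w -> m (z * w) -> m z \/ m w.
Proof.
move=> zO wO zw; case: (val_ring_cases zO) => [|zu]; first by left.
case: (val_ring_cases wO) => [|wu]; first by right.
by case: (max_ideal_unit zw); apply: unit_atM.
Qed.

Lemma unit_atD z w : unit z -> m w -> unit (z + w).
Proof.
move=> zu wm; have zwO : O (z + w) by apply: val_ringD; [case: zu|case: wm].
case: (val_ring_cases zwO) => // zwm.
by case: (max_ideal_unit _ zu); rewrite -[z](addrK w); apply: max_idealB.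
Qed.

(** Otherwise z^-1 lies in the maximal ideal, and so does 1 = z^-n z^n. *)
Lemma val_ring_root z n : (0 < n)%N -> O (z ^+ n) -> O z.
Proof.
move=> n0 zn; apply: contrapT => nz.
have zm : m z^-1 by apply/max_idealP; right; rewrite invrK.
apply: not_max_ideal1; have := max_idealMr (max_ideal_exp zm n0) zn.
rewrite -exprMn mulVf ?expr1n //; apply/eqP => z0; apply: nz; rewrite z0.
exact: val_ring0.
Qed.

(** Before a numerical valuation exists, divisibility in the valuation ring serves as the order on
    values; it is total, so a finite list has a least member. *)
Lemma exists_min_val (s : seq L) : has (fun z => z != 0) s ->
  exists z, [/\ z \in s, z != 0 & forall w, w \in s -> O (w / z)].
Proof.
elim: s => //= a s IH; case: (boolP (has _ s)) => [/IH[z [zs z0 zP]] _|/hasPn s0].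
  case: (pselect (O (a / z))) => [az|/val_ringVN].
    exists z; split=> //; first by rewrite inE zs orbT.
    by move=> w; rewrite inE => /orP[/eqP->|/zP].
  rewrite invfM invrK mulrC => za.
  have [a0|a0] := eqVneq a 0.
    exists z; split=> //; first by rewrite inE zs orbT.
    by move=> w; rewrite inE => /orP[/eqP->|/zP//]; rewrite a0 mul0r; apply: val_ring0.
  exists a; split=> //; first by rewrite mem_head.
  move=> w; rewrite inE => /orP[/eqP->|/zP wz]; first by rewrite mulfV //; apply: val_ring1.
  have -> : w / a = w / z * (z / a) by rewrite mulrA divfK.
  exact: val_ringM.
rewrite orbF => a0; exists a; split=> //; first by rewrite mem_head.
move=> w; rewrite inE => /orP[/eqP->|/s0].
  by rewrite mulfV //; apply: val_ring1.
by rewrite negbK => /eqP->; rewrite mul0r; apply: val_ring0.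
Qed.

(** After division by the term of least value all other terms lie in the maximal ideal, so a
    vanishing sum would put 1 there. *)
Lemma sum_neq0_of_distinct_val (I : finType) (f : I -> L) :
  (exists i, f i != 0) ->
  (forall i j, i != j -> f i != 0 -> f j != 0 -> ~ unit (f i / f j)) ->
  \sum_i f i != 0.
Proof.
move=> [i fi0] fP; have [|z [/codomP[j ->] fj0 jP]] := @exists_min_val (codom f).
  by apply/hasP; exists (f i) => //; apply: codom_f.
rewrite (bigD1 j) //=; apply/eqP => s0; apply: not_max_ideal1.
have -> : 1 = - \sum_(k | k != j) f k / f j.
  apply/eqP; rewrite -subr_eq0 opprK -mulr_suml -{1}(mulfV fj0) -mulrDl s0.
  by rewrite mul0r.
apply/max_idealN/max_ideal_sum => k kj.
have [->|fk0] := eqVneq (f k) 0; first by rewrite mul0r; apply: max_ideal0.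
have fkO := jP _ (codom_f f k).
by case: (val_ring_cases fkO) => // /fP[].
Qed.

End OnePlace.
End Places.

Lemma constant_term_div (E : fieldType) (c : nat -> E) (z b : E) n : z != 0 -> b != 0 ->
  \sum_(i < n.+1) c i * z ^+ i = 0 ->
  c 0%N / b / z = - \sum_(i < n) c i.+1 / b * z ^+ i.
Proof.
move=> z0 b0; rewrite big_ord_recl expr0 mulr1 => /eqP; rewrite addr_eq0 => /eqP ->.
rewrite !mulNr !mulr_suml; congr (- _); apply: eq_bigr => i _.
by rewrite exprSr mulrAC mulrA mulfK // mulrAC.
Qed.

Lemma exprn_div_le (E : fieldType) (z : E) i n : z != 0 -> (i <= n)%N ->
  z ^+ i / z ^+ n = z^-1 ^+ (n - i).
Proof.
move=> z0 le_in; rewrite exprVn -{1}(subnKC le_in) exprD invfM mulrA mulfV ?mul1r //.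
by rewrite expf_neq0.
Qed.

Lemma div_expz_div (E : fieldType) (z c d : E) (n k : int) : z != 0 ->
  c / z ^ n / (d / z ^ k) = c / d / z ^ (n - k).
Proof.
move=> z0; rewrite expfzDr // -invr_expz !invfM !invrK.
by rewrite mulrACA.
Qed.

(** * Restriction of a place to the rational function field *)

Section LocalParameters.

Variables (K : fieldType) (L : fieldExtType {fraction {poly K}}).
Local Notation KX := {fraction {poly K}}.
Local Notation ι := (@poly_in K L).

Lemma base_ratio (k : KX) : exists g h : {poly K}, h != 0 /\ k%:A = ι g / ι h.
Proof.
have [g [h [h0 ->]]] := tofrac_ratio k; exists g, h; split=> //.
by rewrite /poly_in -fmorph_div.
Qed.

Lemma base_eq0 (k : KX) : (k%:A == 0 :> L) = (k == 0).
Proof. by rewrite -[k%:A]/(in_alg L k) fmorph_eq0. Qed.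

Lemma base_div (k l : KX) : (k / l)%:A = k%:A / l%:A :> L.
Proof. exact: (fmorph_div (in_alg L)). Qed.

Lemma base_poly (g : {poly K}) : (tofrac g)%:A = ι g. Proof. by []. Qed.

(** The minimal polynomial with its factors X removed; the nonzero constant term becomes the base
    multiple sought in [exists_base_multiple]. *)
Lemma algebraic_relation (z : L) : z != 0 ->
  exists p : {poly KX}, p`_0 != 0 /\ (map_poly (in_alg L) p).[z] = 0.
Proof.
move=> z0; have /polyOver1P[p pE] := minPolyOver 1%VS z.
have pz : (map_poly (in_alg L) p).[z] = 0 by rewrite -pE minPolyxx.
have p0 : p != 0.
  by rewrite -(map_poly_eq0 (in_alg L)) -pE monic_neq0 // monic_minPoly.
elim/poly_ind: p {pE} pz p0 => [|p c IH]; first by rewrite eqxx.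
have [->|c0 pz _] := eqVneq c 0; last first.
  by exists (p * 'X + c%:P); rewrite coefD coefMX coefC add0r.
rewrite addr0 rmorphM /= map_polyX hornerMX => /eqP; rewrite mulf_eq0 (negPf z0) orbF.
by move/eqP => pz; rewrite mulf_eq0 polyX_eq0 orbF; apply: IH.
Qed.

Lemma poly_in_coef g : ι g = \sum_(i < size g) const_in L g`_i * xvar L ^+ i.
Proof.
rewrite -{1}[g]coefK poly_def rmorph_sum; apply: eq_bigr => i _.
by rewrite /= -mul_polyC rmorphM rmorphXn.
Qed.

Section OnePlace.

Variable P : place L.
Local Notation O := (val_ring P).
Local Notation m := (max_ideal P).
Local Notation unit := (is_unit_at P).

(* Divide an algebraic equation for z by its coefficient of least value; its
   constant coefficient is then the multiple of z asked for. *)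
Lemma exists_base_multiple z : z != 0 -> O z ->
  exists k : KX, [/\ k != 0, O k%:A & O (k%:A / z)].
Proof.
move=> z0 zO; have [p [p0 pz]] := algebraic_relation z0.
pose c i : L := (p`_i)%:A.
have sp : (0 < size p)%N.
  by rewrite lt0n size_poly_eq0; apply: contraNneq p0 => ->; rewrite coef0.
have c00 : c 0%N != 0 by rewrite /c base_eq0.
have [|_ [/mapP[j _ ->] cj0 cjP]] := @exists_min_val _ _ P (map c (iota 0 (size p))).
  by apply/hasP; exists (c 0%N) => //; apply: map_f; rewrite mem_iota.
have dO i : O (c i / c j).
  case: (ltnP i (size p)) => [ip|ip]; first by apply: cjP; apply: map_f; rewrite mem_iota.
  by rewrite /c nth_default // scale0r mul0r; apply: val_ring0.
exists (p`_0 / p`_j); have kE : (p`_0 / p`_j)%:A = c 0%N / c j by rewrite /c base_div.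
split; first by rewrite -base_eq0 kE mulf_neq0 ?invr_neq0.
  by rewrite kE.
have : \sum_(i < (size p).-1.+1) c i * z ^+ i = 0.
  rewrite prednK // -[RHS]pz horner_coef size_map_poly; apply: eq_bigr => i _.
  by rewrite coef_map.
move=> /(constant_term_div z0 cj0); rewrite kE => ->; apply/val_ringN/val_ring_sum => i _.
exact: val_ringM (dO _) (val_ringX _ zO).
Qed.

(** A base multiple of a nonunit is a nonunit, so the place does not become trivial on the rational
    function field. *)
Lemma exists_base_max_ideal : exists k : KX, k != 0 /\ m k%:A.
Proof.
case: (val_ringP P) => _ _ _ [z zO].
have z0 : z != 0 by apply/eqP => z0; apply: zO; rewrite z0; apply: val_ring0.
have zm : m z^-1 by apply/max_idealP; right; rewrite invrK.
have [|k [k0 _ kz]] := exists_base_multiple _ (max_ideal_sub zm).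
  by rewrite invr_neq0.
exists k; split=> //; rewrite invrK in kz.
have -> : k%:A = k%:A * z * z^-1 :> L by rewrite mulfK.
exact: max_idealM.
Qed.

Lemma val_ring_poly g : O (xvar L) -> O (ι g).
Proof.
move=> xO; rewrite poly_in_coef; apply: val_ring_sum => i _.
exact: val_ringM (val_ring_const _ _) (val_ringX _ xO).
Qed.

(** The maximal ideal meets K[x] in a nonzero ideal, generated by its nonzero member of least
    degree; constants are units, so this member is not constant. *)
Lemma finite_place_generator : O (xvar L) ->
  exists π : {poly K}, [/\ π != 0, (1 < size π)%N & forall g, m (ι g) <-> π %| g].
Proof.
move=> xO; have polyO g := val_ring_poly g xO.
have [k [k0 km]] := exists_base_max_ideal.
have [g [h [h0 kE]]] := base_ratio k.
have gm : m (ι g).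
  have -> : ι g = k%:A * ι h by rewrite kE divfK // poly_in_eq0.
  by apply: max_idealMr.
have g0 : g != 0.
  by apply/eqP => g0; move: kE; rewrite g0 rmorph0 mul0r => /eqP; rewrite base_eq0 (negPf k0).
pose Q n := `[< exists g, [/\ g != 0, m (ι g) & size g = n] >].
have Q0 : exists n, Q n by exists (size g); apply/asboolP; exists g.
case: (ex_minnP Q0) => n /asboolP[π [π0 πm <-]] πmin.
exists π; split=> //.
  rewrite ltnNge; apply/negP => sπ; have cE := size1_polyC sπ.
  apply: (max_ideal_unit πm); rewrite cE; apply: unit_at_const.
  by apply: contraNneq π0 => c0; rewrite cE c0.
move=> f; split=> [fm|/dvdpP[q ->]]; last first.
  by rewrite rmorphM; exact: max_idealM (polyO _) πm.
rewrite /dvdp; apply: contraT => r0.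
have rm : m (ι (f %% π)).
  have -> : f %% π = f - f %/ π * π by rewrite {2}(divp_eq f π) addrAC subrr add0r.
  by rewrite rmorphB rmorphM; exact: max_idealB fm (max_idealM (polyO _) πm).
have : Q (size (f %% π)) by apply/asboolP; exists (f %% π).
by move/πmin; rewrite leqNgt ltn_modpN0.
Qed.

(** When x has a pole the leading term dominates: divided by its power of x, every lower term
    contains a positive power of 1/x. *)
Lemma infinite_place_lead g : ~ O (xvar L) -> g != 0 ->
  m (ι g / xvar L ^+ (size g).-1 - const_in L (lead_coef g)).
Proof.
move=> xO g0; have x0 : xvar L != 0 by rewrite xvarE poly_in_eq0 polyX_eq0.
have xm : m (xvar L)^-1 by apply/max_idealP; right; rewrite invrK.
have sg : (0 < size g)%N by rewrite lt0n size_poly_eq0.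
have -> : ι g / xvar L ^+ (size g).-1 =
    \sum_(i < (size g).-1) const_in L g`_i * (xvar L)^-1 ^+ ((size g).-1 - i)
    + const_in L (lead_coef g).
  rewrite poly_in_coef mulr_suml -(prednK sg) big_ord_recr /= mulfK ?expf_neq0 //.
  congr (_ + _); apply: eq_bigr => i _.
  by rewrite -mulrA exprn_div_le // ltnW.
rewrite addrK; apply: max_ideal_sum => i _; apply: max_idealM; first exact: val_ring_const.
by apply: max_ideal_exp; rewrite // subn_gt0.
Qed.

Lemma infinite_place_poly g : ~ O (xvar L) -> g != 0 ->
  unit (ι g / xvar L ^+ (size g).-1).
Proof.
move=> xO g0; rewrite -[X in unit X](subrK (const_in L (lead_coef g))) addrC.
apply: unit_atD; last exact: infinite_place_lead.
by apply: unit_at_const; rewrite lead_coef_eq0.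
Qed.

(** The discrete valuation induced on the base: w is the generator π if x is integral at the place,
    and 1/x otherwise. *)
Lemma exists_base_uniformizer : exists w : L, [/\ w != 0, m w &
  forall k : KX, k != 0 -> exists n : int, unit (k%:A / w ^ n)].
Proof.
suff [w [w0 wm wP]] : exists w : L, [/\ w != 0, m w &
    forall g, g != 0 -> exists n : int, unit (ι g / w ^ n)].
  exists w; split=> // k k0; have [g [h [h0 kE]]] := base_ratio k.
  have g0 : g != 0.
    by apply/eqP => g0; move: kE; rewrite g0 rmorph0 mul0r => /eqP; rewrite base_eq0 (negPf k0).
  have [n nP] := wP g g0; have [n' nP'] := wP h h0.
  exists (n - n'); have := unit_atM nP (unit_atV nP').
  by rewrite kE div_expz_div.
case: (pselect (O (xvar L))) => xO; last first.
  exists (xvar L)^-1; split.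
  - by rewrite invr_neq0 // xvarE poly_in_eq0 polyX_eq0.
  - by apply/max_idealP; right; rewrite invrK.
  move=> g g0; exists (- (size g).-1%:Z); rewrite -invr_expz -exprnP exprVn invrK.
  exact: infinite_place_poly.
have [π [π0 sπ πP]] := finite_place_generator xO.
exists (ι π); split; first by rewrite poly_in_eq0.
  by apply/πP.
move=> g; elim: (size g) {-2}g (leqnn (size g)) => {g} [|n IH] g.
  by rewrite leqn0 size_poly_eq0 => ->.
move=> sg g0; case: (boolP (π %| g)) => [/dvdpP[q gE]|ng]; last first.
  exists 0; rewrite expr0z divr1; case: (val_ring_cases (val_ring_poly g xO)) => //.
  by move/πP; rewrite (negPf ng).
have q0 : q != 0 by apply: contraNneq g0 => q0; rewrite gE q0 mul0r.
have [|n' nP'] := IH q _ q0.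
  move: sg; rewrite gE size_mul //; case: (size π) sπ => [|[|l]] // _.
  by rewrite !addnS /= ltnS; apply: leq_trans; apply: leq_addr.
exists (n' + 1); rewrite expfzDr ?poly_in_eq0 // expr1z invfM gE rmorphM /=.
by rewrite mulrACA mulfV ?poly_in_eq0 // mulr1.
Qed.

End OnePlace.
End LocalParameters.
Arguments base_eq0 {K} L k.

Lemma div_mul_expz (E : fieldType) (z c d u v : E) (n k : int) :
  z != 0 -> c != 0 -> d != 0 ->
  z ^ (n - k) * (u / v) = (c / z ^ n)^-1 * (d / z ^ k) * (c * u / (d * v)).
Proof.
move=> z0 c0 d0; rewrite expfzDr // -invr_expz invfM invrK -mulf_div.
move: (u / v) (z ^ n) (z ^ k)^-1 => U A B; field.
by rewrite c0 d0.
Qed.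

Lemma mul_expr_div_sub (E : fieldType) (z c : E) (n i j : nat) : z != 0 -> (j <= n)%N ->
  c * (z ^+ (n - i) / z ^+ (n - j)) = c / z ^+ n * z ^+ (n - i + j).
Proof.
move=> z0 lj; have -> : z ^+ n = z ^+ (n - j) * z ^+ j by rewrite -exprD subnK.
by rewrite exprD; field; rewrite !expf_neq0.
Qed.

Lemma expr_div_cancel (E : fieldType) (z w c y : E) (k n : nat) :
  w != 0 -> c != 0 -> y != 0 ->
  (z ^+ k / w) ^+ n * (c / w ^+ n)^-1 * (c / y) = z ^+ (k * n) / y.
Proof. by move=> w0 c0 y0; rewrite expr_div_n -exprM; field; rewrite ?(expf_neq0 _ w0) ?y0 ?c0. Qed.

(** * Local parameters and the discrete valuation of a place *)

Section Orders.

Variables (K : fieldType) (L : fieldExtType {fraction {poly K}}).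
Local Notation KX := {fraction {poly K}}.
Local Notation ι := (@poly_in K L).
Local Notation N := (\dim {:L}).

Section OnePlace.

Variable P : place L.
Local Notation O := (val_ring P).
Local Notation m := (max_ideal P).
Local Notation unit := (is_unit_at P).

(* N + 1 elements whose values are distinct modulo the value group of the base
   field would be linearly independent over the base field. *)
Lemma no_long_chain (w : L) (b : nat -> L) : w != 0 -> m w ->
  (forall k : KX, k != 0 -> exists n : int, unit (k%:A / w ^ n)) ->
  (forall i, b i != 0) ->
  (forall i j, (i < j <= N)%N -> m (b i / b j)) ->
  (forall i j, (i <= N)%N -> (j <= N)%N -> m (w * (b i / b j))) -> False.
Proof.
move=> w0 wm wP b0 bm wb.
pose X := [tuple b i | i < N.+1].
have : ~~ free X.
  apply/negP => /eqP Xfree; have := dimvS (subvf <<X>>%VS).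
  by rewrite Xfree size_tuple ltnn.
have [//|] := boolP (free X); move/freeP => nX _; apply: nX => c.
rewrite (eq_bigr (fun i : 'I_N.+1 => c i *: b i)) => [sc0|i _]; last by rewrite -tnth_nth tnth_mktuple.
move=> i; apply/eqP; rewrite -(base_eq0 L); apply: contraT => ci0.
have : \sum_(i < N.+1) (c i)%:A * b i != 0.
  apply: (@sum_neq0_of_distinct_val _ _ P); first by exists i; exact: (mulf_neq0 ci0 (b0 i)).
  move=> {i ci0} i j ij; rewrite !mulf_eq0 !negb_or => /andP[ci _] /andP[cj _].
  have [|n nP] := wP (c i); first by rewrite -(base_eq0 L).
  have [|n' nP'] := wP (c j); first by rewrite -(base_eq0 L).
  move=> /(unit_atM (unit_atM (unit_atV nP) nP')); rewrite -div_mul_expz //.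
  have li : (i <= N)%N by rewrite -ltnS.
  have lj : (j <= N)%N by rewrite -ltnS.
  (* The ratio of two terms is, up to a unit, w^(n - n') b_i / b_j. For n = n' the chain condition
     separates them; otherwise a single factor w outweighs b_i / b_j or its inverse. *)
  case: (n - n') => [[|k]|k].
  - rewrite expr0z mul1r; case: (ltngtP i j) => [lij|lji|/val_inj eij].
    + by apply: max_ideal_unit; apply: bm; rewrite lij.
    + move=> /unit_atV; rewrite invfM invrK mulrC; apply: max_ideal_unit.
      by apply: bm; rewrite lji.
    + by rewrite eij eqxx in ij.
  - rewrite -exprnP exprSr -mulrA; apply: max_ideal_unit; apply: max_idealM (wb _ _ li lj).
    exact: val_ringX (max_ideal_sub wm).
  rewrite NegzE => /unit_atV; rewrite invfM invr_expz opprK invfM invrK (mulrC _^-1).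
  rewrite -exprnP exprSr -mulrA; apply: max_ideal_unit; apply: max_idealM (wb _ _ lj li).
  exact: val_ringX (max_ideal_sub wm).
by rewrite (eq_bigr (fun i : 'I_N.+1 => c i *: b i)) ?sc0 ?eqxx // => j _; rewrite mulr_algl.
Qed.

(** Without a local parameter, every nonzero element of the maximal ideal has a proper divisor
    there; iterating from w yields a chain excluded by [no_long_chain]. *)
Lemma exists_local_parameter : exists t : L, t != 0 /\ local_parameter P t.
Proof.
have [w [w0 wm wP]] := exists_base_uniformizer P.
suff [t [t0 tm tP]] : exists t, [/\ t != 0, m t & forall z, m z -> O (z / t)].
  exists t; split=> //; apply/seteqP; split=> [z /tP zt|_ [z zO <-]] /=.
    by exists (z / t) => //; rewrite mulrC divfK.
  exact: max_idealMr.
apply: contrapT => nt.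
have next t : exists t', t != 0 -> m t -> [/\ t' != 0, m t' & m (t / t')].
  case: (pselect (t != 0 /\ m t)) => [[t0 tm]|h]; last by exists 0 => t0 tm; case: h.
  have : ~ forall z, m z -> O (z / t) by move=> tP; apply: nt; exists t.
  move=> /existsNP[z /not_implyP[zm zt]]; exists z => _ _; split=> //.
    by apply/eqP => z0; apply: zt; rewrite z0 mul0r; apply: val_ring0.
  by apply/max_idealP; right; rewrite invfM invrK mulrC.
have {next}[h hP] := choice next.
pose d i := iter i h w.
have dP i : d i != 0 /\ m (d i).
  by elim: i => [|i [IH0 IHm]] //; case: (hP (d i)).
have d0 i : d i != 0 by case: (dP i).
have dm i : m (d i) by case: (dP i).
have dd i j : (i < j)%N -> m (d i / d j).
  elim: j => // j IH; rewrite ltnS leq_eqVlt => /orP[/eqP->|/IH lij].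
    by case: (hP (d j)).
  have -> : d i / d j.+1 = d i / d j * (d j / d j.+1) by rewrite mulrA divfK.
  by apply: max_idealMr => //; apply: max_ideal_sub; case: (hP (d j)).
apply: (no_long_chain w0 wm wP d0) => [i j /andP[lij _]|i j _ _]; first exact: dd.
rewrite mulrCA; apply: max_idealMr => //.
case: j => [|j]; first by rewrite mulfV //; apply: val_ring1.
exact: max_ideal_sub (dd 0%N _ _).
Qed.

Definition uniformizer : L := sval (cid exists_local_parameter).
Local Notation t := uniformizer.

Lemma uniformizer_neq0 : t != 0.
Proof. by rewrite /uniformizer; case: cid => ? []. Qed.

Lemma local_parameter_uniformizer : local_parameter P t.
Proof. by rewrite /uniformizer; case: cid => ? []. Qed.

Lemma uniformizer_max : m t.
Proof.
by rewrite local_parameter_uniformizer; exists 1; rewrite ?mulr1 //; apply: val_ring1.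
Qed.

Lemma max_ideal_div z : m z -> O (z / t).
Proof.
rewrite local_parameter_uniformizer => -[u uO <-].
by rewrite mulrAC mulfV ?mul1r // uniformizer_neq0.
Qed.

(** By [no_long_chain] applied to the powers of t, w divides t^N. A base multiple of y has the value
    of some w^n, so y divides t^(N n); the exponents of the powers of t dividing y are thus bounded,
    and the largest one is the order. *)
Lemma exists_order z : z != 0 -> exists n : int, unit (z / t ^ n).
Proof.
have t0 := uniformizer_neq0; have tm := uniformizer_max; have tO := max_ideal_sub tm.
suff pos y : y != 0 -> O y -> exists n : nat, unit (y / t ^+ n).
  move=> z0; case: (pselect (O z)) => [/(pos _ z0)[n nP]|/val_ringVN]; first by exists n.
  case/pos => [|n /unit_atV nP]; first by rewrite invr_neq0.
  by exists (- n%:Z); move: nP; rewrite invfM invrK -invr_expz.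
move=> y0 yO.
have [w [w0 wm wP]] := exists_base_uniformizer P.
have tw : O (t ^+ N / w).
  apply: contrapT => tw; have wt : m (w / t ^+ N).
    by apply/max_idealP; right; rewrite invfM invrK mulrC.
  apply: (@no_long_chain w (fun i => t ^+ (N - i)) w0 wm wP) => [i|i j|i j li lj].
  - by rewrite expf_neq0.
  - case/andP=> lij lj; have -> : (N - i = (N - j) + (j - i))%N by lia.
    rewrite exprD mulrC mulKf ?expf_neq0 //; apply: max_ideal_exp => //.
    by rewrite subn_gt0.
  rewrite mul_expr_div_sub //.
  by apply: max_idealMr => //; apply: val_ringX.
have [k [k0 kO ky]] := exists_base_multiple y0 yO.
have [n nP] := wP k k0.
have [M MP] : exists M : nat, O (t ^+ M / y).
  case: n nP => n nP.
    exists (N * n)%N; have : O ((t ^+ N / w) ^+ n * (k%:A / w ^ n%:Z)^-1 * (k%:A / y)).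
      by apply: val_ringM => //; apply: val_ringM; [apply: val_ringX|apply: unit_at_val; apply: unit_atV].
    by rewrite -exprnP expr_div_cancel // base_eq0.
  case: (@not_max_ideal1 _ _ P); have := max_idealM kO (max_ideal_exp wm (ltn0Sn n)).
  by rewrite NegzE -invr_expz -exprnP invrK in nP => /max_ideal_unit-/(_ nP).
pose Q n := `[< O (y / t ^+ n) >].
have Q0 : exists n, Q n by exists 0%N; apply/asboolP; rewrite expr0 divr1.
have QM l : Q l -> (l <= M)%N.
  move/asboolP => lO; rewrite leqNgt; apply/negP => lM.
  have := val_ringM MP lO; rewrite mulrA divfK // exprn_div_le 1?ltnW //.
  move/val_ring_root; rewrite subn_gt0 => /(_ lM).
  by move: tm => /max_idealP[t00|//]; rewrite t00 eqxx in t0.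
case: (ex_maxnP Q0 QM) => l /asboolP lO lmax; exists l.
case: (val_ring_cases lO) => // /max_ideal_div.
by rewrite -mulrA -invfM -exprSr => /asboolP/lmax; rewrite ltnn.
Qed.

Lemma unit_uniformizerX (n : int) : unit (t ^ n) -> n = 0.
Proof.
have tm := uniformizer_max.
case: n => [[//|n]|n]; first by move/max_ideal_unit; case; apply: max_ideal_exp.
by rewrite NegzE -invr_expz => /unit_atV; rewrite invrK => /max_ideal_unit; case; apply: max_ideal_exp.
Qed.

(** Two local parameters differ by a unit, so the integer found with the chosen one is the only
    candidate for [xget]. *)
Lemma order_at_eq z (n : int) : unit (z / t ^ n) -> order_at P z = n.
Proof.
have t0 := uniformizer_neq0; have tn0 k : t ^ k != 0 by rewrite expfz_neq0.
move=> zu; apply: xget_unique.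
  exists t, (z / t ^ n); split=> //; first exact: local_parameter_uniformizer.
  by rewrite mulrCA mulfV ?mulr1 // tn0.
move=> k [s [u [sP uu zE]]].
have st : unit (s / t).
  have sm : m s by rewrite sP; exists 1; rewrite ?mulr1 //; apply: val_ring1.
  have := uniformizer_max; rewrite sP => -[v vO vE].
  have s0 : s != 0 by apply: contra_eqN vE => /eqP->; rewrite mul0r eq_sym.
  apply/unit_atP; split; first by rewrite mulf_neq0 // invr_neq0.
    exact: max_ideal_div.
  by rewrite invfM invrK -vE mulrA mulVf // mul1r.
have zk : unit (z / t ^ k).
  have -> : z / t ^ k = (s / t) ^ k * u by rewrite zE expfzMl exprz_inv -invr_expz mulrAC.
  apply: unit_atM => //.
  exact: unit_atXz.
have := unit_atM (unit_atV zu) zk; rewrite invfM invrK.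
have z0 : z != 0 by have := unit_at_neq0 zk; rewrite mulf_eq0 => /norP[].
rewrite mulrACA mulVf // mul1r invr_expz -expfzDr // => /unit_uniformizerX /eqP.
by rewrite subr_eq0 => /eqP.
Qed.

Lemma order_atP z : z != 0 -> unit (z / t ^ order_at P z).
Proof. by move=> /exists_order[n nP]; rewrite (order_at_eq nP). Qed.

Lemma order_atM z w : z != 0 -> w != 0 -> order_at P (z * w) = order_at P z + order_at P w.
Proof.
move=> z0 w0; apply: order_at_eq; have := unit_atM (order_atP z0) (order_atP w0).
by rewrite mulrACA -invfM -expfzDr // uniformizer_neq0.
Qed.

Lemma order_at_unit z : unit z -> order_at P z = 0.
Proof. by move=> zu; apply: order_at_eq; rewrite expr0z divr1. Qed.

Lemma order_at1 : order_at P 1 = 0.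
Proof. exact: order_at_unit (unit_at1 P). Qed.

Lemma order_atV z : z != 0 -> order_at P z^-1 = - order_at P z.
Proof.
move=> z0; apply/eqP; rewrite -subr_eq0 opprK -order_atM ?invr_neq0 // mulVf //.
by rewrite order_at1.
Qed.

Lemma order_atX z n : z != 0 -> order_at P (z ^+ n) = n%:Z * order_at P z.
Proof.
move=> z0; elim: n => [|n IH]; first by rewrite expr0 order_at1 mul0r.
by rewrite exprS order_atM ?expf_neq0 // IH intS mulrDl mul1r.
Qed.

Lemma order_at_ge0 z : z != 0 -> (0 <= order_at P z) <-> O z.
Proof.
move=> z0; have zu := order_atP z0; have tm := uniformizer_max.
have tn0 : t ^ order_at P z != 0 by rewrite expfz_neq0 // uniformizer_neq0.
split=> [|zO].
  rewrite -[z in O z](divfK tn0); case: (order_at P z) zu {tn0} => // n zu _.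
  by apply: val_ringM; [case: zu|apply: val_ringX; apply: max_ideal_sub].
rewrite leNgt; apply/negP; case: (order_at P z) zu {tn0} => // n.
rewrite NegzE -invr_expz invrK => zu _; apply: (max_ideal_unit _ zu).
by apply: max_idealM => //; apply: max_ideal_exp.
Qed.

Lemma order_at_gt0 z : z != 0 -> (0 < order_at P z) <-> m z.
Proof.
move=> z0; have zV0 : z^-1 != 0 by rewrite invr_neq0.
rewrite ltNge -oppr_ge0 -order_atV //; split=> [/negP h|/max_idealP[zE|h]].
- by apply/max_idealP; right => /order_at_ge0; auto.
- by rewrite zE eqxx in z0.
- by apply/negP => /order_at_ge0; auto.
Qed.

(** Phrased by division so that 0 is included and the set is a subspace; [order_at] has only a
    default value at 0. *)
Definition ord_ge (n : int) z := O (z / t ^ n).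

Lemma ord_geP n z : z != 0 -> ord_ge n z <-> n <= order_at P z.
Proof.
move=> z0; have tn0 k : t ^ k != 0 by rewrite expfz_neq0 // uniformizer_neq0.
have q0 : z / t ^ n != 0 by rewrite mulf_neq0 // invr_neq0.
have e : order_at P (z / t ^ n) = order_at P z - n.
  rewrite order_atM ?invr_neq0 ?tn0 // order_atV ?tn0 //; congr (_ - _).
  by apply: order_at_eq; rewrite mulfV ?tn0 //; apply: unit_at1.
by rewrite /ord_ge -(order_at_ge0 q0) e subr_ge0.
Qed.

Lemma ord_ge_zero n : ord_ge n 0. Proof. by rewrite /ord_ge mul0r; apply: val_ring0. Qed.

Lemma ord_geD n z w : ord_ge n z -> ord_ge n w -> ord_ge n (z + w).
Proof. by rewrite /ord_ge mulrDl; apply: val_ringD. Qed.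

Lemma ord_geM n k z w : ord_ge n z -> ord_ge k w -> ord_ge (n + k) (z * w).
Proof.
move=> zP wP; rewrite /ord_ge expfzDr ?uniformizer_neq0 // invfM mulrACA.
exact: val_ringM.
Qed.

Lemma ord_ge0E z : ord_ge 0 z <-> O z.
Proof. by rewrite /ord_ge expr0z divr1. Qed.

Lemma ord_ge1E z : ord_ge 1 z <-> m z.
Proof.
rewrite /ord_ge expr1z; split=> [h|/max_ideal_div//].
rewrite -[z](divfK uniformizer_neq0); apply: max_idealM => //; exact: uniformizer_max.
Qed.

End OnePlace.
End Orders.

(** * Extension of places *)

Section ExtensionOfPlaces.

Variables (K : fieldType) (L : fieldExtType {fraction {poly K}}).
Local Notation κ := (const_in L).

Definition subring_over_const (S : set L) :=
  (forall c, S (κ c)) /\ forall u v, S u -> S v -> S (u - v) /\ S (u * v).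

Section Closure.

Variables (S : set L) (sS : subring_over_const S).

Lemma subring_const c : S (κ c). Proof. by case: sS. Qed.
Lemma subring0 : S 0. Proof. by rewrite -(rmorph0 κ); apply: subring_const. Qed.
Lemma subring1 : S 1. Proof. by rewrite -(rmorph1 κ); apply: subring_const. Qed.
Lemma subringB u v : S u -> S v -> S (u - v).
Proof. by case: sS => _ h uS vS; case: (h u v). Qed.
Lemma subringM u v : S u -> S v -> S (u * v).
Proof. by case: sS => _ h uS vS; case: (h u v). Qed.
Lemma subringD u v : S u -> S v -> S (u + v).
Proof. by move=> uS vS; rewrite -[v]opprK -[- v]sub0r; apply: subringB => //; apply: subringB => //; apply: subring0. Qed.
Lemma subringX u n : S u -> S (u ^+ n).
Proof. by move=> uS; elim: n => [|n IH]; rewrite ?expr0 ?exprS; [apply: subring1|apply: subringM]. Qed.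
Lemma subring_sum I (r : seq I) (Q : pred I) (f : I -> L) :
  (forall i, Q i -> S (f i)) -> S (\sum_(i <- r | Q i) f i).
Proof. by move=> h; elim/big_ind: _ => //; [apply: subring0|apply: subringD]. Qed.

Definition poly_over (p : {poly L}) := forall i, S p`_i.
Definition adjoin z : set L := [set w | exists2 p, poly_over p & w = p.[z]].

Lemma subring_adjoin z : subring_over_const (adjoin z).
Proof.
split=> [c|_ _ [p pS ->] [q qS ->]].
  exists (κ c)%:P; last by rewrite hornerC.
  by move=> i; rewrite coefC; case: ifP => _; [apply: subring_const|apply: subring0].
split; [exists (p - q)|exists (p * q)]; rewrite ?hornerE // => i.
  by rewrite coefB; apply: subringB.
by rewrite coefM; apply: subring_sum => j _; apply: subringM.
Qed.

Lemma adjoin_sub z : S `<=` adjoin z.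
Proof.
move=> w wS; exists w%:P; last by rewrite hornerC.
by move=> i; rewrite coefC; case: ifP => // _; apply: subring0.
Qed.

Lemma mem_adjoin z : adjoin z z.
Proof.
exists 'X; last by rewrite hornerX.
by move=> i; rewrite coefX; case: eqP => _; [apply: subring1|apply: subring0].
Qed.

Definition fractions (D : L) : set L := [set w | exists k, S (w * D ^+ k)].

Lemma subring_fractions D : S D -> subring_over_const (fractions D).
Proof.
move=> DS; split=> [c|w w' [k wS] [k' wS']].
  by exists 0%N; rewrite mulr1; apply: subring_const.
split; exists (k + k')%N.
  have -> : (w - w') * D ^+ (k + k') = w * D ^+ k * D ^+ k' - w' * D ^+ k' * D ^+ k.
    by rewrite mulrBl exprD -!mulrA [D ^+ k' * _]mulrC.
  by apply: subringB; apply: subringM => //; apply: subringX.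
by rewrite exprD mulrACA; apply: subringM.
Qed.

Variables (θ : L) (θS : S θ) (θVS : ~ S θ^-1).
Hypothesis S_max : forall T, subring_over_const T -> S `<=` T -> ~ T θ^-1 -> T `<=` S.

(** S is maximal among subrings in which θ is not invertible. Every power of 1 - θ s is again of the
    form 1 - θ v, so localizing S at 1 - θ s does not invert θ, and by maximality the localization
    is S. *)
Lemma subring_max_inv s : S s -> S (1 - θ * s)^-1.
Proof.
move=> sS'; have θ0 : θ != 0.
  by apply/eqP => θ0; apply: θVS; rewrite θ0 invr0; apply: subring0.
have D0 : 1 - θ * s != 0.
  apply/eqP => /eqP; rewrite subr_eq0 eq_sym => /eqP θs; apply: θVS.
  by rewrite -[_^-1]mulr1 -θs mulKf.
have DS : S (1 - θ * s) by apply: subringB; [apply: subring1|apply: subringM].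
set D := 1 - _ in D0 DS *.
have Dpow k : exists2 v, S v & D ^+ k = 1 - θ * v.
  elim: k => [|k [v vS IH]]; first by exists 0; [apply: subring0|rewrite mulr0 subr0].
  exists (s + v - s * (θ * v)).
    apply: subringB; first exact: subringD.
    by apply: subringM => //; apply: subringM.
  by rewrite exprS IH /D; ring.
apply: (S_max (subring_fractions DS)).
- by move=> u uS; exists 0%N; rewrite mulr1.
- case=> k; have [v vS ->] := Dpow k; rewrite mulrBr mulr1 mulKf // => h.
  by apply: θVS; rewrite -[θ^-1](subrK v); apply: subringD.
by exists 1%N; rewrite expr1 mulVf //; apply: subring1.
Qed.

(* Lower the degree of p using the relation given by q, whose constant term can
   be moved to the left and inverted. *)
Lemma subring_max_descent z (p q : {poly L}) : z != 0 -> poly_over p -> poly_over q ->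
  θ * p.[z] = 1 -> θ * q.[z^-1] = 1 -> (size q <= size p)%N ->
  exists p', [/\ poly_over p', θ * p'.[z] = 1 & (size p' < size p)%N].
Proof.
move=> z0 pS qS pz qz qp.
have sp : (0 < size p)%N.
  by rewrite lt0n size_poly_eq0; apply: contra_eqN pz => /eqP->; rewrite horner0 mulr0 eq_sym oner_eq0.
set n := (size p).-1; have pn : size p = n.+1 by rewrite prednK.
have q0S := subring_max_inv (qS 0%N).
set D := 1 - θ * q`_0 in q0S.
have D0 : D != 0.
  apply/eqP => /eqP; rewrite subr_eq0 eq_sym => /eqP h; apply: θVS.
  suff -> : θ^-1 = q`_0 by apply: qS.
  by rewrite -[LHS]mulr1 -h mulKf //; apply: contra_eqN h => /eqP->; rewrite mul0r eq_sym oner_eq0.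
have zn : z ^+ n = \sum_(i < n) D^-1 * θ * q`_(n - i) * z ^+ i.
  have DE : D = \sum_(i < n) θ * q`_i.+1 * z^-1 ^+ i.+1.
    rewrite {1}/D -{1}qz (@horner_coef_wide _ n.+1) -?pn // pn big_ord_recl expr0 mulr1.
    rewrite mulrDr addrAC subrr add0r mulr_sumr.
    by apply: eq_bigr => i _; rewrite mulrA.
  apply: (mulfI D0); rewrite {1}DE mulr_suml mulr_sumr [RHS](reindex_inj rev_ord_inj) /=.
  apply: eq_bigr => i _; rewrite subKn //.
  have -> : z ^+ n = z ^+ i.+1 * z ^+ (n - i.+1) by rewrite -exprD subnKC.
  by rewrite exprVn mulrA divfK ?expf_neq0 // -!mulrA mulVKf.
exists (\poly_(i < n) (p`_i + p`_n * (D^-1 * θ * q`_(n - i)))); split.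
- move=> i; rewrite coef_poly; case: ifP => _; last exact: subring0.
  by apply: subringD => //; apply: subringM => //; apply: subringM => //; apply: subringM.
- rewrite horner_poly -pz; congr (_ * _).
  rewrite [RHS]horner_coef pn big_ord_recr /= zn mulr_sumr -big_split /=.
  by apply: eq_bigr => i _; rewrite mulrDl !mulrA.
by rewrite pn ltnS; apply: size_poly.
Qed.

(** If neither z nor 1/z belonged to S, adjoining either one would invert θ. Of the two resulting
    relations of least degree, the longer could be shortened by the other. *)
Lemma subring_max_total z : S z \/ S z^-1.
Proof.
have θ0 : θ != 0.
  by apply/eqP => θ0; apply: θVS; rewrite θ0 invr0; apply: subring0.
apply: contrapT => /not_orP[zS zVS].
have z0 : z != 0 by apply/eqP => z0; apply: zS; rewrite z0; apply: subring0.
have rel y : ~ S y -> exists p, poly_over p /\ θ * p.[y] = 1.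
  move=> yS; have [[p pS pE]|h] := pselect (adjoin y θ^-1).
    by exists p; rewrite -pE mulfV.
  case: yS; apply: (S_max (subring_adjoin y) (@adjoin_sub y) h); exact: mem_adjoin.
pose Q y n := `[< exists p, [/\ poly_over p, θ * p.[y] = 1 & size p = n] >].
have Qex y : ~ S y -> exists n, Q y n.
  by move/rel => [p [pS py]]; exists (size p); apply/asboolP; exists p.
have Qmin y : ~ S y -> exists p, [/\ poly_over p, θ * p.[y] = 1 &
    forall p', poly_over p' -> θ * p'.[y] = 1 -> (size p <= size p')%N].
  move/Qex => ex; case: (ex_minnP ex) => n /asboolP[p [pS py pn]] nmin.
  exists p; split=> // p' pS' py'; rewrite pn; apply: nmin.
  by apply/asboolP; exists p'.
have [p [pS pz pmin]] := Qmin z zS; have [q [qS qz qmin]] := Qmin z^-1 zVS.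
case: (leqP (size q) (size p)) => [|/ltnW] le_size.
  have [p' [pS' pz']] := subring_max_descent z0 pS qS pz qz le_size.
  by rewrite ltnNge pmin.
have pz2 : θ * p.[z^-1^-1] = 1 by rewrite invrK.
have zV0 : z^-1 != 0 by rewrite invr_neq0.
have [q' [qS' qz']] := subring_max_descent zV0 qS pS qz pz2 le_size.
by rewrite ltnNge qmin.
Qed.

End Closure.

(** Chevalley's extension theorem: a subring containing A and maximal among those in which θ is not
    invertible is a valuation ring. *)
Lemma exists_place_above (A : set L) (θ : L) : subring_over_const A -> A θ ->
  ~ A θ^-1 -> exists P : place L, A `<=` val_ring P /\ max_ideal P θ.
Proof.
move=> sA θA θVA.
(* Zorn's lemma is applied to X through its union with A, so that the empty chain, whose union is
   the empty set, satisfies Q too. *)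
pose Q X := subring_over_const (A `|` X) /\ ~ (A `|` X) θ^-1.
have [X [[sS θVS] Xmax]] : exists X, Q X /\ forall Y, X `<` Y -> ~ Q Y.
  apply: Zorn_bigcup => C CQ Ctot.
  have pair u v : (A `|` \bigcup_(X in C) X) u -> (A `|` \bigcup_(X in C) X) v ->
      exists2 X, (X = set0 \/ C X) & (A `|` X) u /\ (A `|` X) v.
    move=> [uA|[X XC uX]] [vA|[Y YC vY]].
    - by exists set0; [left|split; left].
    - by exists Y; [right|split; [left|right]].
    - by exists X; [right|split; [right|left]].
    case: (Ctot _ _ XC YC) => sub.
      by exists Y; [right|split; right=> //; apply: sub].
    by exists X; [right|split; right=> //; apply: sub].
  have QX X : X = set0 \/ C X -> Q X.
    case=> [->|/CQ//]; rewrite /Q setU0; split=> //.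
  have subX X : X = set0 \/ C X -> A `|` X `<=` A `|` \bigcup_(X in C) X.
    move=> [->|XC] u [uA|uX]; [by left|by []|by left|by right; exists X].
  split.
    split=> [c|u v uS vS]; first by left; case: sA.
    have [X XC [uX vX]] := pair u v uS vS.
    have [[_ /(_ u v uX vX)[? ?]] _] := QX X XC.
    by split; apply: (subX X XC).
  move=> θS; have [X XC [θX _]] := pair _ _ θS θS.
  by case: (QX X XC).
have Smax T : subring_over_const T -> A `|` X `<=` T -> ~ T θ^-1 -> T `<=` A `|` X.
  move=> sT ST θT; apply: contrapT => nT.
  have AT : A `|` T = T by apply/seteqP; split=> u; [case=> // uA; apply: ST; left|right].
  apply: (Xmax T); last by rewrite /Q AT.
  split; first by move=> u uX; apply: ST; right.
  by move=> TX; apply: nT => u /TX; right.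
have θS : (A `|` X) θ by left.
have valS : is_valuation_ring (A `|` X).
  split; last by exists θ^-1.
  - by case: sS.
  - by case: sS.
  exact: (subring_max_total sS θS θVS Smax).
exists (Place valS); split; first by move=> u uA; left.
by apply/max_idealP; right.
Qed.

End ExtensionOfPlaces.

(** * Approximation and the fundamental inequality *)

Section Separation.

Variables (K : fieldType) (L : fieldExtType {fraction {poly K}}).
Implicit Types (P Q : place L) (s : seq (place L)).

Lemma unit_atN P z : is_unit_at P z -> is_unit_at P (- z).
Proof.
move=> zu; rewrite -mulN1r -(rmorph1 (const_in L)) -rmorphN; apply: unit_atM => //.
by apply: unit_at_const; rewrite oppr_eq0 oner_neq0.
Qed.

Lemma order_atN P z : order_at P (- z) = order_at P z.
Proof.
have [->|z0] := eqVneq z 0; first by rewrite oppr0.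
by apply: order_at_eq; rewrite mulNr; apply/unit_atN/order_atP.
Qed.

Lemma place_inj P Q : val_ring P = val_ring Q -> P = Q.
Proof.
by case: P Q => [O OP] [O' OP'] /= e; rewrite -e in OP' *; congr Place; apply: Prop_irrelevance.
Qed.

(* Every element of L becomes integral at Q after division by a high power of an
   element that is not. *)
Lemma val_ring_sub_eq P Q : val_ring Q `<=` val_ring P -> Q = P.
Proof.
move=> QP; apply: place_inj; apply/seteqP; split=> // u uP.
apply: contrapT => uQ; case: (val_ringP P) => _ _ _ [z]; apply.
have u0 : u != 0 by apply/eqP => u0; apply: uQ; rewrite u0; apply: val_ring0.
have [->|z0] := eqVneq z 0; first exact: val_ring0.
have uord : order_at Q u < 0 by rewrite ltNge; apply/negP => /(order_at_ge0 Q u0).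
set M := `|order_at Q z|%N.
have zuQ : val_ring Q (z / u ^+ M).
  apply/order_at_ge0; first by rewrite ?(mulf_neq0, invr_neq0, expf_neq0).
  rewrite order_atM ?invr_neq0 ?expf_neq0 // order_atV ?expf_neq0 // order_atX // /M.
  by move: (order_at Q z) (order_at Q u) uord => a b; nia.
rewrite -[z](divfK (expf_neq0 M u0)).
by apply: val_ringM; [apply: QP|apply: val_ringX].
Qed.

Lemma eventually_seq (T : eqType) (s : seq T) (G : T -> nat -> Prop) :
  (forall x, x \in s -> exists r0, forall r, (r0 <= r)%N -> G x r) ->
  exists r0, forall r, (r0 <= r)%N -> forall x, x \in s -> G x r.
Proof.
elim: s => [_|x s IH h]; first by exists 0%N.
have [|r1 h1] := IH; first by move=> y ys; apply: h; rewrite inE ys orbT.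
have [r2 h2] := h x (mem_head _ _); exists (maxn r1 r2) => r.
rewrite geq_max => /andP[r1r r2r] y; rewrite inE => /orP[/eqP->|]; first exact: h2.
exact: h1.
Qed.

(** Induction on s: if Y has no pole at the new place P, a high power of some Z integral at Q but
    not at P is added. Where both Y and Z have poles, a large exponent makes the pole of the power
    outweigh that of Y. *)
Lemma exists_pole s Q : Q \notin s ->
  exists Y, val_ring Q Y /\ forall P, P \in s -> ~ val_ring P Y.
Proof.
elim: s => [_|P s IH]; first by exists 0; split=> //; apply: val_ring0.
rewrite inE negb_or => /andP[QP /IH[Y [YQ Ys]]].
have [YP|YP] := pselect (val_ring P Y); last first.
  by exists Y; split=> // R; rewrite inE => /orP[/eqP->|/Ys].
have [Z [ZQ ZP]] : exists Z, val_ring Q Z /\ ~ val_ring P Z.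
  apply: contrapT => h; move/eqP: QP; apply; apply: val_ring_sub_eq => z zQ.
  by apply: contrapT => zP; apply: h; exists z.
have [R Rs|r0 r0P] := @eventually_seq _ s (fun R r => ~ val_ring R (Y + Z ^+ r)).
  have YR := Ys R Rs; have [ZR|ZR] := pselect (val_ring R Z).
    exists 0%N => r _ h; apply: YR; rewrite -[Y](addrK (Z ^+ r)).
    by apply: val_ringB => //; apply: val_ringX.
  have Y0 : Y != 0 by apply/eqP => Y0; apply: YR; rewrite Y0; apply: val_ring0.
  have Z0 : Z != 0 by apply/eqP => Z0; apply: ZR; rewrite Z0; apply: val_ring0.
  have Yord : order_at R Y < 0 by rewrite ltNge; apply/negP => /(order_at_ge0 R Y0).
  have Zord : order_at R Z < 0 by rewrite ltNge; apply/negP => /(order_at_ge0 R Z0).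
  exists `|order_at R Y|.+1 => r rP h.
  have : ord_ge R (order_at R Y) (Z ^+ r).
    have -> : Z ^+ r = (Y + Z ^+ r) + - Y by rewrite addrAC subrr add0r.
    apply: ord_geD; last first.
      by apply/ord_geP; rewrite ?oppr_eq0 // order_atN.
    have [->|n0] := eqVneq (Y + Z ^+ r) 0; first exact: ord_ge_zero.
    by apply/ord_geP => //; apply: le_trans (ltW Yord) _; apply/order_at_ge0.
  move/ord_geP; rewrite expf_neq0 // => /(_ isT); rewrite order_atX //.
  by move: (order_at R Y) (order_at R Z) Yord Zord rP => a b; nia.
exists (Y + Z ^+ r0.+1); split.
  by apply: val_ringD => //; apply: val_ringX.
move=> R; rewrite inE => /orP[/eqP->|]; last exact: r0P.
move=> h; apply: ZP; apply: (@val_ring_root _ _ _ _ r0.+1) => //.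
by rewrite -[_ ^+ _](addKr Y) addrC; apply: val_ringB.
Qed.

(** Inversion turns the poles on s into zeros; 1 + Y replaces Y when Y vanishes at Q. *)
Lemma exists_separator s Q : Q \notin s ->
  exists u, is_unit_at Q u /\ forall P, P \in s -> max_ideal P u.
Proof.
move=> /exists_pole[Y [YQ Ys]].
have [Ym|Yu] := val_ring_cases YQ; last first.
  exists Y^-1; split; first exact: unit_atV.
  by move=> P /Ys YP; apply/max_idealP; right; rewrite invrK.
exists (1 + Y)^-1; split; first by apply/unit_atV/unit_atD => //; apply: unit_at1.
move=> P /Ys YP; apply/max_idealP; right; rewrite invrK => h; apply: YP.
by rewrite -[Y](addKr 1) addrC; apply: val_ringB => //; apply: val_ring1.
Qed.

Lemma ord_ge_large P u z (n : int) : max_ideal P u ->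
  exists r0, forall r, (r0 <= r)%N -> ord_ge P n (z * u ^+ r).
Proof.
move=> um; have [->|z0] := eqVneq z 0.
  by exists 0%N => r _; rewrite mul0r; apply: ord_ge_zero.
have [u0|u0] := eqVneq u 0.
  by exists 1%N => -[//|r] _; rewrite u0 expr0n mulr0; apply: ord_ge_zero.
have uord : 0 < order_at P u by apply/order_at_gt0.
exists `|n - order_at P z|%N => r rP; apply/ord_geP.
  by rewrite mulf_neq0 // expf_neq0.
rewrite order_atM ?expf_neq0 // order_atX //.
by move: (order_at P z) (order_at P u) uord rP => a b; nia.
Qed.

End Separation.

Lemma mul_div_div (E : fieldType) (g h v b a : E) :
  g / h * v * (b / a) = g * b * (v / (h * a)).
Proof. by rewrite invfM; ring. Qed.

Section FundamentalInequality.

Variables (F : finFieldType) (L : fieldExtType {fraction {poly F}}).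
Local Notation ι := (@poly_in F L).
Local Notation N := (\dim {:L}).
Implicit Types (P Q : place L) (s l : seq (place L)) (θ : L).

Lemma poly_in_coef_wide n (g : {poly F}) : (size g <= n)%N ->
  ι g = \sum_(i < n) const_in L g`_i * xvar L ^+ i.
Proof.
move=> sg; rewrite poly_in_coef.
rewrite (big_ord_widen n (fun i => const_in L g`_i * xvar L ^+ i) sg) big_mkcond.
apply: eq_bigr => i _; case: ltnP => // gi.
by rewrite nth_default // rmorph0 mul0r.
Qed.

Lemma lcomb_pair (I J : finType) (b : I * J -> L) (c : I * J -> F) :
  lcomb b c = \sum_i \sum_j const_in L (c (i, j)) * b (i, j).
Proof. by rewrite pair_bigA; apply: eq_bigr => -[]. Qed.

Lemma free_le_span (I J : finType) (b : I -> L) (E : J -> L) :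
  free_mod [set 0] b -> (forall i, exists c, b i = lcomb E c) -> (#|I| <= #|J|)%N.
Proof.
move=> bfree bE; have s0 : subspace [set 0 : L].
  by split=> // c u v -> ->; rewrite mulr0 addr0.
pose V : set L := [set z | exists c, z = lcomb E c].
have sV : subspace V.
  split; first by exists (fun=> 0); rewrite /lcomb big1 // => j _; rewrite rmorph0 mul0r.
  by move=> a _ _ [c ->] [d ->]; exists (fun j => a * c j + d j); rewrite lcombD lcombZ.
apply: (free_le_gen sV s0 bE bfree) => _ [c ->].
by exists c; apply: subrr.
Qed.

Lemma exists_denominator (I : finType) (z : I -> L) :
  exists h (G : I -> 'I_N -> {poly F}), h != 0 /\
    forall i, z i = \sum_(j < N) ι (G i j) / ι h * (vbasis {:L})`_j.
Proof.
have /choice[k kP] : forall ij : I * 'I_N, exists gh : {poly F} * {poly F},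
    gh.2 != 0 /\ (coord (vbasis {:L}) ij.2 (z ij.1))%:A = ι gh.1 / ι gh.2.
  move=> ij; have [g [h [h0 e]]] := base_ratio L (coord (vbasis {:L}) ij.2 (z ij.1)).
  by exists (g, h).
have k0 ij : (k ij).2 != 0 by case: (kP ij).
exists (\prod_ij (k ij).2), (fun i j => (k (i, j)).1 * \prod_(ij | ij != (i, j)) (k ij).2).
split; first by apply/prodf_neq0.
move=> i; rewrite [LHS](coord_vbasis (memvf (z i))); apply: eq_bigr => j _.
case: (kP (i, j)) => _ /= e; rewrite -mulr_algl e; congr (_ * _).
have -> : \prod_ij (k ij).2 = (k (i, j)).2 * \prod_(ij | ij != (i, j)) (k ij).2.
  exact: bigD1.
rewrite !rmorphM /= -mulf_div mulfV ?mulr1 //.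
by rewrite poly_in_eq0; apply/prodf_neq0.
Qed.

(* Substitute for [L : K(θ)] <= N δ in the proof of [free_le_growth]. *)
Definition growth θ (δ : nat) := forall T : nat, exists2 A : {poly F}, A != 0 &
  forall r, (r <= T)%N -> exists2 B : {poly F}, θ ^+ r = ι B / ι A & (size B <= δ * T + 1)%N.

Lemma growth_poly h : growth (ι h) (size h).-1.
Proof.
move=> T; exists 1; first exact: oner_neq0.
move=> r rT; exists (h ^+ r); first by rewrite rmorphXn rmorph1 divr1.
by apply: leq_trans (size_poly_exp_leq h r) _; rewrite addn1 ltnS leq_mul2l rT orbT.
Qed.

(** The powers up to T have the common denominator x^T, of degree T, hence the rate 1. *)
Lemma growth_infinity : growth (xvar L)^-1 1.
Proof.
have x0 : xvar L != 0 by rewrite xvarE poly_in_eq0 polyX_eq0.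
move=> T; exists 'X^T; first by rewrite monic_neq0 // monicXn.
move=> r rT; exists 'X^(T - r); last by rewrite size_polyXn; lia.
have -> : ι 'X^T = xvar L ^+ (T - r) * xvar L ^+ r by rewrite -exprD subnK // rmorphXn.
have -> : ι 'X^(T - r) = xvar L ^+ (T - r) by rewrite rmorphXn.
by rewrite invfM mulrA mulfV ?mul1r ?exprVn // expf_neq0.
Qed.

Section Growth.

Variables (s : seq (place L)) (θ : L) (δ : nat).
Hypotheses (θ0 : θ != 0) (θO : forall P, P \in s -> val_ring P θ).
Hypothesis θ_growth : growth θ δ.
Local Notation R := [set z | forall P, P \in s -> val_ring P z].
Local Notation J := [set z | forall P, P \in s -> val_ring P (z / θ)].

Lemma subspace_semilocal : subspace R.
Proof.
split=> [P _|c u v uR vR P Ps]; first exact: val_ring0.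
by apply: val_ringD; [apply: val_ringM (val_ring_const _ _) (uR _ Ps)|apply: vR].
Qed.

(** A θ-adic argument: modulo θ only the coefficients of θ^0 survive, and they vanish by
    independence; then divide by θ and repeat. *)
Lemma free_powers (I : finType) (z : I -> L) T (c : I -> nat -> F) :
  (forall i, R (z i)) -> free_mod J z ->
  \sum_(r < T) lcomb z (c^~ r) * θ ^+ r = 0 -> forall r i, (r < T)%N -> c i r = 0.
Proof.
move=> zR zfree; elim: T c => [//|T IH] c.
have lcR d : R (lcomb z d) := subspace_lcomb d subspace_semilocal zR.
rewrite big_ord_recl expr0 mulr1 => s0.
have e : lcomb z (c^~ 0%N) = - (\sum_(r < T) lcomb z (fun i => c i r.+1) * θ ^+ r) * θ.
  move/eqP: s0; rewrite addr_eq0 => /eqP ->; rewrite mulNr mulr_suml; congr (- _).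
  by apply: eq_bigr => r _; rewrite -mulrA -exprSr.
have c0 : forall i, c i 0%N = 0.
  apply: zfree => P Ps; rewrite e mulfK //; apply/val_ringN/val_ring_sum => r _.
  by apply: val_ringM; [apply: lcR|apply/val_ringX/θO].
have lc0 : lcomb z (c^~ 0%N) = 0 by apply: big1 => i _; rewrite c0 rmorph0 mul0r.
move: e; rewrite lc0 mulNr => /esym/eqP; rewrite oppr_eq0 mulf_eq0 (negPf θ0) orbF => /eqP.
by move=> /(IH (fun i r => c i r.+1)) cS [|r] i //; apply: cS.
Qed.

(** The products z_i θ^r with r <= T are independent over F and lie in the span of N (C + δ T + 1)
    elements, by common denominators and degree bounds; the rates of growth in T are compared. *)
Lemma free_le_growth (I : finType) (z : I -> L) :
  (forall i, R (z i)) -> free_mod J z -> (#|I| <= N * δ)%N.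
Proof.
move=> zR zfree; have [h [G [h0 zE]]] := exists_denominator z.
pose C := (\max_(ij : I * 'I_N) size (G ij.1 ij.2))%N.
suff bound T : (#|I| * T.+1 <= N * (C + δ * T + 1))%N.
  (* If [#|I|] were at least N δ + 1, the left-hand side would exceed N δ T by at least T + 1, which
     for T = N C + N is more than the constant term N C + N of the bound. *)
  rewrite leqNgt; apply/negP => lt; have {bound} := bound (N * C + N)%N.
  have := leq_mul lt (leqnn (N * C + N).+1); clearbody C.
  by move: (N) C (δ) #|I| => n c d i; nia.
have [A A0 AP] := θ_growth T.
pose b (k : I * 'I_T.+1) := z k.1 * θ ^+ k.2.
pose E (k : 'I_N * 'I_(C + δ * T + 1)) := xvar L ^+ k.2 * (vbasis {:L})`_(k.1) / ι (h * A).
have -> : (#|I| * T.+1)%N = #|{: I * 'I_T.+1}| by rewrite card_prod card_ord.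
have -> : (N * (C + δ * T + 1))%N = #|{: 'I_N * 'I_(C + δ * T + 1)}|.
  by rewrite card_prod !card_ord.
apply: (@free_le_span _ _ b E) => [c c0 [i r]|[i r]].
  pose c' i (r : nat) := if insub r is Some r' then c (i, r') else 0.
  have c'E j (r' : 'I_T.+1) : c' j r' = c (j, r') by rewrite /c' valK.
  rewrite -c'E; apply: (@free_powers _ z T.+1 c' zR zfree _ r i (ltn_ord r)).
  rewrite -[RHS]c0 lcomb_pair exchange_big /=.
  by apply: eq_bigr => r' _; rewrite mulr_suml; apply: eq_bigr => j _; rewrite c'E mulrA.
have [|B θr sB] := AP r; first by rewrite -ltnS.
exists (fun k : 'I_N * 'I_(C + δ * T + 1) => (G i k.1 * B)`_k.2).
rewrite /b zE /= θr mulr_suml lcomb_pair.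
apply: eq_bigr => j _.
have sGB : (size (G i j * B)%R <= C + δ * T + 1)%N.
  apply: leq_trans (size_polyMleq _ _) _.
  have : (size (G i j) <= C)%N by apply: (leq_bigmax (i, j)).
  by move: sB; lia.
have -> : ι (G i j) / ι h * (vbasis {:L})`_j * (ι B / ι A) =
    ι (G i j * B) * ((vbasis {:L})`_j / ι (h * A)).
  by rewrite !rmorphM; apply: mul_div_div.
rewrite (poly_in_coef_wide sGB) mulr_suml.
by apply: eq_bigr => r' _; rewrite /E /= !mulrA.
Qed.

End Growth.
End FundamentalInequality.

(** * Residue fields and the sum of e f *)

Section DegreeBound.

Variables (F : finFieldType) (L : fieldExtType {fraction {poly F}}).
Local Notation ι := (@poly_in F L).
Local Notation N := (\dim {:L}).
Implicit Types (P Q : place L) (s l : seq (place L)) (θ : L).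

Lemma subspace_val_ring P : subspace (val_ring P).
Proof.
split=> [|c u v uO vO]; first exact: val_ring0.
by apply: val_ringD => //; apply: val_ringM => //; apply: val_ring_const.
Qed.

Lemma subspace_max_ideal P : subspace (max_ideal P).
Proof.
split=> [|c u v um vm]; first exact: max_ideal0.
by apply: max_idealD => //; apply: max_idealM => //; apply: val_ring_const.
Qed.

Lemma exists_growth P : exists θ δ, [/\ θ != 0, max_ideal P θ & growth θ δ].
Proof.
have [xO|xO] := pselect (val_ring P (xvar L)).
  have [π [π0 _ πP]] := finite_place_generator xO.
  exists (ι π), (size π).-1; split; first by rewrite poly_in_eq0.
    by apply/πP.
  exact: growth_poly.
exists (xvar L)^-1, 1%N; split; last exact: growth_infinity.
  by rewrite invr_neq0 // xvarE poly_in_eq0 polyX_eq0.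
by apply/max_idealP; right; rewrite invrK.
Qed.

(** Elements independent modulo the maximal ideal are independent modulo any θ in it, so
    [free_le_growth] bounds their number and the degree is not a default value. *)
Lemma qdim_residue_field P : qdim (val_ring P) (max_ideal P) (place_degree P).
Proof.
have [θ [δ [θ0 θm θg]]] := exists_growth P.
have [sO sm] := (subspace_val_ring P, subspace_max_ideal P).
have [n b bO bfree|n _ nP] := @qdim_of_bound _ _ _ _ (N * δ) sO sm; last first.
  by rewrite /place_degree (xget_qdim sO sm nP).
rewrite -(card_ord n); apply: (@free_le_growth _ _ [:: P] θ δ θ0 _ θg _ b).
- by move=> Q; rewrite inE => /eqP->; apply: max_ideal_sub.
- by move=> i Q; rewrite inE => /eqP->.
apply: free_mod_sub bfree => z /(_ P (mem_head _ _)) zO.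
by rewrite -[z](divfK θ0); apply: max_idealM.
Qed.

Lemma place_degree_gt0 P : (0 < place_degree P)%N.
Proof.
have := qdim_residue_field P; case: (place_degree P) => // -[b [_ bgen _]].
have [c] := bgen 1 (val_ring1 P); rewrite /lcomb big_ord0 subr0 => h.
by case: (not_max_ideal1 h).
Qed.

Section Filtration.

Variable s : seq (place L).
Hypothesis s_uniq : uniq s.

(** The list [l] encodes an effective divisor, each place counted with multiplicity; adding one
    entry at a time makes [free_filtration] an induction on lists. *)
Definition filtration l : set L :=
  [set z | forall P, P \in s -> ord_ge P (count_mem P l)%:Z z].

Lemma subspace_filtration l : subspace (filtration l).
Proof.
split=> [P _|c u v uJ vJ P Ps]; first exact: ord_ge_zero.
apply: ord_geD; last exact: vJ.
by rewrite -[_%:Z]add0r; apply: ord_geM (uJ P Ps); apply/ord_ge0E/val_ring_const.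
Qed.

(** To add Q, a basis of the residue field at Q is multiplied by t^e u^r: t^e moves it to the
    current order at Q, and the separator u, a unit at Q, moves it into the filtration at the other
    places of s. *)
Lemma free_filtration l : {subset l <= s} -> exists (I : finType) (b : I -> L),
  [/\ #|I| = (\sum_(P <- l) place_degree P)%N, forall i, filtration [::] (b i) &
      free_mod (filtration l) b].
Proof.
elim: l => [_|Q l IH ls].
  exists 'I_0, (fun=> 0); split; first by rewrite card_ord big_nil.
    by case.
  by move=> c _ [].
have Qs : Q \in s by apply: ls; rewrite mem_head.
have [|I [b [cI bR bfree]]] := IH; first by move=> P Pl; apply: ls; rewrite inE Pl orbT.
have [d [dO _ dfree]] := qdim_residue_field Q.
have [|u [uQ us]] := @exists_separator _ _ (rem Q s) Q; first by rewrite mem_rem_uniqF.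
set e := count_mem Q l.
have [P Ps|r0 r0P] := @eventually_seq _ (rem Q s) (fun P r => forall i,
    ord_ge P (count_mem P l)%:Z (uniformizer Q ^+ e * d i * u ^+ r)).
  have [i _|r0 r0P] := @eventually_seq _ (enum 'I_(place_degree Q))
      (fun i r => ord_ge P (count_mem P l)%:Z (uniformizer Q ^+ e * d i * u ^+ r)).
    exact/ord_ge_large/us.
  by exists r0 => r rr i; apply: r0P; rewrite ?mem_enum.
pose w := uniformizer Q ^+ e * u ^+ r0.
have wE i : w * d i = uniformizer Q ^+ e * d i * u ^+ r0 by rewrite mulrAC.
have uu : is_unit_at Q (u ^+ r0) by apply: unit_atX.
have t0 := uniformizer_neq0 Q.
have wJ i : filtration l (w * d i).
  move=> P Ps; rewrite wE; have [->|PQ] := eqVneq P Q; last first.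
    by apply: r0P => //; rewrite mem_rem_uniq // inE PQ.
  rewrite -/e /ord_ge -exprnP -(mulrA _ (d i)) mulrC mulKf ?expf_neq0 //.
  by apply: val_ringM => //; apply: unit_at_val.
exists (I + 'I_(place_degree Q))%type.
exists (fun k => match k with inl i => b i | inr j => w * d j end); split.
- by rewrite card_sum cI card_ord big_cons addnC.
- case=> [i|j]; first exact: bR.
  move=> P Ps; have := wJ j P Ps; rewrite /ord_ge /= expr0z divr1 -exprnP => h.
  rewrite -[w * d j](divfK (expf_neq0 (count_mem P l) (uniformizer_neq0 P))).
  by apply: val_ringM => //; apply/val_ringX/max_ideal_sub/uniformizer_max.
apply: (free_mod_cat (subspace_filtration l) _ wJ bfree).
  move=> z zJ P Ps; have := zJ P Ps; rewrite /ord_ge /= -!exprnP exprD invfM mulrCA => h.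
  have tP0 := uniformizer_neq0 P.
  have := val_ringM (val_ringX (Q == P) (max_ideal_sub (uniformizer_max P))) h.
  by rewrite mulVKf // expf_neq0.
move=> c; rewrite lcomb_mull => /(_ Q Qs) h; apply: dfree; apply/ord_ge1E.
move: h; rewrite /ord_ge /= eqxx -/e -!exprnP add1n exprSr /w => h.
have := val_ringM (unit_at_val (unit_atV uu)) h.
suff -> : (u ^+ r0)^-1 * (uniformizer Q ^+ e * u ^+ r0 * lcomb d c / (uniformizer Q ^+ e * uniformizer Q))
   = lcomb d c / uniformizer Q ^+ 1 by [].
have := unit_at_neq0 uu; move: (u ^+ r0) (uniformizer Q ^+ e) (expf_neq0 e t0) => v v' v0' v0.
by field; rewrite v0 v0' t0.
Qed.

End Filtration.

Lemma count_mem_multiset s (e : place L -> nat) Q : uniq s ->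
  count_mem Q (flatten [seq nseq (e P) P | P <- s]) = if Q \in s then e Q else 0%N.
Proof.
elim: s => //= P s IH /andP[Ps /IH{}IH]; rewrite count_cat IH count_nseq inE /=.
case: eqVneq Ps => [-> Ps|PQ _]; first by rewrite mem_head (negPf Ps) mul1n addn0.
by rewrite in_cons eq_sym (negPf PQ).
Qed.

(* Take a basis of each residue field and powers of uniformizers at the places
   of s: by separation this yields sum_P v_P(θ) deg P elements that are
   independent modulo θ, and such elements are bounded by [free_le_growth]. *)
Theorem fundamental_inequality s θ δ : uniq s -> θ != 0 ->
  (forall P, P \in s -> val_ring P θ) -> growth θ δ ->
  (\sum_(P <- s) `|order_at P θ| * place_degree P <= N * δ)%N.
Proof.
move=> us θ0 θO θg.
pose l := flatten [seq nseq `|order_at P θ|%N P | P <- s].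
have ls : {subset l <= s}.
  by move=> P /flattenP[_ /mapP[Q Qs ->]]; rewrite mem_nseq => /andP[_ /eqP->].
have [I [b [cI bR bfree]]] := free_filtration us ls.
have -> : (\sum_(P <- s) `|order_at P θ| * place_degree P)%N = #|I|.
  rewrite cI big_flatten big_map; apply: eq_bigr => P _.
  by rewrite big_nseq iter_addn_0 mulnC.
apply: (free_le_growth θ0 θO θg) => [i P Ps|].
  exact/ord_ge0E/bR.
apply: free_mod_sub bfree => z zJ P Ps; rewrite count_mem_multiset // Ps.
have oP := (order_at_ge0 P θ0).2 (θO P Ps).
rewrite gez0_abs // -[z](divfK θ0) -[X in ord_ge _ X]add0r.
by apply: ord_geM; [apply/ord_ge0E/zJ|apply/ord_geP].
Qed.

End DegreeBound.

(** * Riemann-Roch spaces and the genus *)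

Section Riemann.

Variables (F : finFieldType) (L : fieldExtType {fraction {poly F}}).
Local Notation ι := (@poly_in F L).
Local Notation N := (\dim {:L}).
Local Notation x := (xvar L).
Implicit Types (P Q : place L) (s l : seq (place L)) (θ : L) (D : divisor L).

Lemma xvar_neq0 : x != 0.
Proof. by rewrite xvarE poly_in_eq0 polyX_eq0. Qed.

Lemma max_ideal_xvarV P : ~ val_ring P x -> max_ideal P x^-1.
Proof. by move=> xO; apply/max_idealP; right; rewrite invrK. Qed.

(** Taken for functions on places, so that E + Q can be written without a proof of finite
    support. *)
Definition rr_space (E : place L -> int) : set L :=
  [set z | forall P, ord_ge P (- E P) z].

Lemma riemann_roch_spaceE D : riemann_roch_space D = rr_space D.
Proof.
apply/seteqP; split=> z zD => [P|z0 P]; last exact/ord_geP/zD.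
have [->|z0] := eqVneq z 0; first exact: ord_ge_zero.
by apply/ord_geP => //; apply: zD.
Qed.

Lemma subspace_rr (E : place L -> int) : subspace (rr_space E).
Proof.
split=> [P|c u v uE vE P]; first exact: ord_ge_zero.
apply: ord_geD; last exact: vE.
by rewrite -[- E P]add0r; apply: ord_geM (uE P); apply/ord_ge0E/val_ring_const.
Qed.

Lemma subspace_0 : subspace [set 0 : L].
Proof. by split=> // c u v -> ->; rewrite mulr0 addr0. Qed.

Lemma ellE D n : qdim (rr_space D) [set 0] n -> ell D = n.
Proof.
by move=> nP; rewrite /ell riemann_roch_spaceE; apply: xget_qdim nP;
  [apply: subspace_rr|apply: subspace_0].
Qed.

Lemma ord_ge_le P (n k : int) z : n <= k -> ord_ge P k z -> ord_ge P n z.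
Proof.
move=> nk; have [->|z0] := eqVneq z 0; first by move=> _; apply: ord_ge_zero.
by move=> /(ord_geP _ _ z0) kz; apply/ord_geP => //; apply: le_trans kz.
Qed.

Lemma rr_space_sub (E E' : place L -> int) : (forall P, E P <= E' P) ->
  rr_space E `<=` rr_space E'.
Proof. by move=> EE' z zE P; apply: ord_ge_le (zE P); rewrite lerN2. Qed.

(** Multiplication by t^(E(Q) + 1), with t a uniformizer at Q, embeds the quotient into the residue
    field at Q. *)
Lemma qdim_le_rr_add1 (E : place L -> int) Q :
  qdim_le (rr_space (fun P => E P + (P == Q)%:Z)) (rr_space E) (place_degree Q).
Proof.
have sE := subspace_rr; apply: qdim_of_bound => // n b bE bfree.
have [d [dO dgen _]] := qdim_residue_field Q.
rewrite -(card_ord n) -(card_ord (place_degree Q)).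
pose w := uniformizer Q ^ (E Q + 1).
have t0 := uniformizer_neq0 Q.
have w0 : w != 0 by rewrite expfz_neq0.
apply: (@free_le_gen _ _ _ _ _ _ (fun i => w * b i) d (subspace_val_ring Q) (subspace_max_ideal Q)) => //.
  move=> i; have := bE i Q; rewrite /ord_ge eqxx.
  by rewrite -invr_expz invrK mulrC.
move=> c; rewrite lcomb_mull => h; apply: bfree => P.
have [->|PQ] := eqVneq P Q; last first.
  have := subspace_lcomb c (sE _) bE P.
  by rewrite (negPf PQ) addr0.
move/ord_ge1E: h; rewrite /ord_ge -invr_expz invrK /w expfzDr // mulrC mulrCA.
by rewrite expr1z mulrA mulfK // mulrC.
Qed.

Lemma qdim_le_rr (E : place L -> int) l :
  qdim_le (rr_space (fun P => E P + (count_mem P l)%:Z)) (rr_space E)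
    (\sum_(P <- l) place_degree P)%N.
Proof.
elim: l => [|Q l IH].
  exists 0%N; rewrite ?big_nil //.
  have -> : (fun P => E P + (count_mem P [::])%:Z) = E by apply/funext => P; rewrite addr0.
  exists (fun=> 0); split=> [[]|z zE|c _ []] //.
  by exists (fun=> 0); rewrite /lcomb big_ord0 subr0.
rewrite big_cons; apply: (qdim_le_add _ _ _ _ IH); first exact: subspace_rr.
- by apply: rr_space_sub => P; rewrite lerDl.
- by apply: rr_space_sub => P; rewrite lerD2l lez_nat leq_addl.
pose E' P := E P + (count_mem P l)%:Z.
move: (qdim_le_rr_add1 E' Q).
rewrite (_ : (fun P => E' P + _) = (fun P => E P + (count_mem P (Q :: l))%:Z)) //.
by apply/funext => P; rewrite /E' /= PoszD [in RHS]eq_sym -addrA [(P == Q)%:Z + _]addrC.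
Qed.

Lemma divisor_degree_seq D s : uniq s -> (forall P, P \notin s -> D P = 0) ->
  divisor_degree D = \sum_(P <- s) D P * (place_degree P)%:Z.
Proof.
move=> us Ds; rewrite /divisor_degree [RHS]fsbig_seq //.
apply/esym/fsbig_widen => // P [_ /= /negP Ps].
by rewrite Ds // mul0r.
Qed.

Lemma exists_support D : exists2 s, uniq s & forall P, P \notin s -> D P = 0.
Proof.
have [s sE] := (finite_seqP _).1 (Defs.finite_support D).
exists (undup s); first exact: undup_uniq.
move=> P; rewrite mem_undup => Ps; apply/eqP; apply: contraNT Ps => DP.
by have : [set` s] P by rewrite -sE.
Qed.

(** D' is reached from D by adding places one at a time, and each raises the dimension by at most
    its degree. *)
Lemma ell_le D D' (l' : nat) : (forall P, D P <= D' P) ->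
  qdim (rr_space D') [set 0] l' ->
  exists2 l : nat, qdim (rr_space D) [set 0] l &
    l'%:Z - l%:Z <= divisor_degree D' - divisor_degree D.
Proof.
move=> DD' l'P; have sD := subspace_rr; have s0 := subspace_0.
have [s1 us1 s1P] := exists_support D; have [s2 us2 s2P] := exists_support D'.
pose s := undup (s1 ++ s2); have us : uniq s by apply: undup_uniq.
have sP P : P \notin s -> D P = 0 /\ D' P = 0.
  by rewrite mem_undup mem_cat negb_or => /andP[/s1P ? /s2P ?].
have [l _ lP] := qdim_sub (sD D') (sD D) s0 (rr_space_sub DD') l'P.
exists l => //; pose e P := `|D' P - D P|%N.
have [c cle cP] := qdim_le_rr D (flatten [seq nseq (e P) P | P <- s]).
have DE : (fun P => D P + (count_mem P (flatten [seq nseq (e P) P | P <- s]))%:Z) = D'.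
  apply/funext => P; rewrite count_mem_multiset //; case: ifPn => [_|/sP[-> ->]].
    by rewrite /e gez0_abs ?subr_ge0 // addrCA subrr addr0.
  by rewrite addr0.
rewrite DE in cP.
have -> : l' = (c + l)%N.
  apply: (qdim_inj (sD D') s0 l'P); apply: (qdim_add (sD D)) cP lP => //.
    by move=> _ ->; case: (sD D).
  exact: rr_space_sub.
rewrite PoszD addrK (divisor_degree_seq us) => [|P /sP[]//].
rewrite (divisor_degree_seq us) => [|P /sP[]//].
rewrite -sumrB; apply: le_trans (_ : c%:Z <= (\sum_(P <- s) e P * place_degree P)%N%:Z) _.
  rewrite lez_nat; apply: leq_trans cle _; rewrite big_flatten big_map.
  by apply: leq_sum => P _; rewrite big_nseq iter_addn_0 mulnC.
rewrite (big_morph Posz PoszD (erefl 0%:Z)); apply: ler_sum => P _.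
by rewrite PoszM /e gez0_abs ?subr_ge0 // mulrBl.
Qed.

(** Each zero contributes at least 1 to the fundamental inequality, so there are at most N δ of
    them. *)
Lemma finite_zeros θ δ : θ != 0 -> growth θ δ -> finite_set [set P | max_ideal P θ].
Proof.
move=> θ0 θg; apply: contrapT => /infinite_set_fset-/(_ (N * δ).+1)[X XP Xn].
have := @fundamental_inequality _ _ (finmap.enum_fset X) θ δ (finmap.fset_uniq X) θ0 _ θg.
have XO P : P \in finmap.enum_fset X -> val_ring P θ by move=> PX; apply: max_ideal_sub; apply: XP.
have Xm P : P \in finmap.enum_fset X -> (1 <= `|order_at P θ| * place_degree P)%N.
  move=> PX; rewrite muln_gt0 place_degree_gt0 andbT absz_gt0.
  by rewrite gt_eqF //; apply/order_at_gt0 => //; apply: XP.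
move=> /(_ XO); apply/negP; rewrite -ltnNge; apply: leq_trans Xn _.
by rewrite -sum1_size !big_seq; apply: leq_sum.
Qed.

End Riemann.

(** * The genus from the spaces L(n (x)_oo) *)

Section Genus.

Variables (F : finFieldType) (L : fieldExtType {fraction {poly F}}).
Local Notation ι := (@poly_in F L).
Local Notation N := (\dim {:L}).
Local Notation x := (xvar L).
Implicit Types (P Q : place L) (s l : seq (place L)) (D : divisor L).

Definition finite_place P := `[< val_ring P x >].

Lemma xvarV_neq0 : x^-1 != 0. Proof. by rewrite invr_neq0 // xvar_neq0. Qed.

Lemma order_xvarV_gt0 P : ~~ finite_place P -> 0 < order_at P x^-1.
Proof. by move=> /asboolP /max_ideal_xvarV xm; apply/order_at_gt0 => //; apply: xvarV_neq0. Qed.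

Lemma order_poly_ge0 P h : finite_place P -> h != 0 -> 0 <= order_at P (ι h).
Proof.
move=> /asboolP xO h0; apply/order_at_ge0; first by rewrite poly_in_eq0.
exact: val_ring_poly.
Qed.

Lemma order_poly_infinite P h : ~~ finite_place P -> h != 0 ->
  order_at P (ι h) = - ((size h).-1%:Z * order_at P x^-1).
Proof.
move=> /asboolP xO h0; have hu := infinite_place_poly xO h0.
have xn0 n : x ^+ n != 0 by rewrite expf_neq0 // xvar_neq0.
have := order_at_unit hu; rewrite order_atM ?poly_in_eq0 ?invr_neq0 ?xn0 //.
rewrite order_atV ?xn0 // order_atX ?xvar_neq0 // order_atV ?xvar_neq0 // => /eqP.
by rewrite subr_eq0 mulrN opprK => /eqP.
Qed.

(* The divisor of zeros of h away from infinity, plus n times the divisor of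
   poles of x. *)
Definition polar_coef (h : {poly F}) (n : nat) P : int :=
  if finite_place P then order_at P (ι h) else n%:Z * order_at P x^-1.

Lemma finite_set_zeros_poly h : h != 0 -> finite_set [set P | max_ideal P (ι h)].
Proof. by move=> h0; apply: (finite_zeros _ (growth_poly L h)); rewrite poly_in_eq0. Qed.

Lemma finite_set_infinite_places : finite_set [set P | ~~ finite_place P].
Proof.
apply: sub_finite_set (finite_zeros xvarV_neq0 (growth_infinity L)) => P /= /asboolP.
exact: max_ideal_xvarV.
Qed.

Lemma polar_finite_support h n : h != 0 -> finite_set [set P | polar_coef h n P != 0].
Proof.
move=> h0; apply: (@sub_finite_set _ _ ([set P | max_ideal P (ι h)] `|` [set P | ~~ finite_place P])).
  move=> P /=; rewrite /polar_coef; case: ifPn => [fP oh|]; last by right.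
  left; apply/order_at_gt0; first by rewrite poly_in_eq0.
  by rewrite lt_neqAle eq_sym oh order_poly_ge0.
by rewrite finite_setU; split; [apply: finite_set_zeros_poly|apply: finite_set_infinite_places].
Qed.

Definition polar_divisor h n (h0 : h != 0) : divisor L :=
  Divisor (polar_finite_support n h0).

(** The fundamental inequality is used twice, with h at the finite places and with 1/x at the
    infinite ones. *)
Lemma polar_degree_le h n (h0 : h != 0) :
  divisor_degree (polar_divisor n h0) <= (N * ((size h).-1 + n))%N%:Z.
Proof.
have [s us sP] := exists_support (polar_divisor n h0).
rewrite (divisor_degree_seq us sP) (bigID finite_place) /=.
rewrite mulnDr PoszD; apply: lerD.
  have := fundamental_inequality (filter_uniq finite_place us) _ _ (growth_poly L h).
  rewrite poly_in_eq0 => /(_ h0) bound; apply: le_trans (_ : _ <= _%N%:Z) _; last first.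
    rewrite lez_nat; apply: bound => P; rewrite mem_filter => /andP[/asboolP xO _].
    exact: val_ring_poly.
  rewrite (big_morph Posz PoszD (erefl 0%:Z)) big_filter; apply: ler_sum => P fP.
  by rewrite /polar_coef fP PoszM gez0_abs // order_poly_ge0.
have := fundamental_inequality (filter_uniq (predC finite_place) us) xvarV_neq0 _ (growth_infinity L).
rewrite muln1 => bound; apply: le_trans (_ : _ <= (_ * n)%N%:Z) _; last first.
  rewrite lez_nat leq_mul2r; apply/orP; right; apply: bound => P; rewrite mem_filter => /andP[fP _].
  exact: max_ideal_sub (max_ideal_xvarV (elimN (asboolP _) fP)).
rewrite PoszM (big_morph Posz PoszD (erefl 0%:Z)) big_filter mulr_suml.
apply: ler_sum => P fP; rewrite /polar_coef (negPf fP) PoszM gez0_abs; last exact/ltW/order_xvarV_gt0.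
by rewrite -mulrA mulrC.
Qed.

(** b is the degree of the pole divisor of x; its equality with N is obtained inside
    [has_genus_of_pole_spaces]. *)
Lemma exists_pole_degree : exists b : nat, forall n,
  divisor_degree (polar_divisor n (oner_neq0 {poly F})) = n%:Z * b%:Z.
Proof.
have [s sE] := (finite_seqP _).1 finite_set_infinite_places.
have sP P : P \in undup s = ~~ finite_place P.
  rewrite mem_undup; apply/idP/idP => h; first by have : [set` s] P by []; rewrite -sE.
  by have : [set P | ~~ finite_place P] P by []; rewrite sE.
exists (\sum_(P <- undup s) `|order_at P x^-1| * place_degree P)%N => n.
rewrite (divisor_degree_seq (undup_uniq s)); last first.
  move=> P; rewrite sP negbK /= /polar_coef => ->; rewrite rmorph1; exact: order_at1.
rewrite (big_morph Posz PoszD (erefl 0%:Z)) mulr_sumr big_seq [RHS]big_seq.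
apply: eq_bigr => P; rewrite sP => fP /=; rewrite /polar_coef (negPf fP) PoszM gez0_abs ?mulrA //.
exact/ltW/order_xvarV_gt0.
Qed.

Lemma qdim_mul (V : set L) (u : L) n : u != 0 -> qdim V [set 0] n ->
  qdim [set z | V (u * z)] [set 0] n.
Proof.
move=> u0 [b [bV bgen bfree]]; exists (fun i => u^-1 * b i); split=> [i|z /bgen[c cz]|c].
- by rewrite /= mulVKf.
- exists c; rewrite lcomb_mull; apply: (mulfI u0).
  by rewrite mulrBr mulVKf // mulr0; apply: cz.
rewrite lcomb_mull => /eqP; rewrite mulf_eq0 invr_eq0 (negPf u0) /= => /eqP.
exact: bfree.
Qed.

Lemma rr_space_polar h n : h != 0 -> rr_space (polar_coef h n) =
  [set z | rr_space (polar_coef 1 (n + (size h).-1)%N) (ι h * z)].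
Proof.
move=> h0; have ih0 : ι h != 0 by rewrite poly_in_eq0.
apply/seteqP; split=> z zE P; have := zE P; have [->|z0] := eqVneq z 0;
  try by rewrite ?mulr0 => _; apply: ord_ge_zero.
  move/(ord_geP _ _ z0) => h1; apply/ord_geP; first by rewrite mulf_neq0.
  move: h1; rewrite order_atM // /polar_coef; case: ifPn => fP.
    by rewrite rmorph1 order_at1 oppr0 -lerBlDl sub0r.
  rewrite (order_poly_infinite fP) // PoszD mulrDl => h1.
  by rewrite opprD addrC lerD2l.
move/(ord_geP _ _ (mulf_neq0 ih0 z0)) => h1; apply/ord_geP => //.
move: h1; rewrite order_atM // /polar_coef; case: ifPn => fP.
  by rewrite rmorph1 order_at1 oppr0 -[in X in X -> _]lerBlDl sub0r.
by rewrite (order_poly_infinite fP) // PoszD mulrDl opprD addrC lerD2l.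
Qed.

Lemma exists_polar_bound D (n0 : nat) : exists h n, [/\ h != 0, (n0 <= n)%N &
  forall P, D P <= polar_coef h n P].
Proof.
have [s us sP] := exists_support D.
have /choice[π πP] : forall P, exists π : {poly F}, π != 0 /\
    (finite_place P -> max_ideal P (ι π)).
  move=> P; case: (boolP (finite_place P)) => fP; last by exists 1; rewrite oner_neq0.
  have [π [π0 _ πP]] := finite_place_generator (elimT (asboolP _) fP).
  by exists π; split=> // _; apply/πP.
have π0 P : π P != 0 by case: (πP P).
(* Absolute values suffice because D only has to be dominated; the summand n0 of n reaches the range
   where dimensions are known. *)
pose h := \prod_(P <- s) π P ^+ `|D P|%N.
pose n := (n0 + \sum_(P <- s) `|D P|)%N.
have h0 : h != 0 by rewrite prodf_seq_neq0; apply/allP => P _; rewrite expf_neq0.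
exists h, n; split; rewrite ?leq_addr // => P; rewrite /polar_coef.
have [Ps|Ps] := boolP (P \in s); last first.
  rewrite sP //; case: ifPn => fP; first exact: order_poly_ge0.
  by rewrite mulr_ge0 // ltW // order_xvarV_gt0.
case: ifPn => fP.
  pose h' := \prod_(Q <- s | Q != P) π Q ^+ `|D Q|%N.
  have h'0 : h' != 0 by rewrite prodf_seq_neq0; apply/allP => Q _; rewrite expf_neq0 ?implybT.
  have -> : h = π P ^+ `|D P|%N * h' by rewrite /h (bigD1_seq P).
  rewrite rmorphM rmorphXn order_atM ?expf_neq0 ?poly_in_eq0 // order_atX ?poly_in_eq0 //.
  have o1 : 0 < order_at P (ι (π P)) by apply/order_at_gt0; rewrite ?poly_in_eq0 //; case: (πP P) => _; apply.
  have o2 := order_poly_ge0 fP h'0.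
  move: (order_at P (ι (π P))) (order_at P (ι h')) (D P) o1 o2 => a b c; nia.
have o1 := order_xvarV_gt0 fP.
have le1 : (`|D P| <= n)%N by rewrite /n (bigD1_seq P) //=; lia.
by move: (order_at P x^-1) n le1 o1 => a k; move: (D P) => c; nia.
Qed.

Theorem has_genus_of_pole_spaces (g : int) (n0 : nat) : full_constant_field L ->
  (forall n, (n0 <= n)%N -> exists2 l : nat, qdim (rr_space (polar_coef 1 n)) [set 0] l &
     l%:Z = (n * N)%N%:Z + 1 - g) ->
  has_genus L g.
Proof.
move=> fc dimP; have [b bP'] := exists_pole_degree.
pose one0 := oner_neq0 {poly F}.
have {bP'} bP n : divisor_degree (polar_divisor n one0) = n%:Z * b%:Z by apply: bP'.
have [l1 l1P l1E] := dimP n0 (leqnn _).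
(* The dimension of L(n (x)_oo) grows like n N, and by [ell_le] at most like n b. *)
have bN : (N <= b)%N.
  have le0 n P : polar_divisor 0 one0 P <= polar_divisor n one0 P.
    rewrite /= /polar_coef; case: ifPn => // fP.
    by rewrite mul0r mulr_ge0 // ltW // order_xvarV_gt0.
  have [l0 l0P _] := ell_le (le0 n0) l1P.
  rewrite leqNgt; apply/negP => ltbN.
  (* The comparison gives n (N - b) <= l0 + g - 1; if b < N, this n is too large. *)
  have [|l2 l2P l2E] := dimP (n0 + `|g| + l0)%N; first by rewrite -addnA leq_addr.
  have [l0' l0P' le] := ell_le (le0 _) l2P.
  have l0E := qdim_inj (subspace_rr _) (subspace_0 L) l0P l0P'.
  move: le; rewrite !bP l2E -l0E mul0r subr0.
  by move: (N) ltbN {l1P l1E l2P l2E l0E bP dimP} => k; nia.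
have bN' : (b <= N)%N.
  by have := polar_degree_le 1 one0; rewrite bP size_poly1 /= mul1r lez_nat muln1.
have {bN bN'} bE : b = N by apply/eqP; rewrite eqn_leq bN bN'.
split=> //.
  exists (polar_divisor n0 one0); rewrite bP (ellE (D := polar_divisor n0 one0) l1P) l1E bE PoszM; lia.
move=> D; have [h [n [h0 n0n Dle]]] := exists_polar_bound D n0.
have [|l2 l2P l2E] := dimP (n + (size h).-1)%N; first exact: leq_trans (leq_addr _ _).
have := qdim_mul (u := ι h) _ l2P; rewrite poly_in_eq0 -rr_space_polar // => /(_ h0) l2P'.
have [l lP le] := ell_le (D := D) (D' := polar_divisor n h0) Dle l2P'.
rewrite (ellE lP); have := polar_degree_le n h0.
move: le l2E; rewrite mulnC addnC.
by move: (divisor_degree D) (divisor_degree _) ((n + (size h).-1) * N)%N => c d k; lia.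
Qed.

End Genus.

(** * Kummer extensions of exponent q - 1 *)

Section PlacesOverPolynomials.

Variables (F : finFieldType) (L : fieldExtType {fraction {poly F}}).
Local Notation ι := (@poly_in F L).
Local Notation x := (xvar L).
Local Notation κ := (const_in L).
Local Notation KX := {fraction {poly F}}.
Implicit Types (P : place L) (g h : {poly F}).

(** A nonconstant h is not invertible in F[x], so [exists_place_above] applies to the ring F[x]. *)
Lemma exists_finite_place_above h : (1 < size h)%N ->
  exists P : place L, finite_place P /\ max_ideal P (ι h).
Proof.
move=> sh; pose A : set L := [set z | exists g, z = ι g].
have sA : subring_over_const A.
  split=> [c|_ _ [g ->] [g' ->]]; first by exists c%:P.
  by split; [exists (g - g'); rewrite rmorphB|exists (g * g'); rewrite rmorphM].
have h0 : h != 0 by rewrite -size_poly_gt0 (ltn_trans _ sh).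
have [||P [AP hP]] := @exists_place_above _ _ A (ι h) sA; first by exists h.
  move=> [g gh]; have : h %| 1.
    apply/dvdpP; exists g; apply: (@poly_in_inj _ L); rewrite rmorphM rmorph1 /=.
    by rewrite -gh mulVf // poly_in_eq0.
  by rewrite dvdp1 => /eqP sh1; rewrite sh1 in sh.
exists P; split; last exact: hP.
apply/asboolP/AP; exists 'X; exact: xvarE.
Qed.

(** Here A consists of the rational functions of degree at most 0, in which 1/x is not
    invertible. *)
Lemma exists_infinite_place : exists P : place L, ~~ finite_place P.
Proof.
pose A : set L := [set z | exists g h, [/\ h != 0, (size g <= size h)%N & z * ι h = ι g]].
have sA : subring_over_const A.
  split=> [c|z z' [g [h [h0 gh zE]]] [g' [h' [h'0 gh' zE']]]].
    exists c%:P, 1; rewrite oner_neq0 rmorph1 mulr1 size_poly1; split=> //.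
    exact: size_polyC_leq1.
  have hh0 : h * h' != 0 by rewrite mulf_neq0.
  have sgh (u v w t : {poly F}) : w != 0 -> t != 0 -> (size u <= size w)%N ->
      (size v <= size t)%N -> (size (u * v)%R <= size (w * t)%R)%N.
    move=> w0 t0 uw vt; rewrite (size_mul w0 t0); apply: leq_trans (size_polyMleq _ _) _.
    by rewrite -!subn1 leq_sub2r // leq_add.
  split.
    exists (g * h' - g' * h), (h * h'); split=> //.
      apply: leq_trans (size_polyD _ _) _; rewrite size_polyN geq_max sgh //.
      by rewrite mulrC sgh.
    by rewrite rmorphB !rmorphM /= -zE -zE' mulrBl; ring.
  exists (g * g'), (h * h'); split=> //; first exact: sgh.
  by rewrite !rmorphM /= -zE -zE' mulrACA.
have [||P [AP xP]] := @exists_place_above _ _ A x^-1 sA.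
- exists 1, 'X; rewrite polyX_eq0 size_poly1 size_polyX; split=> //.
  by rewrite -xvarE mulVf ?xvar_neq0 // rmorph1.
- move=> [g [h [h0 gh]]]; rewrite invrK xvarE -rmorphM => /(@poly_in_inj _ L) gE.
  by move: gh; rewrite -gE mulrC size_mulX // ltnn.
exists P; apply/asboolP => xO; move/max_idealP: xP => [|]; last by rewrite invrK.
by move/eqP; rewrite (negPf (xvarV_neq0 L)).
Qed.

Lemma power_decomposition (π g : {poly F}) : (1 < size π)%N -> g != 0 ->
  exists n g', g = π ^+ n * g' /\ ~~ (π %| g').
Proof.
move=> sπ; have π0 : π != 0 by rewrite -size_poly_gt0 (ltn_trans _ sπ).
elim: (size g) {-2}g (leqnn (size g)) => {g} [|n IH] g.
  by rewrite leqn0 size_poly_eq0 => ->.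
move=> sg g0; case: (boolP (π %| g)) => [/dvdpP[q gE]|ng]; last first.
  by exists 0%N, g; rewrite mul1r.
have q0 : q != 0 by apply: contraNneq g0 => q0; rewrite gE q0 mul0r.
have [|k [q' [qE q'π]]] := IH q _ q0.
  move: sg; rewrite gE size_mul //; case: (size π) sπ => [|[|l]] // _.
  by rewrite !addnS /= ltnS; apply: leq_trans; apply: leq_addr.
by exists k.+1, q'; split=> //; rewrite gE qE exprSr -!mulrA [q' * _]mulrC.
Qed.

Section FinitePlace.

Variables (P : place L) (P_fin : finite_place P).

Lemma order_generator_ndvd (π : {poly F}) g : (forall g, max_ideal P (ι g) <-> π %| g) ->
  ~~ (π %| g) -> order_at P (ι g) = 0.
Proof.
move=> πP ng; apply: order_at_unit.
case: (val_ring_cases (val_ring_poly g (elimT (asboolP _) P_fin))) => // /πP.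
by rewrite (negPf ng).
Qed.

(** The polynomial π below P divides h, and it divides a squarefree G at most once. *)
Lemma squarefree_order_le (G h : {poly F}) : G != 0 -> h != 0 ->
  (forall π : {poly F}, (1 < size π)%N -> ~~ (π ^+ 2 %| G)) ->
  max_ideal P (ι h) -> order_at P (ι G) <= order_at P (ι h).
Proof.
move=> G0 h0 Gsf hm; have [π [π0 sπ πP]] := finite_place_generator (elimT (asboolP _) P_fin).
have πle : order_at P (ι π) <= order_at P (ι h).
  have /dvdpP[q hE] := (πP h).1 hm; have q0 : q != 0 by apply: contraNneq h0 => q0; rewrite hE q0 mul0r.
  by rewrite hE rmorphM order_atM ?poly_in_eq0 // lerDr order_poly_ge0.
apply: le_trans πle; have [[|[|n]] [G' [GE ndvd]]] := power_decomposition sπ G0.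
- by rewrite (order_generator_ndvd πP) ?order_poly_ge0 // GE mul1r.
- have G'0 : G' != 0 by apply: contraNneq G0 => q0; rewrite GE q0 mulr0.
  by rewrite GE expr1 rmorphM order_atM ?poly_in_eq0 // (order_generator_ndvd πP ndvd) addr0.
by move: (Gsf π sπ); rewrite GE -(addn2 n) exprD -mulrA mulrCA dvdp_mulr.
Qed.

Lemma order_base_multiple : exists π : {poly F}, [/\ π != 0, max_ideal P (ι π) &
  forall k : KX, k != 0 -> exists n : int, order_at P k%:A = n * order_at P (ι π)].
Proof.
have [π [π0 sπ πP]] := finite_place_generator (elimT (asboolP _) P_fin).
have poly g : g != 0 -> exists n : int, order_at P (ι g) = n * order_at P (ι π).
  move=> g0; have [n [g' [gE ndvd]]] := power_decomposition sπ g0.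
  have g'0 : g' != 0 by apply: contraNneq g0 => q0; rewrite gE q0 mulr0.
  exists n%:Z; rewrite gE rmorphM rmorphXn order_atM ?expf_neq0 ?poly_in_eq0 //.
  by rewrite order_atX ?poly_in_eq0 // (order_generator_ndvd πP ndvd) addr0.
exists π; split=> //; first exact/πP.
move=> k k0; have [g [h [h0 kE]]] := base_ratio L k.
have g0 : g != 0.
  by apply/eqP => g0; move: kE; rewrite g0 rmorph0 mul0r => /eqP; rewrite base_eq0 (negPf k0).
have [n nP] := poly g g0; have [n' nP'] := poly h h0; exists (n - n').
by rewrite kE order_atM ?invr_eq0 ?poly_in_eq0 // order_atV ?poly_in_eq0 // nP nP' mulrBl.
Qed.

End FinitePlace.
End PlacesOverPolynomials.

Lemma eq_of_sub_multiple (i j n : nat) (c : int) : (i < n)%N -> (j < n)%N ->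
  i%:Z - j%:Z = c * n%:Z -> i = j.
Proof. by move=> ltin ltjn; case: (ltrgtP c 0) => [c0|c0|->]; nia. Qed.

(** As e = - N v(y), the i-th term has order congruent to i v(y) modulo N v(y); for i < N these
    orders are distinct. *)
Lemma kummer_sum_neq0 (K : fieldType) (L : fieldExtType {fraction {poly K}})
    (P : place L) (y : L) (e : int) (N n : nat) (c : 'I_n -> L) :
  (n <= N)%N -> y != 0 -> e != 0 -> N%:Z * order_at P y = - e ->
  (forall i, c i != 0 -> exists d : int, order_at P (c i) = d * e) ->
  (exists i, c i != 0) -> \sum_i c i * y ^+ i != 0.
Proof.
move=> nN y0 e0 ye cP [i ci]; apply: (@sum_neq0_of_distinct_val _ _ P).
  by exists i; rewrite mulf_neq0 ?expf_neq0.
move=> {i ci} i j ij; rewrite !mulf_eq0 !negb_or => /andP[ci _] /andP[cj _].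
have [d dP] := cP _ ci; have [d' dP'] := cP _ cj.
move=> /order_at_unit; rewrite order_atM ?invr_eq0 ?mulf_neq0 ?expf_neq0 //.
rewrite order_atV ?mulf_neq0 ?expf_neq0 // !order_atM ?expf_neq0 //.
rewrite !order_atX // dP dP'; move: (order_at P y) ye => w ye h.
have w0 : w != 0 by apply/eqP => w0; move: ye e0; rewrite w0 mulr0 => /esym/eqP; rewrite oppr_eq0 => ->.
have eE : e = - (N%:Z * w) by rewrite ye opprK.
have : (i%:Z - j%:Z - (d - d') * N%:Z) * w = 0.
  by rewrite -[RHS]h eE; ring.
move/eqP; rewrite mulf_eq0 (negPf w0) orbF subr_eq0 => /eqP ijN.
move/eqP: ij; apply; apply: val_inj => /=.
exact: eq_of_sub_multiple (leq_trans (ltn_ord i) nN) (leq_trans (ltn_ord j) nN) ijN.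
Qed.

Section KummerExtension.

Variables (F : finFieldType) (L : fieldExtType {fraction {poly F}}).
Local Notation κ := (const_in L).
Local Notation KX := {fraction {poly F}}.
Variables (y : L) (f : KX) (N : nat).
Hypotheses (y_pow : y ^+ N = f%:A) (L_gen : <<1; y>>%VS = fullv).
Implicit Types (P : place L) (i j : 'I_N).

(** The upper bound comes from X^N - f, the lower one from total ramification at P: a shorter
    relation for y would be a sum of terms of distinct orders. *)
Lemma kummer_dim P (e : int) : (0 < N)%N -> y != 0 -> e != 0 ->
  (forall k : KX, k != 0 -> exists n : int, order_at P k%:A = n * e) ->
  N%:Z * order_at P y = - e -> \dim {:L} = N.
Proof.
move=> N0 y0 e0 eP ye; rewrite -L_gen dim_Fadjoin dimv1 muln1.
have sD := size_minPoly 1 y; apply/eqP; rewrite eqn_leq; apply/andP; split.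
  have pE : (map_poly (in_alg L) ('X^N - f%:P)) = 'X^N - (f%:A)%:P.
    by rewrite rmorphB /= map_polyXn map_polyC.
  have : minPoly 1 y %| 'X^N - (f%:A)%:P.
    apply: minPoly_dvdp; first by apply/polyOver1P; exists ('X^N - f%:P).
    by rewrite rootE !hornerE y_pow subrr.
  by move/dvdp_leq; rewrite -size_poly_gt0 size_XnsubC // sD; apply.
rewrite leqNgt; apply/negP => lt; have /polyOver1P[p pE] := minPolyOver 1%VS y.
have sp : (size p <= N)%N.
  by rewrite -(size_map_poly (in_alg L)) -pE sD; exact: lt.
suff : \sum_(i < size p) (p`_i)%:A * y ^+ i != 0.
  have := minPolyxx 1%VS y; rewrite pE horner_coef size_map_poly => s0 /eqP; apply.
  by rewrite -[RHS]s0; apply: eq_bigr => i _; rewrite coef_map.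
have p0 : p != 0.
  by rewrite -(map_poly_eq0 (in_alg L)) -pE monic_neq0 // monic_minPoly.
have sp0 : (0 < size p)%N by rewrite size_poly_gt0.
apply: (kummer_sum_neq0 sp y0 e0 ye) => [i|]; first by rewrite base_eq0 => /eP.
have lt' : ((size p).-1 < size p)%N by rewrite prednK.
by exists (Ordinal lt'); rewrite base_eq0 -/(lead_coef p) lead_coef_eq0.
Qed.

Hypothesis dimN : \dim {:L} = N.

Lemma kummer_gt0 : (0 < N)%N.
Proof. by rewrite -dimN; apply: (adim_gt0 {:L}%AS). Qed.

Lemma adjoin_degree_kummer : adjoin_degree 1 y = N.
Proof. by have := dim_Fadjoin 1 y; rewrite L_gen dimN dimv1 muln1. Qed.

Lemma minPoly_kummer : minPoly 1 y = 'X^N - (f%:A)%:P.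
Proof.
have pE : (map_poly (in_alg L) ('X^N - f%:P)) = 'X^N - (f%:A)%:P.
  by rewrite rmorphB /= map_polyXn map_polyC.
apply/eqP; rewrite -eqp_monic ?monic_minPoly ?monicXnsubC ?kummer_gt0 //.
rewrite -dvdp_size_eqp.
  by rewrite size_minPoly adjoin_degree_kummer size_XnsubC ?kummer_gt0.
apply: minPoly_dvdp; first by apply/polyOver1P; exists ('X^N - f%:P).
by rewrite rootE !hornerE y_pow subrr.
Qed.

Lemma kummer_expansion z : exists c : 'I_N -> KX, z = \sum_i (c i)%:A * y ^+ i.
Proof.
have /polyOver1P[p pE] := Fadjoin_polyOver 1%VS y z.
exists (fun i => p`_i); rewrite -[LHS](@Fadjoin_poly_eq _ _ 1%AS y) ?L_gen ?memvf //.
rewrite (@horner_coef_wide _ N); last by rewrite -adjoin_degree_kummer size_Fadjoin_poly.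
by apply: eq_bigr => i _; rewrite pE coef_map.
Qed.

Lemma kummer_free (c : 'I_N -> KX) : \sum_i (c i)%:A * y ^+ i = 0 -> forall i, c i = 0.
Proof.
move=> s0; pose p := \poly_(i < N) (if insub i is Some i' then c i' else 0).
have pE (i : 'I_N) : p`_i = c i by rewrite coef_poly ltn_ord valK.
have : minPoly 1 y %| map_poly (in_alg L) p.
  apply: minPoly_dvdp; first by apply/polyOver1P; exists p.
  rewrite rootE (@horner_coef_wide _ N); last by rewrite size_map_poly size_poly.
  by apply/eqP; rewrite -[RHS]s0; apply: eq_bigr => i _; rewrite coef_map pE.
have [p0 _ i|p0] := eqVneq p 0; first by rewrite -pE p0 coef0.
move/dvdp_leq; rewrite map_poly_eq0 p0 => /(_ isT).
rewrite size_minPoly adjoin_degree_kummer size_map_poly => lt.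
by have := leq_trans lt (size_poly N _); rewrite ltnn.
Qed.

(** With ζ in F, ζ y is again a root of the minimal polynomial X^N - f of y. *)
Lemma exists_automorphism (ζ : F) : ζ ^+ N = 1 -> exists σ : L -> L,
  [/\ forall u v, σ (u - v) = σ u - σ v, forall u v, σ (u * v) = σ u * σ v,
      forall k : KX, σ k%:A = k%:A & σ y = κ ζ * y].
Proof.
move=> ζN.
have [σ hom σy] : exists2 σ : 'End(L), kHom 1 fullv σ & σ y = κ ζ * y.
  have rt : root (map_poly \1%VF (minPoly 1 y)) (κ ζ * y).
    rewrite lfun1_poly minPoly_kummer rootE !hornerE exprMn y_pow -rmorphXn ζN rmorph1.
    by rewrite mul1r subrr.
  exists (kHomExtend 1 \1 y (κ ζ * y)).
    by rewrite -L_gen; apply: kHomExtendP => //; apply: kHom1.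
  by apply: (kHomExtend_val (kHom1 1%AS 1%AS)).
have /kHom_monoid_morphism[σ1 σM] := hom.
exists σ; split=> //; first exact: (raddfB σ).
by move=> k; exact: (etrans (linearZ_LR σ k 1) (congr1 (fun u => k *: u) σ1)).
Qed.

End KummerExtension.

(** * Power sums over a finite field *)

Section PowerSums.

Variable F : finFieldType.
Local Notation N := (#|F|.-1).

Lemma card_predn_gt0 : (0 < N)%N.
Proof. by rewrite -subn1 subn_gt0 finRing_gt1. Qed.

Lemma expf_card_pred (c : F) : c != 0 -> c ^+ N = 1.
Proof.
move=> c0; apply: (mulfI c0); rewrite -exprS prednK ?mulr1 ?expf_card //.
exact: ltn_trans (finRing_gt1 _).
Qed.

Lemma exists_primitive_root : exists g : F, N.-primitive_root g.
Proof.
have [||||g _ gP] := hasP (@has_prim_root F N (enum (predC1 (0 : F))) _ _ _ _).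
- exact: card_predn_gt0.
- by apply/allP => c; rewrite mem_enum unity_rootE => /expf_card_pred ->.
- exact: enum_uniq.
- by rewrite -cardE cardC1.
- by exists g.
Qed.

(** Translation by 1 permutes F, so adding 1 to every element leaves their sum unchanged. *)
Lemma card_natr : #|F|%:R = 0 :> F.
Proof.
have : \sum_(c : F) (c + 1) = \sum_(c : F) c.
  by rewrite [RHS](reindex_inj (addIr 1)).
by rewrite big_split /= sumr_const => /eqP; rewrite -subr_eq0 addrAC subrr add0r => /eqP.
Qed.

(** A primitive root g permutes the nonzero elements by multiplication, which multiplies the sum by
    g^k. When N divides k the sum is N = -1 in F. *)
Lemma sum_unit_powers k :
  \sum_(c : F | c != 0) c ^+ k = if (N %| k)%N then - 1 else 0.
Proof.
case: ifPn => [/dvdnP[d ->]|ndvd].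
  rewrite (eq_bigr (fun=> 1)) => [|c c0]; last by rewrite mulnC exprM expf_card_pred ?expr1n.
  rewrite sumr_const (_ : #|_| = N); last first.
    by rewrite -(cardC1 (0 : F)); apply: eq_card => c; rewrite !inE.
  by rewrite -subn1 mulrnBr ?card_natr ?sub0r // (ltn_trans _ (finRing_gt1 _)).
have [g gP] := exists_primitive_root.
have g0 : g != 0 by rewrite (prim_root_eq0 gP) -lt0n card_predn_gt0.
have gk : g ^+ k != 1 by rewrite -(prim_order_dvd gP).
have e : \sum_(c : F | c != 0) c ^+ k = g ^+ k * \sum_(c : F | c != 0) c ^+ k.
  rewrite {1}(reindex_inj (mulfI g0)) mulr_sumr /=.
  by apply: eq_big => c; rewrite ?mulf_eq0 ?negb_or ?g0 // exprMn.
apply/eqP; move/eqP: e; rewrite -subr_eq0 -{1}[\sum_(c | _) _]mul1r -mulrBl mulf_eq0.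
by rewrite subr_eq0 eq_sym (negPf gk).
Qed.

End PowerSums.

(** * Conjugate places and the splitting of L(n (x)_oo) *)

Section BaseAutomorphisms.

Variables (F : finFieldType) (L : fieldExtType {fraction {poly F}}).
Local Notation ι := (@poly_in F L).
Local Notation κ := (const_in L).
Local Notation x := (xvar L).
Local Notation KX := {fraction {poly F}}.

Definition base_automorphism (σ : L -> L) :=
  [/\ forall u v, σ (u - v) = σ u - σ v, forall u v, σ (u * v) = σ u * σ v &
      forall k : KX, σ k%:A = k%:A].

Section Automorphism.

Variables (σ : L -> L) (σP : base_automorphism σ).

Lemma autB u v : σ (u - v) = σ u - σ v. Proof. by case: σP. Qed.
Lemma autM u v : σ (u * v) = σ u * σ v. Proof. by case: σP. Qed.
Lemma aut_base k : σ k%:A = k%:A. Proof. by case: σP. Qed.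
Lemma aut_poly g : σ (ι g) = ι g. Proof. exact: aut_base. Qed.
Lemma aut_const c : σ (κ c) = κ c. Proof. exact: aut_base. Qed.
Lemma aut_xvar : σ x = x. Proof. exact: aut_base. Qed.
Lemma aut0 : σ 0 = 0. Proof. by rewrite -[in LHS](subrr 0) autB subrr. Qed.
Lemma aut1 : σ 1 = 1. Proof. by rewrite -(rmorph1 κ) aut_const. Qed.
Lemma autD u v : σ (u + v) = σ u + σ v.
Proof. by rewrite -[v in LHS]opprK autB -[- v]sub0r autB aut0 sub0r opprK. Qed.
Lemma autX u n : σ (u ^+ n) = σ u ^+ n.
Proof. by elim: n => [|n IH]; rewrite ?expr0 ?aut1 // !exprS autM IH. Qed.
Lemma aut_sum (I : finType) (f : I -> L) : σ (\sum_i f i) = \sum_i σ (f i).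
Proof. exact: (big_morph σ autD aut0). Qed.
Lemma autV u : σ u^-1 = (σ u)^-1.
Proof.
have [->|u0] := eqVneq u 0; first by rewrite invr0 aut0 invr0.
have e : σ u^-1 * σ u = 1 by rewrite -autM mulVf // aut1.
have su0 : σ u != 0 by apply: contra_eqN e => /eqP->; rewrite mulr0 eq_sym oner_eq0.
by apply: (mulIf su0); rewrite e mulVf.
Qed.

Lemma exists_conjugate_place (P : place L) :
  exists P' : place L, val_ring P' = [set z | val_ring P (σ z)].
Proof.
suff h : is_valuation_ring [set z | val_ring P (σ z)] by exists (Place h).
split=> [c|u v uO vO|z|] /=.
- by rewrite aut_const; apply: val_ring_const.
- by rewrite autB autM; split; [apply: val_ringB|apply: val_ringM].
- by rewrite autV; case: (val_ringP P) => _ _ /(_ (σ z)).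
(* An element outside the new ring is taken in the base field, which σ fixes. *)
have [k [k0 /max_idealP[|kP]]] := exists_base_max_ideal P.
  by move/eqP; rewrite base_eq0 (negPf k0).
by exists (k%:A)^-1; rewrite autV aut_base.
Qed.

End Automorphism.

Lemma order_at_ratio_ge0 (P : place L) z w : w != 0 ->
  (forall n : nat, ord_ge P (- (n%:Z * order_at P w)) z <-> val_ring P (z * w ^+ n)).
Proof.
move=> w0 n; have [->|z0] := eqVneq z 0.
  by rewrite mul0r; split=> _; [apply: val_ring0|apply: ord_ge_zero].
have zw0 : z * w ^+ n != 0 by rewrite mulf_neq0 // expf_neq0.
split=> [/(ord_geP _ _ z0)|/(order_at_ge0 P zw0)] h.
  by apply/(order_at_ge0 P zw0); rewrite order_atM ?expf_neq0 // order_atX // -lerBlDr sub0r.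
by apply/ord_geP => //; move: h; rewrite order_atM ?expf_neq0 // order_atX // -lerBlDr sub0r.
Qed.

(** Membership is expressed by valuation rings alone: conjugation transports these, while
    uniformizers are chosen independently at each place. *)
Lemma rr_polarE n z : rr_space (polar_coef 1 n) z <->
  (forall P : place L, finite_place P -> val_ring P z) /\
  (forall P : place L, ~~ finite_place P -> val_ring P (z * x^-1 ^+ n)).
Proof.
split=> [h|[h1 h2] P].
  split=> P fP; have := h P; rewrite /polar_coef.
    by rewrite fP rmorph1 order_at1 oppr0 => /ord_ge0E.
  by rewrite (negPf fP) => /(order_at_ratio_ge0 _ _ (xvarV_neq0 L)).
rewrite /polar_coef; case: ifPn => fP; first by rewrite rmorph1 order_at1 oppr0; apply/ord_ge0E/h1.
by apply/order_at_ratio_ge0; [apply: xvarV_neq0|apply: h2].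
Qed.

Lemma rr_polar_aut n σ z : base_automorphism σ ->
  rr_space (polar_coef 1 n) z -> rr_space (polar_coef 1 n) (σ z).
Proof.
move=> σP /rr_polarE[h1 h2]; have sE P P' : val_ring P' = [set z | val_ring P (σ z)] ->
    finite_place P' = finite_place P.
  by move=> e; rewrite /finite_place e; apply/asbool_equiv_eq; rewrite /= aut_xvar.
apply/rr_polarE; split=> P fP; have [P' P'E] := exists_conjugate_place σP P.
  by have := h1 P'; rewrite (sE _ _ P'E) P'E; apply.
by have := h2 P'; rewrite (sE _ _ P'E) P'E /= autM // autX // autV // aut_xvar //; apply.
Qed.

Variables (y : L) (f : KX).
Local Notation N := (#|F|.-1).
Hypotheses (y_pow : y ^+ N = f%:A) (L_gen : <<1; y>>%VS = fullv).
Hypothesis dimN : \dim {:L} = N.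

(* The components of z are recovered by averaging its conjugates against the
   powers of zeta. *)
Lemma kummer_component (V : set L) (c : 'I_N -> KX) : subspace V ->
  (forall σ z, base_automorphism σ -> V z -> V (σ z)) ->
  V (\sum_i (c i)%:A * y ^+ i) -> forall i, V ((c i)%:A * y ^+ i).
Proof.
move=> sV Vσ; set z := \sum_i _ => zV i.
have /choice[σ σP] : forall ζ : F, exists σ : L -> L, ζ != 0 ->
    base_automorphism σ /\ σ y = κ ζ * y.
  move=> ζ; have [->|ζ0] := eqVneq ζ 0; first by exists id.
  have [σ [h1 h2 h3 h4]] := exists_automorphism y_pow L_gen dimN (expf_card_pred ζ0).
  by exists σ.
have tV : V (\sum_(ζ : F | ζ != 0) κ (ζ ^+ (N - i)) * σ ζ z).
  apply: subspace_sum => // ζ ζ0; apply: subspaceZ => //; apply: Vσ => //.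
  by case: (σP ζ ζ0).
(* The weight ζ^(N - i) stands for ζ^(-i). The component i is counted N = -1 times in F, so dividing
   by N is a change of sign. *)
suff -> : (c i)%:A * y ^+ i = - \sum_(ζ : F | ζ != 0) κ (ζ ^+ (N - i)) * σ ζ z.
  exact: subspaceN.
have e ζ : ζ != 0 -> κ (ζ ^+ (N - i)) * σ ζ z =
    \sum_j (c j)%:A * y ^+ j * κ (ζ ^+ (N - i + j)).
  move=> /σP[σa σy]; rewrite aut_sum // mulr_sumr; apply: eq_bigr => j _.
  rewrite autM // aut_base // autX // σy exprMn exprD !rmorphM !rmorphXn /=.
  by rewrite mulrCA -[RHS]mulrA; congr (_ * _); rewrite mulrA mulrC.
rewrite (eq_bigr _ e) exchange_big /= (bigD1 i) //= [X in _ + X]big1 ?addr0.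
  rewrite -mulr_sumr -rmorph_sum /= sum_unit_powers subnK ?dvdnn; last exact/ltnW/ltn_ord.
  by rewrite rmorphN rmorph1 mulrN1 opprK.
move=> j ji; rewrite -mulr_sumr -rmorph_sum /= sum_unit_powers.
rewrite ifF ?rmorph0 ?mulr0 //; apply/negP => /dvdnP[d dE].
move/eqP: ji; apply; apply: val_inj => /=.
apply: (@eq_of_sub_multiple _ _ N (d%:Z - 1)); rewrite ?ltn_ord //.
rewrite mulrBl mul1r -PoszM -dE PoszD -subzn; last exact/ltnW/ltn_ord.
by ring.
Qed.

End BaseAutomorphisms.

(** The computation behind [radical_pow]: qa and qb count the full n-th powers of z and a removed
    from y^i, and g completes i to a multiple of n. *)
Lemma kummer_radical_power (E : fieldType) (y b z a : E) (n u v i e ra rb g qa qb : nat) :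
  b != 0 -> z != 0 -> a != 0 -> y ^+ n * b = - (z ^+ u * a ^+ v) ->
  (i * u = qa * n + ra)%N -> (i * v = qb * n + rb)%N -> (e * n = g + i)%N ->
  (b ^+ e / (z ^+ qa * a ^+ qb) * y ^+ i) ^+ n =
  (-1) ^+ i * (z ^+ ra * a ^+ rb * b ^+ g).
Proof.
move=> b0 z0 a0 yE ua va ge.
have yi : (y ^+ i) ^+ n = (-1) ^+ i * (z ^+ (i * u) * a ^+ (i * v)) / b ^+ i.
  have -> : (y ^+ i) ^+ n = (y ^+ n * b / b) ^+ i.
    by rewrite mulfK // -!exprM mulnC.
  rewrite yE expr_div_n [in LHS]exprNn [in LHS]exprMn -!exprM.
  by rewrite (mulnC u) (mulnC v).
rewrite exprMn yi !(exprMn, exprVn) -!exprM ge ua va !exprD.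
by field; rewrite !expf_neq0.
Qed.

(** * Integral elements of the extension y^N = - x^u A^v / B *)

Section KummerCurve.

Variables (F : finFieldType) (L : fieldExtType {fraction {poly F}}).
Local Notation ι := (@poly_in F L).
Local Notation κ := (const_in L).
Local Notation x := (xvar L).
Local Notation KX := {fraction {poly F}}.
Local Notation N := (#|F|.-1).
Variables (y : L) (A B : {poly F}) (u v : nat).
Hypotheses (A0 : A != 0) (B_size : (1 < size B)%N).
Hypothesis sqfree : forall π : {poly F}, (1 < size π)%N -> ~~ (π ^+ 2 %| 'X * A * B).
Hypothesis yE : y ^+ N * ι B = - ι ('X^u * A ^+ v).
Hypothesis L_gen : <<1; y>>%VS = fullv.

Lemma B_neq0 : B != 0. Proof. by rewrite -size_poly_gt0 (ltn_trans _ B_size). Qed.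

Local Notation iX0 := (xvar_neq0 L).
Lemma iA_neq0 : ι A != 0. Proof. by rewrite poly_in_eq0. Qed.
Lemma iB_neq0 : ι B != 0. Proof. by rewrite poly_in_eq0 B_neq0. Qed.

Lemma radicandE : ι ('X^u * A ^+ v) = x ^+ u * ι A ^+ v.
Proof. by rewrite rmorphM !rmorphXn. Qed.

Lemma y_neq0 : y != 0.
Proof.
apply/eqP => y0; have := yE; rewrite y0 expr0n gtn_eqF ?card_predn_gt0 // mul0r radicandE.
move/eqP; rewrite eq_sym oppr_eq0 mulf_eq0 !expf_eq0 (negPf iX0) (negPf iA_neq0).
by rewrite !andbF.
Qed.

Definition radicand : KX := tofrac (- ('X^u * A ^+ v)) / tofrac B.

Lemma y_pow : y ^+ N = radicand%:A.
Proof.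
rewrite base_div !base_poly rmorphN; apply: (mulIf iB_neq0).
by rewrite yE divfK // iB_neq0.
Qed.

Lemma order_XAB P (h : {poly F}) : finite_place P -> h != 0 -> max_ideal P (ι h) ->
  [/\ 0 <= order_at P x, 0 <= order_at P (ι A), 0 <= order_at P (ι B) &
  order_at P x + order_at P (ι A) + order_at P (ι B) <= order_at P (ι h)].
Proof.
move=> fP h0 hm.
have X0 : 'X != 0 :> {poly F} by rewrite polyX_eq0.
split; rewrite ?order_poly_ge0 ?B_neq0 //.
have G0 : 'X * A * B != 0 by rewrite !mulf_neq0 // B_neq0.
have := squarefree_order_le fP G0 h0 sqfree hm.
have -> : ι ('X * A * B) = x * ι A * ι B by rewrite !rmorphM.
by rewrite !order_atM ?mulf_neq0 ?iX0 ?iA_neq0 ?iB_neq0.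
Qed.

(** At a place over B the squarefreeness of x A B forces v(x) = v(A) = 0 and v(B) = v(π), so N v(y)
    = - v(π), where v(π) divides all base orders. *)
Lemma dim_kummer : \dim {:L} = N.
Proof.
have [P [fP BP]] := exists_finite_place_above L B_size.
have [π [π0 πm eP]] := order_base_multiple fP.
have [oX oA oB le1] := order_XAB fP B_neq0 BP.
have [_ _ _ le2] := order_XAB fP π0 πm.
have oπ : 0 < order_at P (ι π) by apply/order_at_gt0; rewrite ?poly_in_eq0.
have oB0 : 0 < order_at P (ι B) by apply/order_at_gt0; rewrite ?iB_neq0.
have [n nP] : exists n : int, order_at P (ι B) = n * order_at P (ι π).
  by apply: (eP (tofrac B)); rewrite tofrac_eq0 B_neq0.
have Bπ : order_at P (ι B) = order_at P (ι π).
  have le3 : order_at P (ι B) <= order_at P (ι π).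
    by apply: le_trans le2; rewrite lerDr addr_ge0.
  move: oB0 le3; rewrite nP pmulr_lgt0 // -{2}[order_at P (ι π)]mul1r ler_pM2r // => n0 n1.
  have -> : n = 1 by lia.
  by rewrite mul1r.
apply: (kummer_dim y_pow L_gen (P := P) (e := order_at P (ι π))) => //.
- exact: card_predn_gt0.
- exact: y_neq0.
- by rewrite gt_eqF.
have := congr1 (order_at P) yE; rewrite order_atN radicandE.
rewrite !order_atM ?expf_neq0 ?y_neq0 ?iA_neq0 ?iB_neq0 ?xvar_neq0 //.
rewrite !order_atX ?y_neq0 ?iA_neq0 ?iB_neq0 ?xvar_neq0 // Bπ.
have -> : order_at P x = 0 by lia.
have -> : order_at P (ι A) = 0 by lia.
by rewrite !mulr0 addr0 => /eqP; rewrite addr_eq0 => /eqP.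
Qed.

Implicit Types (i : 'I_N).

(** The radicand of y^i with all exponents reduced modulo N; that of B is - i modulo N, with i = 0
    treated apart because N - 0 is not reduced. *)
Definition residual i : {poly F} :=
  'X^(i * u %% N) * A ^+ (i * v %% N) * B ^+ (if i == 0%N :> nat then 0 else N - i)%N.

Definition radical_coef i : KX :=
  tofrac (B ^+ (i != 0%N :> nat)) / tofrac ('X^(i * u %/ N) * A ^+ (i * v %/ N)).

(* Up to a factor from F[x], [radical i] is the K(x)-multiple of y^i that is
   integral over F[x]. *)
Definition radical i : L := (radical_coef i)%:A * y ^+ i.

Lemma radical_coefE i : (radical_coef i)%:A =
  ι B ^+ (i != 0%N :> nat) / (x ^+ (i * u %/ N) * ι A ^+ (i * v %/ N)).
Proof.
rewrite base_div !base_poly rmorphXn; congr (_ / _).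
by rewrite rmorphM !rmorphXn.
Qed.

Lemma residualE i : ι (residual i) = x ^+ (i * u %% N) * ι A ^+ (i * v %% N) *
   ι B ^+ (if i == 0%N :> nat then 0 else N - i)%N.
Proof. by rewrite !rmorphM !rmorphXn. Qed.

Lemma radical_coef_neq0 i : radical_coef i != 0.
Proof.
rewrite -(base_eq0 L) radical_coefE mulf_neq0 ?invr_neq0 ?mulf_neq0 ?expf_neq0 //.
- exact: iB_neq0.
- exact: iX0.
exact: iA_neq0.
Qed.

Lemma radical_neq0 i : radical i != 0.
Proof. by rewrite /radical mulf_neq0 ?expf_neq0 ?y_neq0 // base_eq0 radical_coef_neq0. Qed.

Lemma residual_neq0 i : residual i != 0.
Proof. by rewrite !mulf_neq0 ?expf_neq0 ?polyX_eq0 ?B_neq0. Qed.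

Lemma radical_pow i : radical i ^+ N = (-1) ^+ i * ι (residual i).
Proof.
rewrite /radical radical_coefE residualE.
apply: (kummer_radical_power (u := u) (v := v)); rewrite -?divn_eq //.
- exact: iB_neq0.
- exact: iX0.
- exact: iA_neq0.
- by rewrite yE radicandE.
by case: eqP => [->|_] //=; rewrite mul1n subnK // ltnW.
Qed.

Lemma order_radical P i : N%:Z * order_at P (radical i) = order_at P (ι (residual i)).
Proof.
rewrite -order_atX ?radical_neq0 // radical_pow -signr_odd mulr_sign.
by case: ifP => // _; rewrite order_atN.
Qed.

(** The exponents are at most N - 1, and v(x) + v(A) + v(B) <= v(h), so the order is at most (N - 1)
    v(h). *)
Lemma order_residual_lt P i (h : {poly F}) : finite_place P -> h != 0 ->
  max_ideal P (ι h) -> order_at P (ι (residual i)) < N%:Z * order_at P (ι h).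
Proof.
move=> fP h0 hm; have [oX oA oB le] := order_XAB fP h0 hm.
have oh : 0 < order_at P (ι h) by apply/order_at_gt0; rewrite ?poly_in_eq0.
rewrite residualE !order_atM ?mulf_neq0 ?expf_neq0 ?iX0 ?iA_neq0 ?iB_neq0 //.
rewrite !order_atX ?iX0 ?iA_neq0 ?iB_neq0 //.
have ra : (i * u %% N < N)%N by rewrite ltn_mod card_predn_gt0.
have rb : (i * v %% N < N)%N by rewrite ltn_mod card_predn_gt0.
have rg : ((if i == 0%N :> nat then 0 else N - i) < N)%N.
  by case: eqP => [_|/eqP i0]; rewrite ?card_predn_gt0 // ltn_subrL lt0n i0 card_predn_gt0.
move: (i * u %% N)%N (i * v %% N)%N (if _ then _ else _) ra rb rg.
move: (order_at P x) (order_at P (ι A)) (order_at P (ι B)) (order_at P (ι h)) oX oA oB le oh.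
move: (N) => n a b c d a0 b0 c0 abc d0 e f g en fn gn.
have : e%:Z * a + f%:Z * b + g%:Z * c <= (n%:Z - 1) * (a + b + c).
  have -> : (n%:Z - 1) * (a + b + c) = (n%:Z - 1) * a + (n%:Z - 1) * b + (n%:Z - 1) * c by ring.
  by rewrite !lerD // ler_wpM2r //; lia.
by nia.
Qed.

(** N times the order of the radical is that of a polynomial. At finite places membership is then
    automatic, and at an infinite place it is a comparison of degrees, the same for all of them. *)
Lemma rr_radical_poly n i (g : {poly F}) : g != 0 ->
  rr_space (polar_coef 1 n) (ι g * radical i) <->
  (N * (size g).-1 + (size (residual i)).-1 <= n * N)%N.
Proof.
move=> g0; have N0 := card_predn_gt0 F.
have z0 : ι g * radical i != 0 by rewrite mulf_neq0 ?radical_neq0 // poly_in_eq0.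
have oz P : N%:Z * order_at P (ι g * radical i) =
    N%:Z * order_at P (ι g) + order_at P (ι (residual i)).
  by rewrite order_atM ?radical_neq0 ?poly_in_eq0 // mulrDr order_radical.
have inf P : ~~ finite_place P -> order_at P (ι g * radical i * x^-1 ^+ n) >= 0 <->
    (N * (size g).-1 + (size (residual i)).-1 <= n * N)%N.
  move=> fP; have o0 := order_xvarV_gt0 fP.
  rewrite order_atM ?expf_neq0 ?xvarV_neq0 // order_atX ?xvarV_neq0 //.
  have := oz P; rewrite !(order_poly_infinite fP) ?residual_neq0 //.
  move: (order_at P (ι g * _)) (order_at P x^-1) o0 => w o o0 h.
  have -> : (0 <= w + n%:Z * o) = (0 <= N%:Z * (w + n%:Z * o)).
    by rewrite pmulr_rge0 // ltz_nat.
  rewrite mulrDr h.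
  have -> : N%:Z * - ((size g).-1%:Z * o) - (size (residual i)).-1%:Z * o + N%:Z * (n%:Z * o) =
    ((n * N)%N%:Z - (N * (size g).-1 + (size (residual i)).-1)%N%:Z) * o.
    by rewrite PoszD !PoszM; ring.
  by rewrite pmulr_lge0 // subr_ge0 lez_nat.
have zn0 : ι g * radical i * x^-1 ^+ n != 0 by rewrite mulf_neq0 // expf_neq0 // xvarV_neq0.
rewrite rr_polarE; split=> [[_ h]|h].
  (* One infinite place must exist for the degree bound to be read off. *)
  have [P fP] := exists_infinite_place L.
  by apply/(inf P fP)/(order_at_ge0 P zn0); apply: h.
split=> P fP; last by apply/(order_at_ge0 P zn0)/(inf P fP).
apply/order_at_ge0 => //; have : 0 <= N%:Z * order_at P (ι g * radical i).
  by rewrite oz addr_ge0 ?mulr_ge0 ?order_poly_ge0 ?residual_neq0.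
by rewrite pmulr_rge0 // ltz_nat.
Qed.

(** A nonconstant reduced denominator d1 vanishes at some finite place where the numerator does not.
    By [order_residual_lt] the radical has smaller order there than d1, so a pole would remain. *)
Lemma rr_radical_integral n i (k : KX) :
  rr_space (polar_coef 1 n) (k%:A * radical i) -> exists g, k%:A = ι g.
Proof.
move=> /rr_polarE[h _]; have [g [d [d0 kE]]] := base_ratio L k.
have [k0|k0] := eqVneq (k%:A : L) 0; first by exists 0; rewrite k0 rmorph0.
have g0 : g != 0 by apply: contraNneq k0 => g0; rewrite kE g0 rmorph0 mul0r.
pose c := gcdp g d; have c0 : c != 0 by rewrite gcdp_eq0 negb_and d0 orbT.
pose g1 := g %/ c; pose d1 := d %/ c.
have gE : g = g1 * c by rewrite divpK // dvdp_gcdl.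
have dE : d = d1 * c by rewrite divpK // dvdp_gcdr.
have g10 : g1 != 0 by apply: contraNneq g0 => e; rewrite gE e mul0r.
have d10 : d1 != 0 by apply: contraNneq d0 => e; rewrite dE e mul0r.
have {}kE : k%:A = ι g1 / ι d1.
  by rewrite kE gE dE !rmorphM -mulf_div mulfV ?mulr1 // poly_in_eq0.
have [/size1_polyC dC|d1_size] := leqP (size d1) 1.
  have dc0 : d1`_0 != 0 by apply: contraNneq d10 => e; rewrite dC e.
  exists (g1 * (d1`_0)^-1%:P); rewrite kE {1}dC rmorphM /=; congr (_ * _).
  by rewrite -!const_inE fmorphV.
have [P [fP dm]] := exists_finite_place_above L d1_size.
have og : order_at P (ι g1) = 0.
  have [π [π0 sπ πP]] := finite_place_generator (elimT (asboolP _) fP).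
  apply: (order_generator_ndvd fP πP); apply/negP => πg.
  have cop : coprimep g1 d1 by apply: coprimep_div_gcd; rewrite d0 orbT.
  have /eqp_size := coprimepP _ _ cop π πg ((πP d1).1 dm).
  by rewrite size_poly1 => sπ1; rewrite sπ1 in sπ.
have z0 : k%:A * radical i != 0 by rewrite mulf_neq0 ?radical_neq0.
have := (order_at_ge0 P z0).2 (h P fP).
rewrite order_atM ?radical_neq0 // kE order_atM ?invr_eq0 ?poly_in_eq0 //.
rewrite order_atV ?poly_in_eq0 // og add0r.
have := order_residual_lt i fP d10 dm; rewrite -order_radical.
by rewrite ltr_pM2l ?ltz_nat ?card_predn_gt0 // -subr_lt0 addrC ltNge => /negP.
Qed.

End KummerCurve.

Lemma base_mul (K : fieldType) (L : fieldExtType {fraction {poly K}})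
  (k l : {fraction {poly K}}) : (k * l)%:A = k%:A * l%:A :> L.
Proof. exact: (rmorphM (in_alg L)). Qed.

(** * Dimension of L(n (x)_oo) and genus of the Kummer curve *)

Section KummerGenus.

Variables (F : finFieldType) (L : fieldExtType {fraction {poly F}}).
Local Notation ι := (@poly_in F L).
Local Notation κ := (const_in L).
Local Notation x := (xvar L).
Local Notation KX := {fraction {poly F}}.
Local Notation N := (#|F|.-1).
Variables (y : L) (A B : {poly F}) (u v : nat).
Hypotheses (A0 : A != 0) (B_size : (1 < size B)%N).
Hypothesis sqfree : forall π : {poly F}, (1 < size π)%N -> ~~ (π ^+ 2 %| 'X * A * B).
Hypothesis yE : y ^+ N * ι B = - ι ('X^u * A ^+ v).
Hypothesis L_gen : <<1; y>>%VS = fullv.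
Implicit Types (i : 'I_N).

Local Notation N0 := (card_predn_gt0 F).
Local Notation R := (residual A B u v).
Local Notation C := (radical_coef A B u v).
Local Notation b := (radical y A B u v).

Lemma rr_expansion n z : rr_space (polar_coef 1 n) z ->
  exists g : 'I_N -> {poly F}, z = \sum_i ι (g i) * b i /\
   forall i, g i != 0 -> (N * (size (g i)).-1 + (size (R i)).-1 <= n * N)%N.
Proof.
move=> zV; have dimN := dim_kummer A0 B_size sqfree yE L_gen.
have yp := y_pow B_size yE.
have [c zE] := kummer_expansion L_gen dimN z.
have cV i : rr_space (polar_coef 1 n) ((c i)%:A * y ^+ i).
  move: zV; rewrite zE => zV.
  apply: (kummer_component yp L_gen dimN (subspace_rr _) _ zV i) => σ w.
  exact: rr_polar_aut.
have cE i : (c i)%:A * y ^+ i = (c i / C i)%:A * b i.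
  by rewrite base_div /radical mulrA divfK // base_eq0 radical_coef_neq0.
have /choice[g gE] : forall i, exists g, (c i / C i)%:A = ι g.
  by move=> i; have := cV i; rewrite cE => /(rr_radical_integral A0 B_size sqfree yE).
exists g; split; first by rewrite zE; apply: eq_bigr => i _; rewrite cE gE.
move=> i g0; apply/(rr_radical_poly A0 B_size yE n i g0).
by rewrite -gE -cE.
Qed.

Lemma residual_size i : i != 0%N :> nat -> (1 < size (R i))%N.
Proof.
move=> i0; apply: leq_trans B_size _; apply: dvdp_leq; first exact: residual_neq0.
by rewrite /residual (negPf i0) dvdp_mull // dvdp_exp // subn_gt0.
Qed.

(** An algebraic constant is integral at every place, hence lies in L(0). There only i = 0
    contributes, with a constant coefficient, because B divides every other residual. *)
Lemma full_constant_field_kummer : full_constant_field L.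
Proof.
move=> z f f0 fz; have zO (P : place L) : val_ring P z.
  apply: contrapT => zO; have zm : max_ideal P z^-1 by apply/max_idealP; right; rewrite invrK.
  have z0 : z != 0 by apply/eqP => z0; apply: zO; rewrite z0; apply: val_ring0.
  have sf : (0 < size f)%N by rewrite size_poly_gt0.
  have := fz; rewrite horner_coef size_map_poly -(prednK sf) big_ord_recr /= => s0.
  have : is_unit_at P (κ (lead_coef f)) by apply: unit_at_const; rewrite lead_coef_eq0.
  apply: max_ideal_unit.
  have -> : κ (lead_coef f) = - \sum_(i < (size f).-1) κ f`_i * z^-1 ^+ ((size f).-1 - i).
    apply/eqP; rewrite -addr_eq0; apply/eqP; apply: (mulIf (expf_neq0 (size f).-1 z0)).
    rewrite mul0r -[RHS]s0 mulrDl addrC coef_map; congr (_ + _).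
    rewrite mulr_suml; apply: eq_bigr => i _; rewrite coef_map -mulrA; congr (_ * _).
    by rewrite -exprn_div_le ?divfK ?expf_neq0 // ltnW.
  apply/max_idealN/max_ideal_sum => i _; apply: max_idealM; first exact: val_ring_const.
  by apply: max_ideal_exp; rewrite // subn_gt0.
have zV : rr_space (polar_coef 1 0) z.
  by apply/rr_polarE; split=> P _; rewrite ?expr0 ?mulr1; apply: zO.
have [g [zE gP]] := rr_expansion zV.
have g0 i : i != 0%N :> nat -> g i = 0.
  move=> i0; apply/eqP; apply: contraT => /gP; rewrite mul0n leqn0 addn_eq0 => /andP[_].
  by have := residual_size i0; case: (size (R i)) => [|[|k]].
have [i0 i0E] : exists i : 'I_N, i = 0%N :> nat by exists (Ordinal N0).
have [c cE] : exists c, g i0 = c%:P.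
  have [->|/gP] := eqVneq (g i0) 0; first by exists 0.
  rewrite mul0n leqn0 addn_eq0 muln_eq0 gtn_eqF ?N0 //= => /andP[/eqP s1 _].
  by exists (g i0)`_0; apply: size1_polyC; move: s1; case: (size (g i0)) => [|[|k]].
exists c; rewrite zE (bigD1 i0) //= big1 ?addr0 => [|i ii0].
  rewrite cE /radical radical_coefE i0E /= !mul0n !div0n !expr0 !(mulr1, divr1, invr1).
  by rewrite const_inE.
by rewrite g0 ?rmorph0 ?mul0r // -i0E.
Qed.

(** The ceiling of deg(residual i) / N: the number of poles at infinity used up by [radical i]
    itself. *)
Definition pole_slack i : nat := ((size (R i)).-1 + N.-1) %/ N.

Lemma pole_slackP n i t :
  (N * t + (size (R i)).-1 <= n * N)%N = (t + pole_slack i <= n)%N.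
Proof.
have N0' := N0; rewrite -[RHS]ltnS /pole_slack -(divnMDl t _ N0) ltn_divLR // mulSn.
move: (N) N0' (size _).-1 => k k0 d; rewrite [(k * t)%N]mulnC.
by apply/idP/idP; lia.
Qed.

(** A basis consists of the x^t times [radical i] with t + slack <= n; truncated subtraction makes
    the block of i empty when its slack exceeds n. *)
Lemma qdim_polar n : qdim (rr_space (polar_coef 1 n)) [set 0 : L]
  (\sum_(i < N) (n.+1 - pole_slack i))%N.
Proof.
have dimN := dim_kummer A0 B_size sqfree yE L_gen.
have yp := y_pow B_size yE.
pose J i := 'I_(n.+1 - pole_slack i).
pose bb (k : {i : 'I_N & J i}) := x ^+ tagged k * b (tag k).
have lcE (c : {i : 'I_N & J i} -> F) :
    lcomb bb c = \sum_i ι (\poly_(t < n.+1 - pole_slack i)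
      (if (insub t : option 'I_(n.+1 - pole_slack i)) is Some t' then c (Tagged J t') else 0)) * b i.
  transitivity (\sum_i \sum_(t : J i) κ (c (Tagged J t)) * (x ^+ t * b i)).
    by rewrite sig_big_dep; apply: eq_bigr => -[i t] _.
  apply: eq_bigr => i _; rewrite (poly_in_coef_wide L (size_poly _ _)) mulr_suml.
  by apply: eq_bigr => t _; rewrite coef_poly ltn_ord valK mulrA.
have -> : (\sum_(i < N) (n.+1 - pole_slack i))%N = #|{: {i : 'I_N & J i}}|.
  rewrite card_tagged sumnE big_map big_enum /=.
  by apply: eq_bigr => i _; rewrite card_ord.
apply: (@qdim_fintype _ _ _ _ _ bb).
- move=> [i t]; rewrite /bb /=.
  have -> : x ^+ t = ι 'X^t by rewrite rmorphXn.
  apply/(rr_radical_poly A0 B_size yE); first by rewrite monic_neq0 // monicXn.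
  rewrite size_polyXn pole_slackP; have := ltn_ord t; rewrite /J ltn_subRL ltnS.
  by rewrite addnC.
- move=> z /rr_expansion[g [zE gP]].
  exists (fun k : {i : 'I_N & J i} => (g (tag k))`_(tagged k : 'I_(n.+1 - pole_slack (tag k)))); rewrite lcE zE.
  apply/eqP; rewrite subr_eq0; apply/eqP; apply: eq_bigr => i _; congr (ι _ * _).
  apply/polyP => t; rewrite coef_poly; case: ltnP => [lt|ge]; first by rewrite insubT.
  have [->|g0] := eqVneq (g i) 0; first by rewrite coef0.
  rewrite nth_default //; apply: leq_trans ge; have := gP i g0; rewrite pole_slackP.
  move: g0; rewrite -size_poly_gt0; case: (size (g i)) => //= d _ le_dn.
  by rewrite ltn_subRL ltnS addnC.
move=> c; rewrite lcE => s0 [i t].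
pose p i := \poly_(t < n.+1 - pole_slack i) (if (insub t : option 'I_(n.+1 - pole_slack i)) is Some t' then c (Tagged J t') else 0).
have : forall i, tofrac (p i) * C i = 0.
  apply: (kummer_free L_gen dimN); rewrite -[RHS]s0; apply: eq_bigr => j _.
  by rewrite base_mul base_poly /radical mulrA.
move=> /(_ i)/eqP; rewrite mulf_eq0 (negPf (radical_coef_neq0 L u v A0 B_size i)) orbF tofrac_eq0 => /eqP pi0.
have := coef0 F t; rewrite -pi0 coef_poly ltn_ord.
by rewrite (valK t).
Qed.

Theorem genus_kummer :
  has_genus L ((\sum_(i < N) pole_slack i)%N%:Z + 1 - N%:Z).
Proof.
have dimN := dim_kummer A0 B_size sqfree yE L_gen.
(* From the sum of the slacks on, every slack is at most n and no subtraction is truncated, so the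
   dimension is N (n + 1) minus that sum. *)
apply: (has_genus_of_pole_spaces (n0 := \sum_(i < N) pole_slack i)).
  exact: full_constant_field_kummer.
move=> n le_n; exists (\sum_(i < N) (n.+1 - pole_slack i))%N; first exact: qdim_polar.
have : (\sum_(i < N) (n.+1 - pole_slack i) + \sum_(i < N) pole_slack i = N * n.+1)%N.
  rewrite -big_split /= (eq_bigr (fun=> n.+1)) ?sum_nat_const ?card_ord // => i _.
  rewrite subnK //; apply: leq_trans (leqnSn n); apply: leq_trans le_n.
  by rewrite (bigD1 i) //= leq_addr.
rewrite dimN mulnS mulnC; set s := (\sum_(i < N) (_ - _))%N; set t := (\sum_(i < N) _)%N.
by clearbody s t; lia.
Qed.

End KummerGenus.

(** * Arithmetic of the genus *)

Lemma sum_ord_rev n (f : nat -> nat) : f n = f 0%N ->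
  (\sum_(i < n) f (n - i) = \sum_(i < n) f i)%N.
Proof.
case: n => [|n] fn; first by rewrite !big_ord0.
rewrite big_ord_recl subn0 fn [RHS]big_ord_recl; congr (_ + _)%N.
rewrite (reindex_inj rev_ord_inj) /=; apply: eq_bigr => i _; congr f.
by rewrite /bump /= !add1n subSS subKn.
Qed.

Lemma sum_dvd n m : (0 < n)%N -> (m %| n)%N -> (\sum_(i < n) (m %| i) = n %/ m)%N.
Proof.
move=> n0 mn; rewrite divn_count_dvd -(@sum_ord_rev n (fun i => m %| i : nat)) ?mn ?dvdn0 //.
rewrite big_add1 /= big_mkord [RHS](reindex_inj rev_ord_inj) /=.
by apply: eq_bigr => i _; rewrite subnSK.
Qed.

(* Pair the terms of index i and n - i: they add up to n unless n divides i w. *)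
Lemma sum_modn n w : (0 < n)%N ->
  (2 * \sum_(i < n) (i * w %% n) = n * (n - gcdn w n))%N.
Proof.
move=> n0; set d := gcdn w n.
have d0 : (0 < d)%N by rewrite gcdn_gt0 n0 orbT.
have dvdE i : (n %| i * w)%N = (n %/ d %| i)%N.
  have nE : n = (n %/ d * d)%N by rewrite divnK // dvdn_gcdr.
  have wE : w = (w %/ d * d)%N by rewrite divnK // dvdn_gcdl.
  rewrite {1}nE {1}wE mulnA dvdn_pmul2r // Gauss_dvdl //.
  rewrite coprime_sym /coprime -(eqn_pmul2r d0) mul1n muln_gcdl -nE -wE.
  by rewrite eqxx.
have pair (i : 'I_n) : (i * w %% n + (n - i) * w %% n + n * (n %/ d %| i) = n)%N.
  rewrite -dvdE; have e : (i * w + (n - i) * w = w * n)%N by rewrite -mulnDl subnKC 1?mulnC // ltnW.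
  have dv : (n %| i * w + (n - i) * w)%N by rewrite e dvdn_mull.
  case: (boolP (n %| i * w)%N) => h.
    have h' : (n %| (n - i) * w)%N by rewrite -(dvdn_addr _ h).
    by rewrite (eqP h) (eqP h') !add0n muln1.
  have m1 : (0 < i * w %% n)%N by rewrite lt0n.
  have l1 : (i * w %% n < n)%N by rewrite ltn_mod.
  have l2 : ((n - i) * w %% n < n)%N by rewrite ltn_mod.
  have : (n %| i * w %% n + (n - i) * w %% n)%N by rewrite /dvdn modnDm.
  move/dvdnP => [k kE]; rewrite kE muln0 addn0.
  have k1 : k = 1%N by move: kE m1 l1 l2; move: (_ %% _)%N (_ %% _)%N => c c'; nia.
  by rewrite k1 mul1n.
have := congr1 (fun f => \sum_(i < n) f i)%N (boolp.funext pair).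
rewrite !big_split /= -big_distrr /= sum_dvd //; last first.
  by apply/dvdnP; exists d; rewrite mulnC divnK // dvdn_gcdr.
rewrite sum_nat_const card_ord (@sum_ord_rev n (fun i => i * w %% n)%N); last by rewrite mul0n mod0n modnMr.
have -> : (n %/ (n %/ d) = d)%N.
  by rewrite -{1}(divnK (dvdn_gcdr w n)) mulKn // divn_gt0 // dvdn_leq // dvdn_gcdr.
move=> /= h; rewrite mulnBr -h addnK mul2n -addnn.
by [].
Qed.

(** Here r and s are the predecessors of the two powers of p, so the last hypothesis reads r s + r +
    s = n. *)
Lemma slack_identity (i n r s al be ra rb g : nat) : (i * s = al * n + ra)%N ->
  (i * s.+1 = be * n + rb)%N -> (g + i = n)%N -> (r.+1 * s.+1 = n.+1)%N ->
  (ra + r * rb + s * g + ra + n * (2 * al + r * be) = n * (i + s))%N.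
Proof.
move=> e1 e2 gE rs; transitivity (2 * (i * s) + r * (i * s.+1) + s * g)%N.
  by rewrite e1 e2; lia.
have h : (r * s + r + s = n)%N by lia.
have h1 := congr1 (muln i) h; have h2 := congr1 (muln s) gE; clear e1 e2 gE rs h.
by lia.
Qed.

Section GenusFormula.

Variables (F : finFieldType) (A B : {poly F}) (r s d : nat).
Local Notation N := (#|F|.-1).
Hypotheses (A_size : size A = r) (B_size : size B = s) (r_gt0 : (0 < r)%N) (s_gt0 : (0 < s)%N).
Hypotheses (card_rs : (r * s)%N = #|F|) (gcd_s : gcdn s N = 1%N) (gcd_s1 : gcdn s.-1 N = d).

Lemma size_residual (i : 'I_N) : (size (residual A B s.-1 s i)).-1 =
  (i * s.-1 %% N + r.-1 * (i * s %% N) + s.-1 * (if i == 0%N :> nat then 0 else N - i))%N.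
Proof.
have A0 : A != 0 by rewrite -size_poly_gt0 A_size.
have B0 : B != 0 by rewrite -size_poly_gt0 B_size.
rewrite /residual size_mul ?mulf_neq0 ?expf_neq0 ?polyX_eq0 //.
rewrite size_mul ?expf_neq0 ?polyX_eq0 // size_polyXn.
have e (p : {poly F}) k : p != 0 -> size (p ^+ k) = ((size p).-1 * k).+1.
  by move=> p0; rewrite -size_exp prednK // size_poly_gt0 expf_neq0.
by rewrite !e // A_size B_size !addSn !addnS.
Qed.

(* deg (residual i) + (i (s - 1) mod N) is divisible by N, because r s = N + 1. *)
Lemma pole_slack_mul (i : 'I_N) : (pole_slack A B s.-1 s i * N =
  2 * (i * s.-1 %% N) + r.-1 * (i * s %% N) + s.-1 * (if i == 0%N :> nat then 0 else N - i))%N.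
Proof.
have N0 := card_predn_gt0 F; have qE : #|F| = N.+1 by rewrite prednK // (ltn_trans _ (finRing_gt1 F)).
rewrite /pole_slack size_residual.
set D := (_ + r.-1 * _ + _)%N; set ra := (i * s.-1 %% N)%N.
have raN : (ra < N)%N by rewrite ltn_mod.
have : (N %| D + ra)%N.
  have [i0|i0] := eqVneq (i : nat) 0%N.
    by rewrite /D /ra i0 !mul0n !mod0n !muln0.
  have e1 := divn_eq (i * s.-1) N; have e2 := divn_eq (i * s) N.
  have gE : (N - i + i = N)%N by rewrite subnK // ltnW.
  have key : (D + ra + N * (2 * (i * s.-1 %/ N) + r.-1 * (i * s %/ N)) = N * (i + s.-1))%N.
    rewrite /D (negPf i0) -/ra; rewrite -/ra in e1.
    have rsE : (r * s = N.+1)%N by rewrite card_rs.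
    move: rsE e2; rewrite -{1}(prednK r_gt0) -{1 2}(prednK s_gt0) => rsE e2.
    exact: slack_identity e1 e2 gE rsE.
  have : (N %| N * (i + s.-1))%N by rewrite dvdn_mulr.
  by rewrite -key dvdn_addl // dvdn_mulr.
(* Since 0 <= ra < N, the multiple D + ra = k N is the first one not below D. *)
move=> /dvdnP[k kE]; have -> : ((D + N.-1) %/ N = k)%N.
  apply/eqP; rewrite eqn_leq -ltnS ltn_divLR // leq_divRL // mulSn -kE.
  by apply/andP; split; lia.
by rewrite -kE /D -/ra; lia.
Qed.

(** By [sum_modn] the doubled sums of residues are N (N - d), N (N - 1) and N (N - 1), for the
    multipliers s - 1, s and -1; the last is reduced to multiplier 1 by reversing the index. *)
Lemma sum_pole_slack :
  (2 * \sum_(i < N) pole_slack A B s.-1 s i + 2 * d = 2 * N + (r + s - 2) * N.-1)%N.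
Proof.
have N0 := card_predn_gt0 F.
have dN : (d <= N)%N by rewrite -gcd_s1 dvdn_leq // dvdn_gcdr.
have h1 := sum_modn s.-1 N0; have h2 := sum_modn s N0; rewrite gcd_s1 in h1; rewrite gcd_s in h2.
have h3 : (2 * \sum_(i < N) (if i == 0%N :> nat then 0 else N - i) = N * N.-1)%N.
  have := sum_modn 1 N0; rewrite gcd1n subn1 => <-; congr (2 * _)%N.
  rewrite -[RHS](@sum_ord_rev N (fun i => i * 1 %% N)%N); last by rewrite muln1 modnn mul0n mod0n.
  apply: eq_bigr => i _; rewrite muln1; have [->|i0] := eqVneq (i : nat) 0%N.
    by rewrite subn0 modnn.
  by rewrite modn_small // ltn_subrL lt0n i0 N0.
have : ((\sum_(i < N) pole_slack A B s.-1 s i) * N =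
    2 * \sum_(i < N) (i * s.-1 %% N) + r.-1 * \sum_(i < N) (i * s %% N) +
    s.-1 * \sum_(i < N) (if i == 0%N :> nat then 0 else N - i))%N.
  rewrite !big_distrr big_distrl -!big_split /=.
  by apply: eq_bigr => i _; apply: pole_slack_mul.
move: h1 h2 h3; set S1 := (\sum_(i < N) (_ %% _))%N; set S2 := (\sum_(i < N) (_ %% _))%N.
set S3 := (\sum_(i < N) (if _ then _ else _))%N; set S := (\sum_(i < N) _)%N.
clearbody S S1 S2 S3 => h1 h2 h3 h; apply/eqP; rewrite -(eqn_pmul2r N0); apply/eqP.
have -> : (r + s - 2 = r.-1 + s.-1)%N by case: r r_gt0 => // r'; case: s s_gt0 => // s'; lia.
have h2' := congr1 (muln r.-1) h2; have h3' := congr1 (muln s.-1) h3.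
move: dN N0 h1 h2' h3' h; rewrite subn1; case: (N) => // n dN _ h1 h2' h3' h /=.
have : (n.+1 * (n.+1 - d) + n.+1 * d = n.+1 * n.+1)%N by rewrite -mulnDr subnK.
by move: (n.+1 * (n.+1 - d))%N h1 => z h1; rewrite /= in h2' h3' *; lia.
Qed.

End GenusFormula.

(** * Rational points *)

Section PlacesOver.

Variables (F : finFieldType) (L : fieldExtType {fraction {poly F}}).
Local Notation ι := (@poly_in F L).
Local Notation κ := (const_in L).
Local Notation x := (xvar L).
Implicit Types (P : place L) (θ w : L).

Lemma degree_one_residue P z : place_degree P = 1%N -> val_ring P z ->
  exists c, max_ideal P (z - κ c).
Proof.
move=> P1 zO; have := qdim_residue_field P; rewrite P1 => -[b [bO bgen _]].
have [c] := bgen z zO; have [d] := bgen 1 (val_ring1 P).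
rewrite /lcomb !big_ord1; set b0 := b ord0; set c0 := c ord0; set d0 := d ord0 => dm cm.
have d00 : d0 != 0.
  by apply/eqP => d00; move: dm; rewrite d00 rmorph0 mul0r subr0; apply: not_max_ideal1.
exists (c0 / d0).
have -> : z - κ (c0 / d0) = (z - κ c0 * b0) - κ (c0 / d0) * (1 - κ d0 * b0).
  have e : κ c0 = κ (c0 / d0) * κ d0 by rewrite -rmorphM divfK.
  by rewrite e; ring.
by apply: max_idealB => //; apply: max_idealM => //; apply: val_ring_const.
Qed.

Lemma max_ideal_const P c : max_ideal P (κ c) -> c = 0.
Proof.
move=> cm; apply/eqP; apply: contraT => c0.
by case: (max_ideal_unit cm); apply: unit_at_const.
Qed.

Lemma max_ideal_prod P (I : eqType) (r : seq I) (f : I -> L) :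
  (forall i, i \in r -> val_ring P (f i)) -> max_ideal P (\prod_(i <- r) f i) ->
  exists2 i, i \in r & max_ideal P (f i).
Proof.
elim: r => [|i r IH] fO; first by rewrite big_nil => /not_max_ideal1.
have fO' j : j \in r -> val_ring P (f j) by move=> jr; apply: fO; rewrite inE jr orbT.
have fiO : val_ring P (f i) by apply: fO; rewrite mem_head.
have rO : val_ring P (\prod_(j <- r) f j).
  rewrite big_seq; elim/big_ind: _ => //; first exact: val_ring1.
  by move=> u v; apply: val_ringM.
rewrite big_cons => /(max_ideal_prime fiO rO)[im|/(IH fO')[j jr jm]].
  by exists i; rewrite ?mem_head.
by exists j; rewrite // inE jr orbT.
Qed.

(* The residue of w at a place over θ is a d-th root of unity, each one occurs,
   and the fundamental inequality leaves no room for anything else. *)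
Lemma places_over θ w (ω : F) (d e : nat) : θ != 0 -> growth θ 1 ->
  d.-primitive_root ω -> (d * e)%N = \dim {:L} -> (0 < e)%N ->
  (exists P, max_ideal P θ) ->
  (forall P, max_ideal P θ -> val_ring P w /\ max_ideal P (w ^+ d - 1)) ->
  (forall P, max_ideal P θ -> (e <= `|order_at P θ|)%N) ->
  (forall P i, max_ideal P θ -> exists P', max_ideal P' θ /\
     forall c, max_ideal P (κ (ω ^+ i) * w - κ c) -> max_ideal P' (w - κ c)) ->
  exists s, [/\ uniq s, size s = d, forall P, P \in s <-> max_ideal P θ &
     forall P, P \in s -> place_degree P = 1%N].
Proof.
move=> θ0 θg ωP deN e0 [P0 P0θ] wP eP conj.
have d0 : (0 < d)%N := prim_order_gt0 ωP.
have res P : max_ideal P θ -> exists2 i, (i < d)%N & max_ideal P (w - κ (ω ^+ i)).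
  move=> /wP[wO wm].
  have := factor_Xn_sub_1 (_ : d.-primitive_root (κ ω)); rewrite fmorph_primitive_root.
  move=> /(_ ωP)/(congr1 (fun p => p.[w])); rewrite hornerD hornerN hornerXn hornerC horner_prod => e1.
  have [||i] := @max_ideal_prod P _ (index_iota 0 d) (fun i => w - κ (ω ^+ i)).
  - by move=> i _; apply: val_ringB => //; apply: val_ring_const.
  - rewrite (eq_bigr (fun i => ('X - (κ ω ^+ i)%:P).[w])) ?e1 // => i _.
    by rewrite !hornerE rmorphXn.
  by rewrite mem_index_iota => /andP[_ id im]; exists i.
have res_inj P i j : (i < d)%N -> (j < d)%N -> max_ideal P (w - κ (ω ^+ i)) ->
    max_ideal P (w - κ (ω ^+ j)) -> i = j.
  move=> id jd im jm; have := max_idealB jm im; rewrite opprB addrC addrA subrK -rmorphB.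
  move=> /max_ideal_const/eqP; rewrite subr_eq0 (eq_prim_root_expr ωP).
  by rewrite !modn_small // => /eqP.
have [i0 i0d i0m] := res P0 P0θ.
have /choice[f fP] : forall j : 'I_d, exists P, max_ideal P θ /\ max_ideal P (w - κ (ω ^+ j)).
  (* Conjugation shifts the residue ω^i0 to ω^j; the exponent d - i0 stands for - i0. *)
  move=> j; have [P' [P'θ P'P]] := conj P0 (j + (d - i0))%N P0θ.
  exists P'; split=> //; apply: P'P.
  have -> : κ (ω ^+ j) = κ (ω ^+ (j + (d - i0))) * κ (ω ^+ i0).
    by rewrite -rmorphM -exprD -addnA subnK ?(ltnW i0d) // exprD (prim_expr_order ωP) mulr1.
  by rewrite -mulrBr; apply: max_idealM => //; apply: val_ring_const.
pose s := [seq f j | j <- enum 'I_d].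
have us : uniq s.
  rewrite map_inj_uniq ?enum_uniq // => j j' fj; apply: val_inj.
  by apply: (res_inj (f j)); rewrite ?ltn_ord //; [case: (fP j)|rewrite fj; case: (fP j')].
have ss : size s = d by rewrite size_map size_enum_ord.
have sθ P : P \in s -> max_ideal P θ by move=> /mapP[j _ ->]; case: (fP j).
(* Every place over θ takes at least e times its degree out of the total N = d e. *)
have bound s' : uniq s' -> (forall P, P \in s' -> max_ideal P θ) ->
    (\sum_(P <- s') place_degree P <= d)%N.
  move=> us' s'θ; rewrite -(leq_pmul2r e0) deN -[\dim _]muln1.
  apply: leq_trans (fundamental_inequality us' θ0 (fun P Ps => max_ideal_sub (s'θ P Ps)) θg).
  rewrite big_distrl !big_seq; apply: leq_sum => P Ps /=.
  by rewrite mulnC leq_mul2r eP ?orbT //; apply: s'θ.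
have deg_ge (s' : seq (place L)) : (size s' <= \sum_(P <- s') place_degree P)%N.
  by rewrite -sum1_size; apply: leq_sum => P _; apply: place_degree_gt0.
exists s; split=> //.
  move=> P; split=> [/sθ//|Pθ]; apply: contraT => Ps.
  have us' : uniq (P :: s) by rewrite /= Ps us.
  have sθ' Q : Q \in P :: s -> max_ideal Q θ by rewrite inE => /orP[/eqP->|/sθ].
  by have := leq_trans (deg_ge (P :: s)) (bound _ us' sθ'); rewrite /= ss ltnn.
move=> P Ps; apply/eqP; rewrite eqn_leq place_degree_gt0 andbT.
have := bound s us sθ; rewrite (perm_big _ (perm_to_rem Ps)) big_cons /= => h.
have := deg_ge (rem P s); rewrite size_rem // ss => h'.
by move: (\sum_(Q <- rem P s) _)%N h h' => k; case: d d0 {bound ss deN ωP wP conj res res_inj i0d f fP s us sθ Ps} => // d' _; lia.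
Qed.

End PlacesOver.

(** * Places of a Kummer extension over one base place *)

Section KummerPlaces.

Variables (F : finFieldType) (L : fieldExtType {fraction {poly F}}).
Local Notation ι := (@poly_in F L).
Local Notation κ := (const_in L).
Local Notation x := (xvar L).
Local Notation KX := {fraction {poly F}}.
Local Notation N := (#|F|.-1).
Variables (y : L) (f : KX).
Hypotheses (y_pow : y ^+ N = f%:A) (L_gen : <<1; y>>%VS = fullv).
Hypotheses (dimN : \dim {:L} = N) (y0 : y != 0).
Implicit Types (P : place L).

Lemma conjugate_max_ideal (σ : L -> L) P P' : base_automorphism σ ->
  val_ring P' = [set z | val_ring P (σ z)] ->
  forall z, max_ideal P' z <-> max_ideal P (σ z).
Proof.
move=> σP P'E z; rewrite !max_idealP P'E /= autV //.
have [->|z0] := eqVneq z 0; first by rewrite aut0 //; split; left.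
have s0 : σ z != 0.
  apply/eqP => s0; have : σ (z * z^-1) = 1 by rewrite mulfV // aut1.
  by rewrite autM // s0 mul0r => /esym/eqP; rewrite oner_eq0.
split=> -[e|]; try by right.
  by rewrite e eqxx in z0.
by rewrite e eqxx in s0.
Qed.

Section OverOneBasePlace.

(** θ cuts out the base place; y^N is μ^d times a unit of residue α, and t is the order of μ
    relative to that of θ. With e prime to t, e is a lower bound for the ramification. *)
Variables (θ μ : L) (α : F) (d e t : nat).
Hypotheses (θ0 : θ != 0) (θ_growth : growth θ 1) (μ0 : μ != 0) (α0 : α != 0).
Hypotheses (deN : (d * e)%N = N) (co_et : coprime e t).
Hypotheses (θ_base : forall σ, base_automorphism σ -> σ θ = θ)
  (μ_base : forall σ, base_automorphism σ -> σ μ = μ).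
Hypothesis μ_order : forall P, max_ideal P θ ->
  `|order_at P μ|%N = (t * `|order_at P θ|)%N.
Hypothesis y_mod : forall P, max_ideal P θ -> max_ideal P (y ^+ N / μ ^+ d - κ α).

Lemma d_gt0 : (0 < d)%N.
Proof. by have := card_predn_gt0 F; rewrite -deN muln_gt0 => /andP[]. Qed.

Lemma e_gt0 : (0 < e)%N.
Proof. by have := card_predn_gt0 F; rewrite -deN muln_gt0 => /andP[]. Qed.

(** Orders in y^N = unit times μ^d give e |v(y)| = t |v(θ)|, and e is prime to t, so e divides
    v(θ). *)
Lemma ramification_ge P : max_ideal P θ -> (e <= `|order_at P θ|)%N.
Proof.
move=> Pθ; have oθ : 0 < order_at P θ by apply/order_at_gt0.
have zu : is_unit_at P (y ^+ N / μ ^+ d).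
  rewrite -[X in is_unit_at P X](subrK (κ α)) addrC; apply: unit_atD (y_mod Pθ).
  exact: unit_at_const.
have := order_at_unit zu; rewrite order_atM ?invr_neq0 ?expf_neq0 //.
rewrite order_atV ?expf_neq0 // !order_atX // => /eqP; rewrite subr_eq0 => /eqP.
move=> /(congr1 absz); rewrite !abszM !absz_nat μ_order // -deN -mulnA.
move/eqP; rewrite eqn_pmul2l ?d_gt0 // => /eqP h.
apply: dvdn_leq; first by rewrite absz_gt0 gt_eqF.
by rewrite -(Gauss_dvdr _ co_et) -h dvdn_mulr.
Qed.

(** w = y^e / μ satisfies w^d = α modulo the place, and at degree one the residue of w lies in F. *)
Lemma degree_one_power P : max_ideal P θ -> place_degree P = 1%N -> is_power_unit d α.
Proof.
move=> Pθ P1; pose w := y ^+ e / μ.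
have wd : w ^+ d = y ^+ N / μ ^+ d by rewrite expr_div_n -exprM mulnC deN.
have wO : val_ring P w.
  apply: (val_ring_root d_gt0); rewrite wd -[X in val_ring P X](subrK (κ α)).
  by apply: val_ringD; [apply/max_ideal_sub/y_mod|apply: val_ring_const].
have [c cm] := degree_one_residue P1 wO.
have : max_ideal P (κ (α - c ^+ d)).
  have -> : κ (α - c ^+ d) = (w ^+ d - κ c ^+ d) - (w ^+ d - κ α).
    by rewrite rmorphB rmorphXn /=; ring.
  apply: max_idealB; last by rewrite wd; apply: y_mod.
  rewrite subrXX; apply: max_idealMr => //; apply: val_ring_sum => i _.
  by apply: val_ringM; apply: val_ringX => //; apply: val_ring_const.
move/max_ideal_const/eqP; rewrite subr_eq0 => /eqP αE; exists c => //.
by apply: contraNneq α0 => c0; rewrite αE c0 expr0n gtn_eqF // d_gt0.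
Qed.

(** Dividing y^e / μ by a d-th root of α makes its residue a d-th root of unity. For g of order N,
    the automorphism y -> g^i y multiplies it by the i-th power of g^e, which has order d. *)
Lemma kummer_places : (exists P, max_ideal P θ) -> is_power_unit d α ->
  exists s, [/\ uniq s, size s = d, forall P, P \in s <-> max_ideal P θ &
     forall P, P \in s -> place_degree P = 1%N].
Proof.
move=> exP [γ γ0 αE]; have [g gP] := exists_primitive_root F.
have ωP : d.-primitive_root (g ^+ e).
  by have := dvdn_prim_root gP (_ : d %| N)%N; rewrite -deN mulKn ?d_gt0 //; apply; rewrite dvdn_mulr.
have κγ0 : κ γ != 0 by rewrite fmorph_eq0.
pose w := y ^+ e / (μ * κ γ).
have wd : w ^+ d - 1 = (y ^+ N / μ ^+ d - κ α) * κ α^-1.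
  rewrite expr_div_n -exprM [(e * d)%N]mulnC deN exprMn -rmorphXn -αE mulrBl fmorphV.
  by rewrite mulfV ?fmorph_eq0 // invfM mulrA.
have wm P : max_ideal P θ -> max_ideal P (w ^+ d - 1).
  by move=> Pθ; rewrite wd; apply: max_idealMr; [apply: y_mod|apply: val_ring_const].
apply: (places_over (w := w) (ω := g ^+ e) (e := e)) => //.
- by rewrite dimN.
- exact: e_gt0.
- move=> P Pθ; split; last exact: wm.
  apply: (val_ring_root d_gt0); rewrite -[w ^+ d](subrK 1).
  by apply: val_ringD; [apply/max_ideal_sub/wm|apply: val_ring1].
- exact: ramification_ge.
move=> P i Pθ; have gi0 : g ^+ i != 0 by rewrite expf_neq0 // (prim_root_eq0 gP) -lt0n card_predn_gt0.
have [σ [h1 h2 h3 σy]] := exists_automorphism y_pow L_gen dimN (expf_card_pred gi0).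
have σP : base_automorphism σ by split.
have [P' P'E] := exists_conjugate_place σP P.
have P'm := conjugate_max_ideal σP P'E.
exists P'; split; first by apply/P'm; rewrite θ_base.
move=> c cm; apply/P'm; suff -> : σ (w - κ c) = κ ((g ^+ e) ^+ i) * w - κ c by [].
rewrite autB // aut_const // /w autM // autX // autV // autM // μ_base // aut_const // σy.
by rewrite exprMn -rmorphXn -!exprM [(i * e)%N]mulnC mulrA.
Qed.

End OverOneBasePlace.
End KummerPlaces.

(** * Places over the rational points of the line *)

Section KummerRationalPoints.

Variables (F : finFieldType) (L : fieldExtType {fraction {poly F}}).
Local Notation ι := (@poly_in F L).
Local Notation κ := (const_in L).
Local Notation x := (xvar L).
Local Notation N := (#|F|.-1).
Implicit Types (P : place L) (c : F).

Lemma ratio_residue P (z w : L) (a b : F) : b != 0 ->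
  max_ideal P (z - κ a) -> max_ideal P (w - κ b) -> max_ideal P (z / w - κ (a / b)).
Proof.
move=> b0 za wb; have κb0 : κ b != 0 by rewrite fmorph_eq0.
have wu : is_unit_at P w.
  by rewrite -[w](subrK (κ b)) addrC; apply: unit_atD => //; apply: unit_at_const.
have w0 := unit_at_neq0 wu.
have -> : z / w - κ (a / b) = ((z - κ a) * κ b - κ a * (w - κ b)) * (w^-1 * (κ b)^-1).
  by rewrite rmorphM fmorphV /=; field; rewrite w0 κb0.
apply: max_idealMr.
  by apply: max_idealB; [apply: max_idealMr|apply: max_idealM] => //; apply: val_ring_const.
apply: val_ringM; apply/unit_at_val/unit_atV => //; exact: unit_at_const.
Qed.

Lemma XsubC_in c : ι ('X - c%:P) = x - κ c.
Proof. by rewrite rmorphB. Qed.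

Lemma finite_of_XsubC P c : max_ideal P (ι ('X - c%:P)) -> finite_place P.
Proof.
rewrite XsubC_in => xm; apply/asboolP; rewrite -[x](subrK (κ c)).
by apply: val_ringD; [apply: max_ideal_sub|apply: val_ring_const].
Qed.

Lemma poly_residue P c g : max_ideal P (ι ('X - c%:P)) -> max_ideal P (ι g - κ g.[c]).
Proof.
move=> xm; have xO := elimT (asboolP _) (finite_of_XsubC xm).
have /factor_theorem[q qE] : root (g - g.[c]%:P) c by rewrite rootE !hornerE subrr.
rewrite const_inE -rmorphB qE rmorphM; apply: max_idealM => //.
exact: val_ring_poly.
Qed.

Lemma card_uniq_seq (T : choiceType) (S : set T) (s : seq T) : uniq s ->
  (forall z, S z <-> z \in s) -> S #= `I_(size s).
Proof.
move=> us sS.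
apply/pcard_eqP; suff /Pbij[f] : set_bij S `I_(size s) (index^~ s) by squash f.
split=> [z /sS zs|z z' /set_mem/sS zs /set_mem/sS zs' eq_i|i /= i_lt].
- by rewrite /= index_mem.
- by rewrite -(nth_index z zs) eq_i nth_index.
case: s us sS i_lt => // z0 s us sS i_lt.
by exists (nth z0 (z0 :: s) i); [apply/sS/mem_nth|rewrite index_uniq].
Qed.

Lemma uniq_flatten_disjoint (I T : eqType) (r : seq I) (f : I -> seq T) : uniq r ->
  (forall i, i \in r -> uniq (f i)) ->
  (forall i j z, i \in r -> j \in r -> z \in f i -> z \in f j -> i = j) ->
  uniq (flatten [seq f i | i <- r]).
Proof.
elim: r => //= i r IH /andP[ir ur] uf dis; rewrite cat_uniq uf ?mem_head //=.
rewrite IH // => [|j jr|j k z jr kr]; last first.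
- by apply: dis; rewrite inE ?jr ?kr orbT.
- by apply: uf; rewrite inE jr orbT.
rewrite andbT; apply/hasPn => z /flattenP[_ /mapP[j jr ->] zj].
apply/negP => zi; move/negP: ir; apply.
by rewrite (dis i j z) ?mem_head // inE jr orbT.
Qed.

Variables (y : L) (A B : {poly F}) (u v d : nat).
Hypotheses (A0 : A != 0) (B_size : (1 < size B)%N).
Hypothesis sqfree : forall π : {poly F}, (1 < size π)%N -> ~~ (π ^+ 2 %| 'X * A * B).
Hypothesis yE : y ^+ N * ι B = - ι ('X^u * A ^+ v).
Hypothesis L_gen : <<1; y>>%VS = fullv.

Let dimN := dim_kummer A0 B_size sqfree yE L_gen.
Let yp := y_pow B_size yE.
Let yn0 := y_neq0 A0 yE.
Let B0 := B_neq0 B_size.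

Lemma y_pow_ratio : y ^+ N = ι (- ('X^u * A ^+ v)) / ι B.
Proof. by rewrite rmorphN -yE mulfK // poly_in_eq0. Qed.

Lemma XsubC_neq0 c : ι ('X - c%:P) != 0.
Proof. by rewrite poly_in_eq0 polyXsubC_eq0. Qed.

Lemma XsubC_growth c : growth (ι ('X - c%:P)) 1.
Proof. by have := growth_poly L ('X - c%:P); rewrite size_XsubC. Qed.

Lemma exists_place_XsubC c : exists P : place L, max_ideal P (ι ('X - c%:P)).
Proof.
by have [|P [_ Pm]] := @exists_finite_place_above F L ('X - c%:P); rewrite ?size_XsubC //; exists P.
Qed.

Lemma places_at_split c : - (c ^+ u * A.[c] ^+ v) = B.[c] -> B.[c] != 0 ->
  exists s, [/\ uniq s, size s = N, forall P, P \in s <-> max_ideal P (ι ('X - c%:P)) &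
     forall P, P \in s -> place_degree P = 1%N].
Proof.
move=> fc Bc.
(* Here μ = α = 1, d = N, e = 1 and t = 0: y^N itself has residue 1, so nothing has to be divided
   out. *)
apply: (@kummer_places _ _ y _ yp L_gen dimN yn0 _ 1 1 N 1 0) => //.
- exact: XsubC_neq0.
- exact: XsubC_growth.
- exact: oner_neq0.
- exact: oner_neq0.
- by rewrite muln1.
- by move=> σ σP; rewrite aut_poly.
- by move=> σ σP; rewrite aut1.
- by move=> P _; rewrite order_at1.
- move=> P Pm; rewrite expr1n divr1 y_pow_ratio.
  have := ratio_residue Bc (poly_residue (- ('X^u * A ^+ v)) Pm) (poly_residue B Pm).
  by rewrite hornerN hornerM hornerXn horner_exp fc mulfV.
- exact: exists_place_XsubC.
by exists 1; rewrite ?oner_neq0 ?expr1n.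
Qed.

Lemma coprime_divn_gcd n k : (0 < k)%N -> coprime (k %/ gcdn n k) (n %/ gcdn n k).
Proof.
move=> k0; have g0 : (0 < gcdn n k)%N by rewrite gcdn_gt0 k0 orbT.
rewrite /coprime -(eqn_pmul2r g0) mul1n muln_gcdl !divnK ?dvdn_gcdl ?dvdn_gcdr //.
by rewrite gcdnC.
Qed.

Hypothesis gcd_u : gcdn u N = d.

Let dN : (d %| N)%N. Proof. by rewrite -gcd_u dvdn_gcdr. Qed.

(** μ = x^(u / d) removes the zero of the radicand and leaves - A(0)^v / B(0); as d = gcd(u, N), the
    exponent u / d is prime to N / d. *)
Lemma places_at_zero (α := - A.[0] ^+ v / B.[0]) : A.[0] != 0 -> B.[0] != 0 ->
  (forall P, max_ideal P (ι ('X - 0%:P)) -> place_degree P = 1%N -> is_power_unit d α) /\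
  (is_power_unit d α ->
   exists s, [/\ uniq s, size s = d, forall P, P \in s <-> max_ideal P (ι ('X - 0%:P)) &
     forall P, P \in s -> place_degree P = 1%N]).
Proof.
move=> A00 B00; have x0 := xvar_neq0 L.
have deN : (d * (N %/ d) = N)%N by rewrite mulnC divnK.
have du : (u %/ d * d = u)%N by rewrite divnK // -gcd_u dvdn_gcdl.
have co : coprime (N %/ d) (u %/ d) by rewrite -gcd_u coprime_divn_gcd // card_predn_gt0.
have α0 : α != 0 by rewrite mulf_neq0 ?invr_neq0 // oppr_eq0 expf_neq0.
have μ0 : x ^+ (u %/ d) != 0 by rewrite expf_neq0.
have μb σ : base_automorphism σ -> σ (x ^+ (u %/ d)) = x ^+ (u %/ d).
  by move=> σP; rewrite autX // aut_xvar.
have μo P : max_ideal P (ι ('X - 0%:P)) -> `|order_at P (x ^+ (u %/ d))|%N =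
    (u %/ d * `|order_at P (ι ('X - 0%:P))|)%N.
  by move=> _; rewrite XsubC_in rmorph0 subr0 order_atX // abszM absz_nat.
have ym P : max_ideal P (ι ('X - 0%:P)) -> max_ideal P (y ^+ N / (x ^+ (u %/ d)) ^+ d - κ α).
  move=> Pm; rewrite -exprM du y_pow_ratio.
  have -> : ι (- ('X^u * A ^+ v)) / ι B / x ^+ u = ι (- A ^+ v) / ι B.
    have -> : ι (- ('X^u * A ^+ v)) = x ^+ u * ι (- A ^+ v).
      by rewrite !rmorphN rmorphM rmorphXn mulrN.
    by rewrite mulrAC [x ^+ u * _]mulrC mulfK // expf_neq0.
  have := ratio_residue B00 (poly_residue (- A ^+ v) Pm) (poly_residue B Pm).
  by rewrite hornerN horner_exp.
have θb σ : base_automorphism σ -> σ (ι ('X - 0%:P)) = ι ('X - 0%:P).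
  by move=> σP; rewrite aut_poly.
split.
  move=> P; apply: (degree_one_power α0 deN ym).
by apply: (kummer_places yp L_gen dimN yn0 (XsubC_neq0 0) (XsubC_growth 0) μ0 α0 deN co θb μb μo ym);
  apply: exists_place_XsubC.
Qed.

Let X := 'X^u * A ^+ v.
Hypothesis size_BX : (size B <= size X)%N.
Let D := (size X - size B)%N.
Hypothesis gcd_D : gcdn D N = d.

(** As over 0, with the degree D of the radicand in place of u and leading coefficients in place of
    values at 0. *)
Lemma places_at_infinity (α := - lead_coef A ^+ v / lead_coef B) :
  (forall P, max_ideal P x^-1 -> place_degree P = 1%N -> is_power_unit d α) /\
  (is_power_unit d α ->
   exists s, [/\ uniq s, size s = d, forall P, P \in s <-> max_ideal P x^-1 &
     forall P, P \in s -> place_degree P = 1%N]).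
Proof.
have x0 := xvar_neq0 L.
have deN : (d * (N %/ d) = N)%N by rewrite mulnC divnK.
have du : (D %/ d * d = D)%N by rewrite divnK // -gcd_D dvdn_gcdl.
have co : coprime (N %/ d) (D %/ d) by rewrite -gcd_D coprime_divn_gcd // card_predn_gt0.
have lB : lead_coef B != 0 by rewrite lead_coef_eq0.
have X0 : X != 0 by rewrite mulf_neq0 ?expf_neq0 ?polyX_eq0.
have α0 : α != 0 by rewrite mulf_neq0 ?invr_neq0 // oppr_eq0 expf_neq0 // lead_coef_eq0.
have μ0 : x ^+ (D %/ d) != 0 by rewrite expf_neq0.
have μb σ : base_automorphism σ -> σ (x ^+ (D %/ d)) = x ^+ (D %/ d).
  by move=> σP; rewrite autX // aut_xvar.
have μo P : max_ideal P x^-1 -> `|order_at P (x ^+ (D %/ d))|%N =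
    (D %/ d * `|order_at P x^-1|)%N.
  by move=> _; rewrite order_atX // order_atV // abszM absz_nat abszN.
have infP P : max_ideal P x^-1 -> ~ val_ring P x.
  move=> xm xO; apply: (@not_max_ideal1 _ _ P).
  by rewrite -(mulfV x0); apply: max_idealM.
have ym P : max_ideal P x^-1 -> max_ideal P (y ^+ N / (x ^+ (D %/ d)) ^+ d - κ α).
  move=> Pm; rewrite -exprM du y_pow_ratio -/X.
  have nX0 : - X != 0 by rewrite oppr_eq0.
  have := ratio_residue lB (infinite_place_lead (infP P Pm) nX0) (infinite_place_lead (infP P Pm) B0).
  rewrite lead_coefN /X lead_coefM lead_coefXn mul1r lead_coef_exp -/X size_polyN.
  suff -> : ι (- X) / x ^+ (size X).-1 / (ι B / x ^+ (size B).-1) = ι (- X) / ι B / x ^+ D by [].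
  have -> : (size X).-1 = (D + (size B).-1)%N.
    by rewrite /D -!subn1 addnBA ?subnK // ltnW.
  rewrite exprD; field; rewrite poly_in_eq0 B0 !expf_neq0 //.
have θb σ : base_automorphism σ -> σ x^-1 = x^-1 by move=> σP; rewrite autV // aut_xvar.
split.
  move=> P; apply: (degree_one_power α0 deN ym).
apply: (kummer_places yp L_gen dimN yn0 (xvarV_neq0 L) (growth_infinity L) μ0 α0 deN co θb μb μo ym).
by have [P fP] := exists_infinite_place L; exists P; apply: max_ideal_xvarV; apply: elimN fP; apply: asboolP.
Qed.

End KummerRationalPoints.

(** * Counting the places of degree one *)

Section RationalPointCount.

Variables (F : finFieldType) (L : fieldExtType {fraction {poly F}}).
Local Notation ι := (@poly_in F L).
Local Notation κ := (const_in L).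
Local Notation x := (xvar L).
Local Notation N := (#|F|.-1).
Implicit Types (P : place L) (c : F).
Variables (y : L) (A B : {poly F}) (u v d : nat).
Hypotheses (A0 : A != 0) (B_size : (1 < size B)%N).
Hypothesis sqfree : forall π : {poly F}, (1 < size π)%N -> ~~ (π ^+ 2 %| 'X * A * B).
Hypothesis yE : y ^+ N * ι B = - ι ('X^u * A ^+ v).
Hypothesis L_gen : <<1; y>>%VS = fullv.
Hypothesis gcd_u : gcdn u N = d.
Hypothesis size_BX : (size B <= size ('X^u * A ^+ v)%R)%N.
Hypothesis gcd_D : gcdn (size ('X^u * A ^+ v)%R - size B) N = d.
Hypothesis splits : forall c, c != 0 -> - (c ^+ u * A.[c] ^+ v) = B.[c] /\ B.[c] != 0.
Hypotheses (A00 : A.[0] != 0) (B00 : B.[0] != 0).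
Let α0 := - A.[0] ^+ v / B.[0].
Let αoo := - lead_coef A ^+ v / lead_coef B.

Lemma degree_one_center P : place_degree P = 1%N ->
  (exists c, max_ideal P (ι ('X - c%:P))) \/ max_ideal P x^-1.
Proof.
move=> P1; have [xO|/max_ideal_xvarV] := pselect (val_ring P x); last by right.
by left; have [c cm] := degree_one_residue P1 xO; exists c; rewrite XsubC_in.
Qed.

Lemma center_inj P c c' : max_ideal P (ι ('X - c%:P)) -> max_ideal P (ι ('X - c'%:P)) ->
  c = c'.
Proof.
rewrite !XsubC_in => cm cm'; apply/eqP; rewrite eq_sym -subr_eq0; apply/eqP.
apply: (@max_ideal_const _ L P); rewrite rmorphB.
have -> : κ c' - κ c = (x - κ c) - (x - κ c').
  by rewrite opprB [RHS]addrC addrA subrK.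
exact: max_idealB.
Qed.

Lemma center_not_infinite P c : max_ideal P (ι ('X - c%:P)) -> ~ max_ideal P x^-1.
Proof.
move=> /finite_of_XsubC/asboolP xO xm; apply: (@not_max_ideal1 _ _ P).
by rewrite -(mulfV (xvar_neq0 L)); apply: max_idealM.
Qed.

Lemma split_places : exists s, [/\ uniq s, size s = (N * N)%N,
  forall P, P \in s <-> exists2 c, c != 0 & max_ideal P (ι ('X - c%:P)) &
  forall P, P \in s -> place_degree P = 1%N].
Proof.
have /choice[S SP] : forall c, exists s, c != 0 -> [/\ uniq s, size s = N,
    forall P, P \in s <-> max_ideal P (ι ('X - c%:P)) &
    forall P, P \in s -> place_degree P = 1%N].
  move=> c; have [->|c0] := eqVneq c 0; first by exists [::].
  have [fc Bc] := splits c0.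
  by have [s sP] := places_at_split A0 B_size sqfree yE L_gen fc Bc; exists s.
have en c : (c \in enum (predC1 (0 : F))) = (c != 0) by rewrite mem_enum.
pose s := flatten [seq S c | c <- enum (predC1 (0 : F))].
have sE P : P \in s <-> exists2 c, c != 0 & P \in S c.
  split=> [/flattenP[s' /mapP[c]]|[c c0 Pc]].
    by rewrite en => c0 -> Pc; exists c.
  by apply/flattenP; exists (S c) => //; apply: map_f; rewrite en.
exists s; split.
- apply: uniq_flatten_disjoint; first exact: enum_uniq.
    by move=> c; rewrite en => c0; have [] := SP c c0.
  move=> c c' P; rewrite !en => c0 c'0; have [_ _ Sc _] := SP c c0.
  by have [_ _ Sc' _] := SP c' c'0; move=> /Sc cm /Sc' cm'; apply: center_inj cm cm'.
- rewrite /s size_flatten /shape -map_comp sumnE big_map.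
  rewrite (eq_big_seq (fun=> N)); last by move=> c; rewrite en => c0; have [] := SP c c0.
  by rewrite big_const_seq count_predT iter_addn_0 -cardE cardC1.
- move=> P; rewrite sE; split=> -[c c0]; have [_ _ Sc _] := SP c c0; move/Sc => Pc; by exists c.
by move=> P /sE[c c0 Pc]; have [_ _ _] := SP c c0; apply.
Qed.

(** A place of degree one lies over some c in F or over infinity. The nonzero c always give N N
    places; 0 and infinity give d each or none, together by the assumed equivalence. *)
Theorem card_rational_points : (is_power_unit d α0 <-> is_power_unit d αoo) ->
  (~ is_power_unit d α0 -> rational_points L #= `I_(N * N)) /\
  (is_power_unit d α0 -> rational_points L #= `I_(N * N + 2 * d)).
Proof.
move=> αE; have [s [us ss sP s1]] := split_places.
have [z1 z2] := places_at_zero A0 B_size sqfree yE L_gen gcd_u A00 B00.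
have [i1 i2] := places_at_infinity A0 B_size sqfree yE L_gen gcd_u size_BX gcd_D.
rewrite -/α0 in z1 z2; rewrite -/αoo in i1 i2.
split=> [nα|α]; last first.
  have [s0 [us0 ss0 s0P s01]] := z2 α.
  have [s' [us' ss' s'P s'1]] := i2 (αE.1 α).
  have -> : (N * N + 2 * d)%N = size (s ++ s0 ++ s') by rewrite !size_cat ss ss0 ss' mul2n addnn.
  apply: card_uniq_seq.
    rewrite !cat_uniq us us0 us' /= andbT; apply/andP; split; apply/hasPn => P.
      rewrite mem_cat => /orP[/s0P P0|/s'P Poo]; apply/negP => /sP[c c0 Pc].
        by rewrite (center_inj Pc P0) eqxx in c0.
      exact: (center_not_infinite Pc Poo).
    by move=> /s'P Poo; apply/negP => /s0P P0; apply: (center_not_infinite P0 Poo).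
  move=> P; rewrite !mem_cat; split=> [P1|/or3P[/s1|/s01|/s'1]] //.
  case: (degree_one_center P1) => [[c cm]|oom]; last by apply/or3P/Or33/s'P.
  have [c0|c0] := eqVneq c 0; last by apply/or3P/Or31/sP; exists c.
  by apply/or3P/Or32/s0P; rewrite -c0.
rewrite -ss; apply: card_uniq_seq => // P; split=> [P1|/s1] //.
case: (degree_one_center P1) => [[c cm]|oom]; last by case: nα; apply/αE/(i1 P).
have [c0|c0] := eqVneq c 0; last by apply/sP; exists c.
by case: nα; apply: (z1 P) => //; rewrite -c0.
Qed.

End RationalPointCount.

(** * The curve *)

(** With t = p^k this divides N by t - 1 with remainder term p - 1, which gives gcd(t - 1, N). *)
Lemma pred_mul_square p t : (0 < p)%N -> (0 < t)%N ->
  (p * t * t).-1 = (p * t.+1 * t.-1 + p.-1)%N.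
Proof. by case: p => // p _; case: t => // t _ /=; lia. Qed.

Lemma subn_mul_pred r s : (0 < r)%N -> (0 < s)%N -> (r * s - s + s.-1 = (r * s).-1)%N.
Proof. by case: r => // r _; case: s => // s _ /=; lia. Qed.

Lemma addn_pred_mul r s : (0 < r)%N -> (0 < s)%N -> (s.-1 + r.-1 * s = (r * s).-1)%N.
Proof. by case: r => // r _; case: s => // s _ /=; lia. Qed.

Section CurveData.

Variables (F : finFieldType) (p k : nat) (a : F).
Local Notation N := (#|F|.-1).
Local Notation s := (p ^ k)%N.
Local Notation r := (p ^ k.+1)%N.
Hypotheses (p_prime : prime p) (k_gt0 : (0 < k)%N) (card_F : #|F| = (p ^ k.*2.+1)%N).
Hypotheses (a_neq0 : a != 0) (a_nonpower : ~ is_power_unit (s - 1) a).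

(* The right-hand side of the equation of the curve is - x^(s-1) A^s / B, with A
   and B the following polynomials. *)
Definition curve_num : {poly F} := 'X^(r.-1) - (a ^+ r)%:P.
Definition curve_den : {poly F} := a *: ('X^(s.-1) - (a^-1)%:P).
Local Notation A := curve_num.
Local Notation B := curve_den.

Lemma card_curve_field : (r * s)%N = #|F|.
Proof. by rewrite card_F -expnD addSn addnn. Qed.

Lemma expp_gt0 : (0 < s)%N. Proof. by rewrite expn_gt0 prime_gt0. Qed.
Lemma exppS_gt0 : (0 < r)%N. Proof. by rewrite expn_gt0 prime_gt0. Qed.

Lemma expp_gt1 : (1 < s)%N.
Proof. by rewrite -(expn0 p) ltn_exp2l // prime_gt1. Qed.

Lemma exppS_gt1 : (1 < r)%N.
Proof. by rewrite -(expn0 p) ltn_exp2l // prime_gt1. Qed.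

Lemma card_field_pred : #|F| = N.+1.
Proof. by rewrite prednK // (ltn_trans _ (finRing_gt1 F)). Qed.

Lemma pcharF : p \in [pchar F].
Proof.
rewrite inE p_prime /=; have := card_natr F; rewrite card_F natrX => /eqP.
by rewrite expf_eq0 => /andP[].
Qed.

Lemma frobeniusB (R : comNzRingType) n (z w : R) : p \in [pchar R] ->
  (z - w) ^+ (p ^ n) = z ^+ (p ^ n) - w ^+ (p ^ n).
Proof.
move=> pR; have pn : [pchar R].-nat (p ^ n)%N by rewrite pnatX pnatE // pR.
by rewrite exprDn_pchar // exprNn_pchar.
Qed.

Lemma curve_num_size : size A = r.
Proof. by rewrite size_XnsubC ?prednK // -?subn1 ?subn_gt0 ?exppS_gt1 // ltnW ?exppS_gt1. Qed.

Lemma curve_den_size : size B = s.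
Proof. by rewrite size_scale // size_XnsubC ?prednK // -?subn1 ?subn_gt0 ?expp_gt1 // ltnW ?expp_gt1. Qed.

Lemma XA_eq : 'X * A = 'X^r - a ^+ r *: 'X.
Proof. by rewrite mulrBr -exprS prednK ?(ltnW exppS_gt1) // mulrC mul_polyC. Qed.

Lemma XB_eq : 'X * B = a *: 'X^s - 'X.
Proof.
rewrite -scalerAr mulrBr -exprS prednK ?(ltnW expp_gt1) // scalerBr; congr (_ - _).
by rewrite mulrC mul_polyC scalerA mulfV // scale1r.
Qed.

(** Frobenius with r s = q and a^q = a. Adding X B gives X^q - X, on which [coprimep_num_den]
    rests. *)
Lemma XA_pow : ('X * A) ^+ s = 'X^(#|F|) - a *: 'X^s.
Proof.
rewrite XA_eq frobeniusB ?pchar_poly ?pcharF // -exprM card_curve_field exprZn -exprM card_curve_field.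
by rewrite expf_card.
Qed.

(** A root c satisfies c^(s-1) = a^-1, which would make a the (s-1)-th power of c^-1, against
    [a_nonpower]. *)
Lemma curve_den_noroot c : B.[c] != 0.
Proof.
rewrite hornerZ mulf_neq0 // !hornerE subr_eq0; apply/eqP => cE; apply: a_nonpower.
have c0 : c != 0.
  apply/eqP => c0; move: cE a_neq0; rewrite c0 expr0n gtn_eqF ?eqxx //.
    by move/esym/eqP; rewrite invr_eq0 => ->.
  by rewrite -subn1 subn_gt0 expp_gt1.
by exists c^-1; rewrite ?invr_neq0 // subn1 exprVn cE invrK.
Qed.

(** A common divisor of A and B divides (X A)^s + X B = X^q - X, a product of linear factors over F,
    whereas B has no root in F. *)
Lemma coprimep_num_den : coprimep A B.
Proof.
rewrite /coprimep size_poly_eq1; set D := gcdp A B.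
have DQ : D %| 'X^(#|F|) - 'X.
  have -> : 'X^(#|F|) - 'X = ('X * A) ^+ s + 'X * B :> {poly F}.
    by rewrite XA_pow XB_eq addrA subrK.
  apply: dvdp_add; last by rewrite dvdp_mull // dvdp_gcdr.
  by rewrite -(prednK (ltnW expp_gt1)) exprS -mulrA mulrCA dvdp_mulr // dvdp_gcdl.
suff cop : coprimep D ('X^(#|F|) - 'X) by exact: (coprimepP _ _ cop D (dvdpp D) DQ).
rewrite finField_genPoly; elim/big_ind: _ => [|f g Df Dg|c _].
- exact: coprimep1.
- by rewrite coprimepMr Df.
rewrite coprimep_XsubC root_gcd negb_and; apply/orP; right.
exact: curve_den_noroot.
Qed.

Lemma coprimep_const (f : {poly F}) (c : F) : c != 0 -> coprimep f c%:P.
Proof. by move=> c0; rewrite -[c%:P]mulr1 mul_polyC coprimepZr // coprimep1. Qed.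

Lemma natr_pX n : (0 < n)%N -> (p ^ n)%:R = 0 :> F.
Proof. by move=> n0; rewrite natrX (pcharf0 pcharF) expr0n gtn_eqF. Qed.

(** X A and X B have nonzero constant derivatives, hence are separable; coprimality of A and B joins
    them. *)
Lemma curve_sqfree (π : {poly F}) : (1 < size π)%N -> ~~ (π ^+ 2 %| 'X * A * B).
Proof.
move=> sπ; apply/negP; rewrite separable_nosquare //; last by rewrite gtn_eqF.
have sXA : separable_poly ('X * A).
  have dE : ('X * A)^`() = (- a ^+ r)%:P.
    rewrite XA_eq derivB derivXn derivZ derivX -mulr_natr -polyC_natr natr_pX // mulr0 sub0r.
    by rewrite polyCN -mul_polyC mulr1.
  by rewrite unlock dE coprimep_const // oppr_eq0 expf_neq0.
have sXB : separable_poly ('X * B).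
  have dE : ('X * B)^`() = (- 1)%:P.
    rewrite XB_eq derivB derivZ derivXn derivX -mulr_natr -polyC_natr natr_pX // mulr0 scaler0 sub0r.
    by rewrite polyCN.
  by rewrite unlock dE coprimep_const // oppr_eq0 oner_eq0.
move: sXB; rewrite !separable_mul => /and3P[_ sB XB].
by move: sXA; rewrite separable_mul => ->; rewrite sB coprimepMl XB coprimep_num_den.
Qed.

Lemma gcd_s_N : gcdn s N = 1%N.
Proof.
have : coprime (r * s) N by rewrite card_curve_field card_field_pred coprimeSn.
by rewrite coprimeMl => /andP[_ /eqP].
Qed.

Lemma gcd_s1_N : gcdn s.-1 N = p.-1.
Proof.
have -> : N = (p * s.+1 * s.-1 + p.-1)%N.
  by rewrite -pred_mul_square ?expp_gt0 ?prime_gt0 // -expnS card_curve_field.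
rewrite gcdnMDl; apply/gcdn_idPr; exact: dvdn_pred_predX.
Qed.

Lemma size_num_full : size ('X^(s.-1) * A ^+ s) = (r * s)%N.
Proof.
have A0 : A != 0 by rewrite -size_poly_gt0 curve_num_size ltnW // exppS_gt1.
rewrite size_mul ?expf_neq0 ?polyX_eq0 // size_polyXn.
have -> : size (A ^+ s) = (r.-1 * s).+1.
  by rewrite -curve_num_size -size_exp prednK // size_poly_gt0 expf_neq0.
by rewrite addSn addnS /= addn_pred_mul ?exppS_gt0 ?expp_gt0 // prednK // muln_gt0 exppS_gt0 expp_gt0.
Qed.

(** The degree r s - s and s - 1 add up to N, so they have the same gcd with N. *)
Lemma gcd_D_N : gcdn (r * s - s) N = p.-1.
Proof.
have e : (r * s - s + s.-1)%N = N.
  by rewrite subn_mul_pred ?exppS_gt0 ?expp_gt0 // card_curve_field.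
by rewrite -gcd_s1_N -e gcdnDl [in RHS]gcdnDr gcdnC.
Qed.

(** By Frobenius A(c)^s = c^((r-1)s) - a, so c^(s-1) A(c)^s = c^N - a c^(s-1) = 1 - a c^(s-1) = -
    B(c). *)
Lemma curve_splits c : c != 0 -> - (c ^+ s.-1 * A.[c] ^+ s) = B.[c] /\ B.[c] != 0.
Proof.
move=> c0; split; last exact: curve_den_noroot.
rewrite /A /B !hornerE frobeniusB ?pcharF // -!exprM card_curve_field expf_card.
rewrite mulrBr -exprD mulrBr mulfV //.
have -> : (s.-1 + r.-1 * s)%N = N.
  by rewrite addn_pred_mul ?exppS_gt0 ?expp_gt0 // card_curve_field.
by rewrite expf_card_pred // opprB mulrC.
Qed.

Lemma curve_num0 : A.[0] = - a ^+ r.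
Proof. by rewrite /A !hornerE expr0n gtn_eqF ?sub0r // -subn1 subn_gt0 exppS_gt1. Qed.

Lemma curve_den0 : B.[0] = - 1.
Proof. by rewrite /B !hornerE expr0n gtn_eqF ?sub0r ?mulrN ?mulfV // -subn1 subn_gt0 expp_gt1. Qed.

Lemma alpha0E : - A.[0] ^+ s / B.[0] = - a.
Proof.
(* Frobenius applied to 0 - a^r settles the sign for even and odd p at once. *)
rewrite curve_num0 curve_den0 invrN1 mulrN1 opprK -[- a ^+ r]sub0r frobeniusB ?pcharF //.
by rewrite -exprM card_curve_field expf_card expr0n gtn_eqF ?sub0r // ltnW // expp_gt1.
Qed.

Lemma alphaooE : - lead_coef A ^+ s / lead_coef B = (- a)^-1.
Proof.
rewrite /A /B lead_coefZ !lead_coefXnsubC -?subn1 ?subn_gt0 ?exppS_gt1 ?expp_gt1 //.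
by rewrite expr1n mulr1 invrN mulNr mul1r.
Qed.

End CurveData.

Lemma half_intr (g : int) (r s q p : nat) :
  g * 2 = (r%:Z + s%:Z - 2) * (q%:Z - 2) - 2 * p%:Z + 4 ->
  g%:~R = 1 / 2 * ((r%:R + s%:R - 2) * (q%:R - 2) - 2 * p%:R + 4) :> rat.
Proof.
move=> gE; have -> : (r%:R + s%:R - 2) * (q%:R - 2) - 2 * p%:R + 4 = (g * 2)%:~R :> rat.
  by rewrite gE !(rmorphD, rmorphN, rmorphM).
by rewrite rmorphM /=; field.
Qed.

(** The term 2 N of [sum_pole_slack] cancels against - 2 N, and 2 - 2 (p - 1) is the constant - 2 p
    + 4. *)
Lemma double_genus (S r s q p : nat) : (0 < p)%N -> (1 < q)%N -> (1 < r)%N -> (1 < s)%N ->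
  (2 * S + 2 * p.-1 = 2 * (q - 1) + (r + s - 2) * (q - 1).-1)%N ->
  (S%:Z + 1 - (q - 1)%N%:Z) * 2 = (r%:Z + s%:Z - 2) * (q%:Z - 2) - 2 * p%:Z + 4.
Proof.
case: p => // p _; case: q => [|[|q]] // _; case: r => [|r] // _; case: s => [|s] // _.
have -> : (r.+1 + s.+1 - 2 = r + s)%N by rewrite addSn addnS subSS subn1.
by rewrite subSS subn0 -pred_Sn -pred_Sn => h; lia.
Qed.

Lemma oppr_div_cancel (E : fieldType) (z u w b : E) : z != 0 -> b != 0 ->
  - (z * u * w) / (z * b) * b = - (u * w).
Proof. by move=> z0 b0; field; rewrite z0 b0. Qed.

Theorem mainTheorem4 (p m q : nat) (F : finFieldType) (a : F)
    (L : fieldExtType {fraction {poly F}}) (y : L)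
    (p_prime : prime p) (m_ge3 : (3 <= m)%N) (m_odd : odd m)
    (q_def : q = (p ^ m)%N) (card_F : #|F| = q)
    (a_neq0 : a != 0)
    (a_nonpower : ~ is_power_unit (p ^ m.-1./2 - 1) a)
    (L_gen : <<1; y>>%VS = fullv)
    (y_eq : y ^+ (q - 1) =
       - (xvar L ^+ (p ^ m.+1./2) - const_in L a ^+ (p ^ m.+1./2) * xvar L)
           ^+ (p ^ m.-1./2)
       / (const_in L a * xvar L ^+ (p ^ m.-1./2) - xvar L)) :
  (exists g : int, has_genus L g /\
     g%:~R = 1 / 2 * (((p ^ m.+1./2)%:R + (p ^ m.-1./2)%:R - 2) * (q%:R - 2)
                      - 2 * p%:R + 4) :> rat) /\
  (~ is_power_unit (p - 1) (- a) ->
     rational_points L #= `I_((q - 1) ^ 2)) /\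
  (is_power_unit (p - 1) (- a) ->
     rational_points L #= `I_((q - 1) ^ 2 + 2 * (p - 1))).
Proof.
have mE : m = m.-1./2.*2.+1.
  have e : m = m./2.*2.+1 by rewrite -[LHS]odd_double_half m_odd.
  have -> : m.-1./2 = m./2 by rewrite {1}e /= doubleK.
  exact: e.
set k := m.-1./2 in a_nonpower y_eq mE *.
have k_gt0 : (0 < k)%N by move: m_ge3; rewrite mE; case: (k).
have hk : m.+1./2 = k.+1 by rewrite mE /= doubleK.
rewrite hk in y_eq *.
have cardF : #|F| = (p ^ k.*2.+1)%N by rewrite card_F q_def -mE.
have qE : #|F|.-1 = (q - 1)%N by rewrite card_F subn1.
have s1 := expp_gt1 p_prime k_gt0; have r1 := exppS_gt1 k p_prime.
pose A := curve_num p k a; pose B := curve_den p k a.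
have sA := curve_num_size k a p_prime : size A = _.
have sB := curve_den_size p_prime k_gt0 a_neq0 : size B = _.
have A0 : A != 0 by rewrite -size_poly_gt0 sA ltnW.
have B_size : (1 < size B)%N by rewrite sB.
have sqfree := curve_sqfree p_prime k_gt0 cardF a_neq0 a_nonpower : forall π : {poly F}, _ -> ~~ (_ %| 'X * A * B).
have x0 := xvar_neq0 L.
have B0 : poly_in L B != 0 by rewrite poly_in_eq0 B_neq0.
have yE : y ^+ #|F|.-1 * poly_in L B = - poly_in L ('X^((p ^ k).-1) * A ^+ (p ^ k)).
  have XE (C : {poly F}) : xvar L * poly_in L C = poly_in L ('X * C).
    by rewrite rmorphM /= -xvarE.
  have numE : xvar L ^+ (p ^ k.+1) - const_in L a ^+ (p ^ k.+1) * xvar L = xvar L * poly_in L A.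
    rewrite XE (XA_eq k a p_prime) rmorphB rmorphXn /= -mul_polyC rmorphM /= -xvarE -const_inE.
    by rewrite rmorphXn.
  have denE : const_in L a * xvar L ^+ (p ^ k) - xvar L = xvar L * poly_in L B.
    rewrite XE (XB_eq p_prime k_gt0 a_neq0) rmorphB /= -mul_polyC rmorphM rmorphXn /= -xvarE -const_inE.
    by [].
  have xs : xvar L ^+ (p ^ k) = xvar L * xvar L ^+ (p ^ k).-1 by rewrite -exprS prednK // ltnW.
  have fullE : poly_in L ('X^((p ^ k).-1) * A ^+ (p ^ k)) = xvar L ^+ (p ^ k).-1 * poly_in L A ^+ (p ^ k).
    by rewrite rmorphM !rmorphXn /= -xvarE.
  rewrite qE y_eq numE denE fullE exprMn xs.
  exact: oppr_div_cancel.
have gcd_u := gcd_s1_N p_prime cardF.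
have dimS : size ('X^((p ^ k).-1) * A ^+ (p ^ k)) = (p ^ k.+1 * p ^ k)%N by apply: size_num_full.
split; last first.
  have size_BX : (size B <= size ('X^((p ^ k).-1) * A ^+ (p ^ k))%R)%N.
    by rewrite sB dimS leq_pmull // ltnW.
  have gcd_D : gcdn (size ('X^((p ^ k).-1) * A ^+ (p ^ k))%R - size B) #|F|.-1 = p.-1.
    by rewrite dimS sB; apply: gcd_D_N.
  have spl : forall c, c != 0 -> - (c ^+ (p ^ k).-1 * A.[c] ^+ (p ^ k)) = B.[c] /\ B.[c] != 0.
    by move=> c c0; apply: curve_splits.
  have A00 : A.[0] != 0 by rewrite /A curve_num0 // oppr_eq0 expf_neq0.
  have B00 : B.[0] != 0 by rewrite /B curve_den0 // oppr_eq0 oner_eq0.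
  have := card_rational_points A0 B_size sqfree yE L_gen gcd_u size_BX gcd_D spl A00 B00.
  rewrite (alpha0E p_prime k_gt0 cardF a_neq0) (alphaooE a p_prime k_gt0) qE -!subn1 mulnn.
  (* The residues over 0 and infinity, - a and its inverse, are (p-1)-th powers simultaneously. *)
  apply; split=> -[b b0 bE]; exists b^-1; rewrite ?invr_neq0 // exprVn -?bE //.
  by rewrite invrK.
have := genus_kummer A0 B_size sqfree yE L_gen; set g := (_ + 1 - _) => gP; exists g; split=> //.
have := sum_pole_slack sA sB (ltnW r1) (ltnW s1) (card_curve_field cardF) (gcd_s_N cardF) gcd_u.
have p0 := prime_gt0 p_prime; have q2 : (1 < q)%N by rewrite -card_F finRing_gt1.
rewrite /g; set S := (\sum_(_ < _) _)%N; rewrite qE => sE.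
have gE : (S%:Z + 1 - (q - 1)%N%:Z) * 2 =
    ((p ^ k.+1)%N%:Z + (p ^ k)%N%:Z - 2) * (q%:Z - 2) - 2 * p%:Z + 4.
  by apply: double_genus sE; rewrite // ltnW.
exact: half_intr gE.
Qed.
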